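(* Let $A>0$. For $f\in PW_A^2(\mathbb{H})$, we have $$f(\mathbf{q})=\sum_{k\in\mathbb{Z}}\operatorname{sinc}\!\left(\frac{A\mathbf{q}}{\pi}-k\right)f\!\left(\frac{\pi k}{A}\right),\qquad \mathbf{q}\in\mathbb{H}.$$ Moreover, the convergence is absolute and uniform on $\Omega_M=\{\mathbf{q}=x+Jy\in\mathbb{H}: x\in\mathbb{R},\ J\in\mathbb{S},\ |y|<M\}$ for every $0<M<\infty$, and on compact sets of $\mathbb{H}$.
   Context: $\mathbb{H}$ denotes the real quaternions with the usual norm, $\mathbb{S}=\{I\in\mathbb{H}: I^2=-1\}$, and $\mathbb{C}_I=\{x+Iy:x,y\in\mathbb{R}\}$ for $I\in\mathbb{S}$. Left slice regular: a real differentiable function $f:\mathbb{H}\to\mathbb{H}$ is left slice regular (written $f\in\mathscr{R}_l(\mathbb{H})$) if for every $I\in\mathbb{S}$ its restriction $f_I$ to $\mathbb{C}_I$ satisfies $\frac12\left(\frac{\partial}{\partial x}+I\frac{\partial}{\partial y}\right)f_I(x+Iy)=0$. Fourier transform: for $I\in\mathbb{S}$ and $F:\mathbb{R}\to\mathbb{H}$ in $L^1(\mathbb{R})$, $\mathscr{F}_I(F)(t)=\frac{1}{\sqrt{2\pi}}\int_{\mathbb{R}}e^{-Ixt}F(x)\,dx$ (exponential on the left), extended to $L^2(\mathbb{R})$ in the usual way; supports are in the almost-everywhere sense. Slice regular Paley-Wiener space: $PW_A^2(\mathbb{H})=\{f\in\mathscr{R}_l(\mathbb{H}): f|_{\mathbb{R}}\in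 L^2(\mathbb{R}),\ \operatorname{supp}\mathscr{F}_I(f|_{\mathbb{R}})\subset[-A,A]\text{ for every }I\in\mathbb{S}\}$. The quaternionic sinc function is $\operatorname{sinc}(\mathbf{q})=\sum_{k=0}^{\infty}\mathbf{q}^{2k}\frac{(-\pi^2)^k}{(2k+1)!}$, $\mathbf{q}\in\mathbb{H}$. *)

(* Defs.v *)
From HB Require Import structures.
From mathcomp Require Import all_boot all_order all_algebra.
From mathcomp Require Import all_classical all_reals all_analysis.
From mathcomp Require Import ring lra.
From mathcomp Require summability.

Set Implicit Arguments.
Unset Strict Implicit.
Unset Printing Implicit Defensive.
Import Order.TTheory GRing.Theory Num.Theory.
Import numFieldNormedType.Exports.
Local Open Scope classical_set_scope.
Local Open Scope ring_scope.

(* [Quat a b c d] is a + b i + c j + d k. *)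
Record quat (R : realType) := Quat { qre : R; qi : R; qj : R; qk : R }.
Arguments qre {R} _.
Arguments qi {R} _.
Arguments qj {R} _.
Arguments qk {R} _.

Section quaternion_algebra.
Variable R : realType.
Implicit Types p q r : quat R.

Definition quat_tuple q := (qre q, qi q, qj q, qk q).
Definition tuple_quat (t : R * R * R * R) : quat R :=
  Quat t.1.1.1 t.1.1.2 t.1.2 t.2.

Lemma quat_tupleK : cancel quat_tuple tuple_quat.
Proof. by case. Qed.

HB.instance Definition _ := Choice.copy (quat R) (can_type quat_tupleK).

Definition addq p q :=
  Quat (qre p + qre q) (qi p + qi q) (qj p + qj q) (qk p + qk q).
Definition oppq p := Quat (- qre p) (- qi p) (- qj p) (- qk p).
Definition scaleq (a : R) q := Quat (a * qre q) (a * qi q) (a * qj q) (a * qk q).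
Definition mulq p q :=
  Quat (qre p * qre q - qi p * qi q - qj p * qj q - qk p * qk q)
       (qre p * qi q + qi p * qre q + qj p * qk q - qk p * qj q)
       (qre p * qj q - qi p * qk q + qj p * qre q + qk p * qi q)
       (qre p * qk q + qi p * qj q - qj p * qi q + qk p * qre q).
Definition normq q :=
  Num.sqrt (qre q ^+ 2 + qi q ^+ 2 + qj q ^+ 2 + qk q ^+ 2).

Fact addqA : associative addq.
Proof. by move=> [????] [????] [????]; rewrite /addq /= !addrA. Qed.
Fact addqC : commutative addq.
Proof. by move=> [a b c d] [????]; rewrite /addq /= addrC [b + _]addrC [c + _]addrC [d + _]addrC. Qed.
Fact add0q : left_id (Quat 0 0 0 0) addq.
Proof. by move=> [????]; rewrite /addq /= !add0r. Qed.
Fact addNq : left_inverse (Quat 0 0 0 0) oppq addq.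
Proof. by move=> [????]; rewrite /addq /oppq /= !addNr. Qed.

HB.instance Definition _ :=
  GRing.isZmodule.Build (quat R) addqA addqC add0q addNq.

Fact mulqA : associative mulq.
Proof. by move=> [????] [????] [????]; rewrite /mulq /=; congr Quat; ring. Qed.
Fact mul1q : left_id (Quat 1 0 0 0) mulq.
Proof. by move=> [????]; rewrite /mulq /=; congr Quat; ring. Qed.
Fact mulq1 : right_id (Quat 1 0 0 0) mulq.
Proof. by move=> [????]; rewrite /mulq /=; congr Quat; ring. Qed.
Fact mulqDl : left_distributive mulq addq.
Proof. by move=> [????] [????] [????]; rewrite /mulq /addq /=; congr Quat; ring. Qed.
Fact mulqDr : right_distributive mulq addq.
Proof. by move=> [????] [????] [????]; rewrite /mulq /addq /=; congr Quat; ring. Qed.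
Fact oneq_neq0 : Quat 1 0 0 0 != 0 :> quat R.
Proof. by apply/eqP => -[] /eqP; rewrite oner_eq0. Qed.

HB.instance Definition _ := GRing.Zmodule_isNzRing.Build (quat R)
  mulqA mul1q mulq1 mulqDl mulqDr oneq_neq0.

Fact scaleqA a b q : scaleq a (scaleq b q) = scaleq (a * b) q.
Proof. by case: q => *; rewrite /scaleq /= !mulrA. Qed.
Fact scale1q : left_id 1 scaleq.
Proof. by move=> [????]; rewrite /scaleq /= !mul1r. Qed.
Fact scaleqDr : right_distributive scaleq +%R.
Proof. by move=> ? [????] [????]; rewrite /scaleq /= !mulrDr. Qed.
Fact scaleqDl q : {morph scaleq^~ q : a b / a + b}.
Proof. by case: q => ???? a b; rewrite /scaleq /= !mulrDl. Qed.

HB.instance Definition _ := GRing.Zmodule_isLmodule.Build R (quat R)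
  scaleqA scale1q scaleqDr scaleqDl.

Fact scaleqAl (a : R) p q : a *: (p * q) = (a *: p) * q.
Proof. by case: p => ????; case: q => ????; congr Quat => /=; ring. Qed.
HB.instance Definition _ := GRing.Lmodule_isLalgebra.Build R (quat R) scaleqAl.
Fact scaleqAr (a : R) p q : a *: (p * q) = p * (a *: q).
Proof. by case: p => ????; case: q => ????; congr Quat => /=; ring. Qed.
HB.instance Definition _ := GRing.Lalgebra_isAlgebra.Build R (quat R) scaleqAr.

Let sqr4_ge0 (a b c d : R) : 0 <= a ^+ 2 + b ^+ 2 + c ^+ 2 + d ^+ 2.
Proof. by rewrite !addr_ge0 ?sqr_ge0. Qed.

Fact ler_normqD p q : normq (p + q) <= normq p + normq q.
Proof.
case: p q => [a b c d] [a' b' c' d'].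
rewrite -(ler_pXn2r (n := 2)) ?nnegrE ?addr_ge0 ?sqrtr_ge0//.
rewrite sqrrD !sqr_sqrtr ?sqr4_ge0//= -sqrtrM ?sqr4_ge0//.
have : a * a' + b * b' + c * c' + d * d' <=
    Num.sqrt ((a ^+ 2 + b ^+ 2 + c ^+ 2 + d ^+ 2) *
              (a' ^+ 2 + b' ^+ 2 + c' ^+ 2 + d' ^+ 2)).
  apply: le_trans (ler_norm _) _.
  rewrite -sqrtr_sqr ler_sqrt ?mulr_ge0 ?sqr4_ge0// -subr_ge0.
  have -> : (a ^+ 2 + b ^+ 2 + c ^+ 2 + d ^+ 2) *
      (a' ^+ 2 + b' ^+ 2 + c' ^+ 2 + d' ^+ 2) -
      (a * a' + b * b' + c * c' + d * d') ^+ 2 =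
      (a * b' - b * a') ^+ 2 + (a * c' - c * a') ^+ 2 +
      (a * d' - d * a') ^+ 2 + (b * c' - c * b') ^+ 2 +
      (b * d' - d * b') ^+ 2 + (c * d' - d * c') ^+ 2 by ring.
  by rewrite !addr_ge0 ?sqr_ge0.
by move=> h; rewrite mulr2n; lra.
Qed.

Fact normqZ (a : R) q : normq (a *: q) = `|a| * normq q.
Proof.
by rewrite -sqrtr_sqr /normq -sqrtrM ?sqr_ge0//=; congr Num.sqrt; ring.
Qed.

Fact normq0_eq0 q : normq q = 0 -> q = 0.
Proof.
case: q => a b c d /eqP; rewrite sqrtr_eq0 /= => h.
have /eqP : a ^+ 2 + b ^+ 2 + c ^+ 2 + d ^+ 2 = 0.
  by apply/eqP; rewrite eq_le h sqr4_ge0.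
rewrite !paddr_eq0 ?addr_ge0 ?sqr_ge0// !sqrf_eq0.
by move=> /andP[/andP[/andP[/eqP-> /eqP->] /eqP->] /eqP->].
Qed.

HB.instance Definition _ :=
  Lmodule_isNormed.Build R (quat R) ler_normqD normqZ normq0_eq0.

End quaternion_algebra.

Section quaternionic_analysis.
Variable R : realType.
Implicit Types (I q : quat R) (f : quat R -> quat R) (F G : R -> quat R).

Let mu := @lebesgue_measure R.

Definition imag_units : set (quat R) := [set I | I ^+ 2 = - 1].

(* The real line sits in the quaternions as x |-> x%:A, so that C_I is the
   range of [slice I]. *)
Definition slice I (x y : R) : quat R := x%:A + I * y%:A.

Definition slice_regular f : Prop :=
  (forall q, differentiable f q) /\
  forall I, imag_units I -> forall x y : R,
    2^-1 *: (derive1 (fun u => f (slice I u y)) x +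
             I * derive1 (fun v => f (slice I x v)) y) = 0.

Definition qexp q : quat R := limn (series (fun n => n`!%:R^-1 *: q ^+ n)).

Definition qsinc q : quat R :=
  limn (series (fun k => ((- pi ^+ 2) ^+ k / (2 * k + 1)`!%:R) *: q ^+ (2 * k))).

Definition qintegral F : quat R :=
  Quat (\int[mu]_x qre (F x)) (\int[mu]_x qi (F x))
       (\int[mu]_x qj (F x)) (\int[mu]_x qk (F x)).

Definition qLnorm (p : \bar R) F : \bar R := Lnorm mu p (fun x => `|F x|%:E).

Definition qLp (p : \bar R) := [set F : R -> quat R |
  [/\ measurable_fun setT (qre \o F), measurable_fun setT (qi \o F),
      measurable_fun setT (qj \o F), measurable_fun setT (qk \o F) &
      (qLnorm p F < +oo)%E]].

Definition L2_cvg (Fn : nat -> R -> quat R) F : Prop :=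
  qLnorm 2%:E (fun x => Fn n x - F x) @[n --> \oo] --> 0%E.

Definition fourier1 I F (t : R) : quat R :=
  (Num.sqrt (2 * pi))^-1 *: qintegral (fun x => qexp (- (I * (x * t)%:A)) * F x).

(* Extension by continuity of [fourier1 I] from the dense subspace L^1 /\ L^2
   to L^2: G is a representative of the transform of F, unique up to a null
   set. By Plancherel, such a G exists for every F in L^2. *)
Definition is_fourier2 I F G : Prop :=
  qLp 2%:E G /\
  forall Fn : nat -> R -> quat R,
    (forall n, (qLp 1%:E `&` qLp 2%:E) (Fn n)) -> L2_cvg Fn F ->
    L2_cvg (fun n => fourier1 I (Fn n)) G.

(* Complement of the largest open set on which G vanishes almost everywhere. *)
Definition ess_support G : set R :=
  [set t | forall U, nbhs t U -> ~ {ae mu, forall s, U s -> G s = 0}].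

Definition paley_wiener (A : R) := [set f : quat R -> quat R |
  [/\ slice_regular f,
      qLp 2%:E (fun x : R => f x%:A) &
      forall I, imag_units I -> exists G,
        is_fourier2 I (fun x : R => f x%:A) G /\ ess_support G `<=` `[- A, A]]].

Definition strip (M : R) : set (quat R) :=
  [set q | exists x y : R, exists2 J, imag_units J & `|y| < M /\ q = slice J x y].

(* Convergence of series indexed by the integers is along the finite subsets of
   the index set (unordered summation); in particular it holds for symmetric
   partial sums and for any other order of summation. *)
Definition sum_cvg (u : int -> quat R) (l : quat R) : Prop :=
  summability.partial_sum u @ summability.totally --> l.

Definition sum_cvg_abs_unif (S : set (quat R)) (u : int -> quat R -> quat R)
    f : Prop :=
  (forall q, S q -> summable [set: int] (fun k => `|u k q|%:E)) /\
  {uniform S, (fun B q => summability.partial_sum (u^~ q) B)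
                @ summability.totally --> f}.

End quaternionic_analysis.

(* Main.v *)
From HB Require Import structures.
Require Import Defs.
From mathcomp Require Import all_boot all_order all_algebra.
From mathcomp Require Import all_classical all_reals all_analysis.
From mathcomp Require Import ring lra.
From mathcomp Require Import measurable_realfun.
From mathcomp Require finmap summability.

Set Implicit Arguments.
Unset Strict Implicit.
Unset Printing Implicit Defensive.
Import Order.TTheory GRing.Theory Num.Theory.
Import numFieldNormedType.Exports.
Local Open Scope classical_set_scope.
Local Open Scope ring_scope.


(** Both sides of the sampling formula are determined, on each complex slice C_J, by
    their values on the real axis. So the formula follows from three facts: it holds on
    the real axis, its right-hand side converges uniformly on strips, and functions
    that are holomorphic on a slice obey the identity principle.

    The real axis. Write f(x) = a + b i + c j + d k for x real. Fourier inversion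
    ([fourier_inversion], with Fejer kernels) shows that each coordinate is a
    transform x |-> \int_[-A, A] (cos (x t) u(t) + sin (x t) v(t)) dt with u, v square
    integrable ([real_axis_band_limited]). By the Cauchy-Schwarz inequality, a finite
    combination of values of such a transform is controlled by a quadratic form whose
    kernel is a sinc ([band_transform_sum]). Sinc vanishes at the nonzero integers, so
    this form is diagonal on the nodes pi k / A. Hence the samples f(pi k / A) are
    square summable, and the squared error of a partial sum of the series at x is at
    most a constant times 1 - sum_k sinc(A x / pi - k)^2. This tends to 0, because the
    squares of the integer translates of sinc add up to 1 ([rsinc_complete]); the
    latter comes from the partial-fraction expansion of 1 / sin^2, obtained by halving
    angles.

    Strips. On the real axis q sinc(q) changes sign when q is translated by 1, hence
    it does so everywhere. Therefore |sinc(x + J y)| <= C / (1 + |x|) on a strip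
    ([qsinc_decay]), the sums of |sinc(A q / pi - k)|^2 over k are bounded on the strip
    ([qsinc_square_sum]), and since the samples are square summable the tails of the
    series are small uniformly in q ([sampling_series_tail]).

    The identity principle ([slice_hol_eq]). Let h be holomorphic on C_J and zero on
    the real axis, let z0 = x0 + J y0 with y0 > 0, and set r = 4 y0. Multiply h by
    (1 - ((z - z0) / r)^2)^n. On the segment of half-length r centred at z0 and parallel
    to the real axis this factor is a real bump that concentrates at z0; on the two
    vertical segments joining its ends to the real axis it is at most (3/4)^n in
    absolute value. By Cauchy's theorem on this rectangle ([goursat]) the integral of
    the bump against any coordinate of h is O((3/4)^n), and this is possible for all n
    only if h(z0) = 0 ([peak_kernel_le0]). The argument needs only Cauchy's theorem,
    and therefore applies to locally uniform limits of functions with a slice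
    derivative ([slice_hol]), among which are sinc and the sum of the sampling
    series. *)

(** * Integrals over segments and rectangles *)

Section interval_integral.
Variable R : realType.
Local Notation mu := (@lebesgue_measure R).
Implicit Types (f g : R -> R) (a b c : R).

Lemma continuous_integrable_itv f a b :
  continuous f -> mu.-integrable `[a, b] (EFin \o f).
Proof.
move=> cf; apply: continuous_compact_integrable; first exact: segment_compact.
exact: continuous_subspaceT.
Qed.

Lemma fine_measure_itv a b : a <= b -> fine (mu `[a, b]) = b - a.
Proof.
move=> ab; rewrite lebesgue_measure_itv/= lte_fin.
by move: ab; rewrite le_eqVlt => /predU1P[->|->//]; rewrite ltxx subrr.
Qed.

Lemma Rintegral_split f a c b : a <= c -> c <= b -> continuous f ->
  \int[mu]_(x in `[a, b]) f x =
  \int[mu]_(x in `[a, c]) f x + \int[mu]_(x in `[c, b]) f x.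
Proof.
move=> ac cb cf.
have := @Rintegral_itvB R f (BLeft a) (BRight b) c
  (continuous_integrable_itv a b cf).
rewrite !bnd_simp => /(_ ac cb) /eqP; rewrite subr_eq addrC => /eqP ->.
rewrite Rintegral_itv_obnd_cbnd//.
apply: integrableS (continuous_integrable_itv c b cf) => //.
by apply: subset_itvr; rewrite bnd_simp.
Qed.

Lemma Rintegral_le_bound f a b (M : R) : a <= b ->
  mu.-integrable `[a, b] (EFin \o f) ->
  (forall x, a <= x <= b -> `|f x| <= M) ->
  `|\int[mu]_(x in `[a, b]) f x| <= M * (b - a).
Proof.
move=> ab itf fM; apply: le_trans (le_normr_Rintegral _ itf) _ => //.
rewrite -(fine_measure_itv ab) -Rintegral_cst//.
apply: le_Rintegral => //.
  exact: integrable_norm.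
by apply: continuous_integrable_itv => x; exact: cvg_cst.
Qed.

Lemma locally_lipschitz_continuous f x (C : R) :
  (exists2 d : R, 0 < d & forall z, `|z - x| <= d -> `|f z - f x| <= C * `|z - x|) ->
  {for x, continuous f}.
Proof.
move=> [d d0 h]; apply/cvgrPdist_le => e e0.
have C0 : 0 < 1 + `|C| by have := normr_ge0 C; lra.
apply/nbhs_ballP; exists (Num.min d (e / (1 + `|C|))) => /=.
  by rewrite lt_min d0 divr_gt0.
move=> z; rewrite /ball /= lt_min => /andP[zd ze].
rewrite distrC; apply: le_trans (h z _) _; rewrite distrC; first exact: ltW.
move: ze; rewrite ltr_pdivlMr// => ze; apply: le_trans (ltW ze).
by rewrite mulrC ler_wpM2l//; have := ler_norm C; lra.
Qed.

End interval_integral.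

Section goursat.
Variable R : realType.
Local Notation mu := (@lebesgue_measure R).
Variables P Q : R -> R -> R.
Implicit Types a b c d e k l m x y : R.

(** The integral of P dx + Q dy along the boundary of [a, b] x [c, d], counterclockwise. *)
Definition circulation a b c d : R :=
  \int[mu]_(x in `[a, b]) P x c + \int[mu]_(y in `[c, d]) Q b y
  - \int[mu]_(x in `[a, b]) P x d - \int[mu]_(y in `[c, d]) Q a y.

(** P dx + Q dy is differentiable at (x0, y0) and closed there: m is both the
    y-derivative of P and the x-derivative of Q. *)
Definition closed_at x0 y0 := exists p m q : R, forall e, 0 < e ->
  exists2 d : R, 0 < d & forall x y, `|x - x0| + `|y - y0| <= d ->
    `|P x y - P x0 y0 - p * (x - x0) - m * (y - y0)|
       <= e * (`|x - x0| + `|y - y0|) /\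
    `|Q x y - Q x0 y0 - m * (x - x0) - q * (y - y0)|
       <= e * (`|x - x0| + `|y - y0|).

Hypothesis PQ : forall x y, closed_at x y.

Let cP y : continuous (P ^~ y).
Proof.
move=> x; have [p [m [q h]]] := PQ x y; apply: (@locally_lipschitz_continuous _ _ _ (1 + `|p|)).
have [d d0 {}h] := h 1 ltr01; exists d => // z zd; have [|+ _] := h z y.
  by rewrite subrr normr0 addr0.
rewrite subrr normr0 addr0 mulr0 subr0 mul1r => hz.
have -> : P z y - P x y = (P z y - P x y - p * (z - x)) + p * (z - x) by ring.
by apply: le_trans (ler_normD _ _) _; rewrite normrM mulrDl mul1r lerD.
Qed.

Let cQ x : continuous (Q x).
Proof.
move=> y; have [p [m [q h]]] := PQ x y; apply: (@locally_lipschitz_continuous _ _ _ (1 + `|q|)).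
have [d d0 {}h] := h 1 ltr01; exists d => // z zd; have [|_] := h x z.
  by rewrite subrr normr0 add0r.
rewrite subrr normr0 add0r mulr0 subr0 mul1r => hz.
have -> : Q x z - Q x y = (Q x z - Q x y - q * (z - y)) + q * (z - y) by ring.
by apply: le_trans (ler_normD _ _) _; rewrite normrM mulrDl mul1r lerD.
Qed.

Let splitH a m b c d : a <= m -> m <= b ->
  circulation a b c d = circulation a m c d + circulation m b c d.
Proof.
move=> am mb; rewrite /circulation.
by rewrite (Rintegral_split am mb (@cP c)) (Rintegral_split am mb (@cP d)); ring.
Qed.

Let splitV a b c m d : c <= m -> m <= d ->
  circulation a b c d = circulation a b c m + circulation a b m d.
Proof.
move=> cm md; rewrite /circulation.
by rewrite (Rintegral_split cm md (@cQ b)) (Rintegral_split cm md (@cQ a)); ring.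
Qed.

(** The circulations around the four quarters add up to the whole one, so some
    quarter carries at least a fourth of it. *)
Let quarter a c l k : 0 <= l -> 0 <= k -> exists p : R * R,
  [/\ a <= p.1, p.1 + l / 2 <= a + l, c <= p.2, p.2 + k / 2 <= c + k &
   `|circulation a (a + l) c (c + k)| <=
   4 * `|circulation p.1 (p.1 + l / 2) p.2 (p.2 + k / 2)|].
Proof.
move=> l0 k0.
have [la1 la2 la3 la4] : [/\ a <= a + l / 2, a + l / 2 <= a + l,
    a + l / 2 + l / 2 <= a + l & a <= a] by split; lra.
have [lc1 lc2 lc3 lc4] : [/\ c <= c + k / 2, c + k / 2 <= c + k,
    c + k / 2 + k / 2 <= c + k & c <= c] by split; lra.
have e : circulation a (a + l) c (c + k) =
  circulation a (a + l / 2) c (c + k / 2)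
  + circulation a (a + l / 2) (c + k / 2) (c + k / 2 + k / 2)
  + (circulation (a + l / 2) (a + l / 2 + l / 2) c (c + k / 2)
  + circulation (a + l / 2) (a + l / 2 + l / 2) (c + k / 2) (c + k / 2 + k / 2)).
  have -> : a + l / 2 + l / 2 = a + l by lra.
  have -> : c + k / 2 + k / 2 = c + k by lra.
  rewrite (@splitH a (a + l / 2)); [|lra|lra].
  by rewrite !(@splitV _ _ c (c + k / 2) (c + k)); lra.
set X1 := circulation a (a + l / 2) c (c + k / 2) in e.
set X2 := circulation a (a + l / 2) (c + k / 2) (c + k / 2 + k / 2) in e.
set X3 := circulation (a + l / 2) (a + l / 2 + l / 2) c (c + k / 2) in e.
set X4 := circulation (a + l / 2) (a + l / 2 + l / 2) (c + k / 2) _ in e.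
set X := circulation _ _ _ _ in e *.
have tri : `|X| <= `|X1| + `|X2| + (`|X3| + `|X4|).
  by rewrite e; apply: le_trans (ler_normD _ _) _; apply: lerD; exact: ler_normD.
clear e.
have [h1|h1] := leP `|X| (4 * `|X1|).
  by exists (a, c); split; rewrite //=.
have [h2|h2] := leP `|X| (4 * `|X2|).
  by exists (a, c + k / 2); split; rewrite //=.
have [h3|h3] := leP `|X| (4 * `|X3|).
  by exists (a + l / 2, c); split; rewrite //=.
exists (a + l / 2, c + k / 2); split; rewrite //=.
by rewrite -/X4; clearbody X X1 X2 X3 X4; lra.
Qed.

Let diff_bound (F G : R -> R) (m E s t : R) : s <= t -> continuous F -> continuous G ->
  (forall x, s <= x <= t -> `|F x - G x + m| <= E) ->
  `|\int[mu]_(x in `[s, t]) F x - \int[mu]_(x in `[s, t]) G x + m * (t - s)|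
    <= E * (t - s).
Proof.
move=> st cF cG h.
have cst_int : mu.-integrable `[s, t] (EFin \o cst m).
  by apply: continuous_integrable_itv => x; exact: cvg_cst.
have FG_ctn : continuous (fun x => F x - G x).
  by move=> x; apply: cvgB; [exact: cF|exact: cG].
have -> : m * (t - s) = \int[mu]_(x in `[s, t]) m.
  by rewrite Rintegral_cst// fine_measure_itv.
rewrite -RintegralB//; [|exact: continuous_integrable_itv..].
rewrite -RintegralD//; last exact: continuous_integrable_itv.
apply: Rintegral_le_bound => //; apply: continuous_integrable_itv => x.
by apply: cvgD; [exact: FG_ctn|exact: cvg_cst].
Qed.

(** The affine part of the form at (x0, y0) is closed and has no circulation; the
    remainder is at most e (l + k) / 2 on each side. *)
Let local_bound x0 y0 e : 0 < e -> exists2 r : R, 0 < r & forall a l c k,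
  0 <= l -> 0 <= k -> l + k <= r -> a <= x0 <= a + l -> c <= y0 <= c + k ->
  `|circulation a (a + l) c (c + k)| <= e * (l + k) ^+ 2.
Proof.
move=> e0; have [p [m [q h]]] := PQ x0 y0.
have [r r0 {}h] := h (e / 2) ltac:(lra).
exists r => // a l c k l0 k0 lkr xa yc.
have al : a <= a + l by lra.
have ck : c <= c + k by lra.
have := xa; have := yc; move=> /andP[yc1 yc2] /andP[xa1 xa2].
have near_ x y : a <= x <= a + l -> c <= y <= c + k ->
    `|x - x0| + `|y - y0| <= l + k.
  move=> /andP[? ?] /andP[? ?]; apply: lerD; rewrite ler_norml; lra.
have e2 : 0 <= e / 2 by lra.
have hP : `|\int[mu]_(x in `[a, a + l]) P x c - \int[mu]_(x in `[a, a + l]) P x (c + k)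
    + m * k * (a + l - a)| <= e * (l + k) * (a + l - a).
  apply: diff_bound => // x xal.
  have n1 : `|x - x0| + `|c - y0| <= l + k by apply: near_ => //; lra.
  have n2 : `|x - x0| + `|c + k - y0| <= l + k by apply: near_ => //; lra.
  have [|h1 _] := h x c; first exact: le_trans lkr.
  have [|h2 _] := h x (c + k); first exact: le_trans lkr.
  set u := (X in `|X| <= _) in h1; set v := (X in `|X| <= _) in h2.
  have -> : P x c - P x (c + k) + m * k = u - v by rewrite /u /v; ring.
  apply: le_trans (ler_normB _ _) _.
  by have := ler_wpM2l e2 n1; have := ler_wpM2l e2 n2; lra.
have hQ : `|\int[mu]_(y in `[c, c + k]) Q (a + l) y - \int[mu]_(y in `[c, c + k]) Q a y
    + - (m * l) * (c + k - c)| <= e * (l + k) * (c + k - c).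
  apply: diff_bound => // y yck.
  have n1 : `|a - x0| + `|y - y0| <= l + k by apply: near_ => //; lra.
  have n2 : `|a + l - x0| + `|y - y0| <= l + k by apply: near_ => //; lra.
  have [|_ h1] := h (a + l) y; first exact: le_trans lkr.
  have [|_ h2] := h a y; first exact: le_trans lkr.
  set u := (X in `|X| <= _) in h1; set v := (X in `|X| <= _) in h2.
  have -> : Q (a + l) y - Q a y + - (m * l) = u - v by rewrite /u /v; ring.
  apply: le_trans (ler_normB _ _) _.
  by have := ler_wpM2l e2 n1; have := ler_wpM2l e2 n2; lra.
rewrite /circulation; move: hP hQ.
set p1 := \int[mu]_(x in _) P x c; set p2 := \int[mu]_(x in _) P x (c + k).
set q1 := \int[mu]_(x in _) Q (a + l) x; set q2 := \int[mu]_(x in _) Q a x => hP hQ.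
have -> : p1 + q1 - p2 - q2 = (p1 - p2 + m * k * (a + l - a)) +
  (q1 - q2 + - (m * l) * (c + k - c)) by ring.
apply: le_trans (ler_normD _ _) _.
have -> : e * (l + k) ^+ 2 = e * (l + k) * (a + l - a) + e * (l + k) * (c + k - c) by ring.
exact: lerD.
Qed.

(** Goursat's bisection. The quarters shrink to a point (x0, y0); going n steps
    down costs a factor 4^n, and [local_bound] wins it back with the square of the
    size of the rectangle, up to an arbitrarily small e. *)
Lemma goursat a b c d : a <= b -> c <= d -> circulation a b c d = 0.
Proof.
move=> ab cd; pose l := b - a; pose k := d - c.
have l0 : 0 <= l by rewrite /l; lra.
have k0 : 0 <= k by rewrite /k; lra.
pose L n := l / 2 ^+ n; pose K n := k / 2 ^+ n.
have L0 n : 0 <= L n by apply: divr_ge0 => //; exact: exprn_ge0.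
have K0 n : 0 <= K n by apply: divr_ge0 => //; exact: exprn_ge0.
have LS n : L n.+1 = L n / 2 by rewrite /L exprSr invfM mulrA.
have KS n : K n.+1 = K n / 2 by rewrite /K exprSr invfM mulrA.
pose next (z : nat * (R * R)) (p : R * R) :=
  [/\ z.2.1 <= p.1, p.1 + L z.1 / 2 <= z.2.1 + L z.1,
     z.2.2 <= p.2, p.2 + K z.1 / 2 <= z.2.2 + K z.1 &
     `|circulation z.2.1 (z.2.1 + L z.1) z.2.2 (z.2.2 + K z.1)| <=
     4 * `|circulation p.1 (p.1 + L z.1 / 2) p.2 (p.2 + K z.1 / 2)|].
have /choice[st Hst] : forall z, exists p, next z p by move=> z; exact: quarter.
pose s := fix s n := if n is m.+1 then st (m, s m) else (a, c).
have sS n : [/\ (s n).1 <= (s n.+1).1, (s n.+1).1 + L n.+1 <= (s n).1 + L n,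
    (s n).2 <= (s n.+1).2, (s n.+1).2 + K n.+1 <= (s n).2 + K n &
    `|circulation (s n).1 ((s n).1 + L n) (s n).2 ((s n).2 + K n)| <=
    4 * `|circulation (s n.+1).1 ((s n.+1).1 + L n.+1)
             (s n.+1).2 ((s n.+1).2 + K n.+1)|].
  by have := Hst (n, s n); rewrite /next LS KS.
have s1 (n m : nat) : (s n).1 <= (s (n + m)%N).1 /\
    (s (n + m)%N).1 + L (n + m)%N <= (s n).1 + L n.
  elim: m => [|m [h1 h2]]; first by rewrite addn0.
  by rewrite addnS; have [h3 h4 _ _ _] := sS (n + m)%N; split; lra.
have s2 (n m : nat) : (s n).2 <= (s (n + m)%N).2 /\
    (s (n + m)%N).2 + K (n + m)%N <= (s n).2 + K n.
  elim: m => [|m [h1 h2]]; first by rewrite addn0.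
  by rewrite addnS; have [_ _ h3 h4 _] := sS (n + m)%N; split; lra.
have u1 (n m : nat) : (s n).1 <= (s m).1 + L m.
  have [h1 h2] := s1 n m; have [h3 h4] := s1 m n.
  by move: h3 h4; rewrite addnC; have := L0 (n + m)%N; lra.
have u2 (n m : nat) : (s n).2 <= (s m).2 + K m.
  have [h1 h2] := s2 n m; have [h3 h4] := s2 m n.
  by move: h3 h4; rewrite addnC; have := K0 (n + m)%N; lra.
pose x0 := sup (range (fun n => (s n).1)).
pose y0 := sup (range (fun n => (s n).2)).
have x0P n : (s n).1 <= x0 <= (s n).1 + L n.
  apply/andP; split.
    by apply: ub_le_sup; [exists ((s 0).1 + L 0) => _ [m _ <-]|exists n].
  by apply: ge_sup; [exists (s 0).1, 0%N|move=> _ [m _ <-]].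
have y0P n : (s n).2 <= y0 <= (s n).2 + K n.
  apply/andP; split.
    by apply: ub_le_sup; [exists ((s 0).2 + K 0) => _ [m _ <-]|exists n].
  by apply: ge_sup; [exists (s 0).2, 0%N|move=> _ [m _ <-]].
have c4 n : `|circulation a b c d| <=
    4 ^+ n * `|circulation (s n).1 ((s n).1 + L n) (s n).2 ((s n).2 + K n)|.
  elim: n => [|n IH].
    rewrite expr0 mul1r /L /K expr0 !divr1 /=.
    by have -> : a + l = b; [rewrite /l; ring|have -> : c + k = d by rewrite /k; ring].
  apply: (le_trans IH); rewrite exprSr -mulrA ler_wpM2l ?exprn_ge0//.
  by have [] := sS n.
apply/eqP; rewrite -normr_eq0; apply/eqP/le_anti; rewrite normr_ge0 andbT.
apply/ler_addgt0Pr => e e0; rewrite add0r.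
pose e' := e / ((l + k) ^+ 2 + 1).
have lk0 : 0 < (l + k) ^+ 2 + 1 by have := sqr_ge0 (l + k); lra.
have e'0 : 0 < e' by exact: divr_gt0.
have [r r0 hr] := local_bound x0 y0 e'0.
have [n hn] : exists n, (l + k) / 2 ^+ n <= r.
  have : (fun n => (l + k) * (2^-1 ^+ n)) @ \oo --> (l + k) * 0.
    by apply: cvgMr; apply: cvg_expr; rewrite ger0_norm//; lra.
  rewrite mulr0 => /cvgrPdist_le/(_ _ r0)[n _ /(_ n (leqnn n))].
  rewrite /= sub0r normrN => h; exists n.
  by rewrite -exprVn; apply: le_trans h; exact: ler_norm.
have LK : L n + K n = (l + k) / 2 ^+ n by rewrite /L /K [RHS]mulrDl.
have h : `|circulation (s n).1 ((s n).1 + L n) (s n).2 ((s n).2 + K n)|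
    <= e' * ((l + k) / 2 ^+ n) ^+ 2.
  by rewrite -LK; apply: hr => //; rewrite LK.
apply: le_trans (c4 n) _.
apply: (@le_trans _ _ (4 ^+ n * (e' * ((l + k) / 2 ^+ n) ^+ 2))).
  by rewrite ler_wpM2l ?exprn_ge0.
have -> : 4 ^+ n * (e' * ((l + k) / 2 ^+ n) ^+ 2) = e' * (l + k) ^+ 2 :> R.
  rewrite expr_div_n -exprM mulnC exprM (_ : 2 ^+ 2 = 4 :> R); last ring.
  by field; rewrite expf_neq0//; apply/eqP; lra.
by rewrite /e' mulrAC ler_pdivrMr// ler_wpM2l//; lra.
Qed.

End goursat.


(** * Quaternions and slices *)

Section quaternion_norm.
Variable R : realType.
Implicit Types (p q : quat R) (a x : R).

Lemma qnormE q :
  `|q| = Num.sqrt (qre q ^+ 2 + qi q ^+ 2 + qj q ^+ 2 + qk q ^+ 2).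
Proof. by []. Qed.

Lemma sqr_qnorm q : `|q| ^+ 2 = qre q ^+ 2 + qi q ^+ 2 + qj q ^+ 2 + qk q ^+ 2.
Proof. by rewrite qnormE sqr_sqrtr// !addr_ge0 ?sqr_ge0. Qed.

Lemma qnormM p q : `|p * q| = `|p| * `|q|.
Proof.
apply/eqP; rewrite -(@eqrXn2 _ 2)// ?mulr_ge0//; apply/eqP.
rewrite exprMn !sqr_qnorm; case: p => a b c d; case: q => a' b' c' d' /=; ring.
Qed.

Lemma qnormZ a q : `|a *: q| = `|a| * `|q|.
Proof. exact: normrZ. Qed.

Lemma qnormA a : `|a%:A : quat R| = `|a|.
Proof.
rewrite qnormZ (_ : `|1 : quat R| = 1) ?mulr1//.
by rewrite qnormE/= expr1n !expr0n/= !addr0 sqrtr1.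
Qed.

Let le_norm q x : x ^+ 2 <= `|q| ^+ 2 -> `|x| <= `|q|.
Proof. by move=> h; rewrite -(@ler_pXn2r _ 2) ?nnegrE// real_normK ?num_real. Qed.

Lemma qre_le_norm q : `|qre q| <= `|q|.
Proof. by apply: le_norm; rewrite sqr_qnorm -!addrA lerDl !addr_ge0 ?sqr_ge0. Qed.

Lemma qi_le_norm q : `|qi q| <= `|q|.
Proof.
by apply: le_norm; rewrite sqr_qnorm -!addrA addrCA lerDl !addr_ge0 ?sqr_ge0.
Qed.

Lemma qj_le_norm q : `|qj q| <= `|q|.
Proof. by apply: le_norm; rewrite sqr_qnorm addrAC lerDr !addr_ge0 ?sqr_ge0. Qed.

Lemma qk_le_norm q : `|qk q| <= `|q|.
Proof. by apply: le_norm; rewrite sqr_qnorm lerDr !addr_ge0 ?sqr_ge0. Qed.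

Lemma qnorm_le_sum q : `|q| <= `|qre q| + `|qi q| + `|qj q| + `|qk q|.
Proof.
rewrite -(@ler_pXn2r _ 2) ?nnegrE ?addr_ge0// sqr_qnorm.
rewrite -![_ q ^+ 2]real_normK ?num_real//.
move: (normr_ge0 (qre q)) (normr_ge0 (qi q)) (normr_ge0 (qj q)) (normr_ge0 (qk q)).
move: `|qre q| `|qi q| `|qj q| `|qk q| => a b c d a0 b0 c0 d0.
have -> : (a + b + c + d) ^+ 2 = a ^+ 2 + b ^+ 2 + c ^+ 2 + d ^+ 2 +
  2 * (a * b + a * c + a * d + b * c + b * d + c * d) by ring.
by rewrite lerDl !(mulr_ge0, addr_ge0).
Qed.

Lemma quat_eq0 q : qre q = 0 -> qi q = 0 -> qj q = 0 -> qk q = 0 -> q = 0.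
Proof. by case: q => a b c d /= -> -> -> ->. Qed.

Lemma imag_unit_coords (J : quat R) : imag_units J ->
  qre J = 0 /\ qi J ^+ 2 + qj J ^+ 2 + qk J ^+ 2 = 1.
Proof.
case: J => a b c d; rewrite /imag_units/= expr2 => -[h1 h2 h3 h4].
have [a0|a0] := eqVneq a 0; first by split=> //; move: h1; rewrite a0; lra.
have mulr2a x : a * x + x * a = 0 -> x = 0.
  move=> h; apply: (mulfI a0); lra.
have b0 : b = 0 by apply: mulr2a; lra.
have c0 : c = 0 by apply: mulr2a; lra.
have d0 : d = 0 by apply: mulr2a; lra.
by exfalso; move: h1; rewrite b0 c0 d0; have := sqr_ge0 a; rewrite expr2; lra.
Qed.

Lemma imag_unit_sqr (J : quat R) : imag_units J -> J * J = - 1.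
Proof. by rewrite /imag_units/= expr2. Qed.

Lemma imag_unit_norm (J : quat R) : imag_units J -> `|J| = 1.
Proof.
by move=> /imag_unit_coords[h0 h1]; rewrite qnormE h0 expr0n add0r h1 sqrtr1.
Qed.

Lemma imag_unitN (J : quat R) : imag_units J -> imag_units (- J).
Proof. by rewrite /imag_units/= sqrrN. Qed.

End quaternion_norm.

Section slice_algebra.
Variable R : realType.
Implicit Types (J q : quat R) (x y : R).

Lemma sliceE J x y : slice J x y = x%:A + y *: J.
Proof. by rewrite /slice -scalerAr mulr1. Qed.

Lemma slice_mull J x y q : slice J x y * q = x *: q + y *: (J * q).
Proof. by rewrite sliceE mulrDl -!scalerAl mul1r. Qed.

Lemma slice_real J x : slice J x 0 = x%:A.
Proof. by rewrite sliceE scale0r addr0. Qed.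

Lemma slice_opp J x y : slice (- J) x y = slice J x (- y).
Proof. by rewrite !sliceE scalerN scaleNr. Qed.

Lemma sliceB J x y x' y' : slice J x y - slice J x' y' = slice J (x - x') (y - y').
Proof. by rewrite !sliceE !scalerBl opprD addrACA. Qed.

Lemma slice_affine J a b x y :
  a *: slice J x y - b%:A = slice J (a * x - b) (a * y).
Proof. by rewrite !sliceE scalerDr !scalerA scalerBl -addrA [_ - b%:A]addrC addrA. Qed.

End slice_algebra.

Section slice_geometry.
Variables (R : realType) (J : quat R).
Hypothesis JJ : imag_units J.
Implicit Types (x y : R) (q : quat R).

Lemma sqr_norm_slice x y : `|slice J x y| ^+ 2 = x ^+ 2 + y ^+ 2.
Proof.
have [] := imag_unit_coords JJ; rewrite sliceE sqr_qnorm.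
case: J => a b c d /= -> h1.
by transitivity (x ^+ 2 + y ^+ 2 * (b ^+ 2 + c ^+ 2 + d ^+ 2));
  [ring|rewrite h1 mulr1].
Qed.

Lemma norm_slice_le x y : `|slice J x y| <= `|x| + `|y|.
Proof.
rewrite sliceE; apply: le_trans (ler_normD _ _) _.
by rewrite qnormA qnormZ imag_unit_norm// mulr1.
Qed.

Lemma re_le_slice x y : `|x| <= `|slice J x y|.
Proof.
rewrite -(@ler_pXn2r _ 2) ?nnegrE// sqr_norm_slice real_normK ?num_real//.
by rewrite lerDl sqr_ge0.
Qed.

Lemma im_le_slice x y : `|y| <= `|slice J x y|.
Proof.
rewrite -(@ler_pXn2r _ 2) ?nnegrE// sqr_norm_slice real_normK ?num_real//.
by rewrite lerDr sqr_ge0.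
Qed.

Lemma sliceM x y x' y' :
  slice J x y * slice J x' y' = slice J (x * x' - y * y') (x * y' + y * x').
Proof.
rewrite slice_mull !sliceE mulrDr -!scalerAr imag_unit_sqr// mulr1.
by rewrite !scalerDr !scalerA !scalerN [_ *: J - _]addrC addrACA scalerBl scalerDl.
Qed.

Lemma sliceMC x y x' y' :
  slice J x y * slice J x' y' = slice J x' y' * slice J x y.
Proof. by rewrite !sliceM; congr slice; ring. Qed.

End slice_geometry.

(** * Differentiability along a slice *)

Section slice_holomorphy.
Variables (R : realType) (J : quat R).
Hypothesis JJ : imag_units J.
Implicit Types (x y e d : R) (p q : quat R) (g h : quat R -> quat R).
Local Notation sl := (slice J).

(** The increment stands on the left of the derivative p, as in the left
    Cauchy-Riemann equation; this is why right multiplication by a constant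
    preserves it. *)
Definition slice_diff_at h (x0 y0 : R) := exists p, forall e, 0 < e ->
  exists2 d : R, 0 < d & forall x y, `|x - x0| + `|y - y0| <= d ->
  `|h (sl x y) - h (sl x0 y0) - sl (x - x0) (y - y0) * p|
    <= e * (`|x - x0| + `|y - y0|).

Definition slice_diff h := forall x0 y0, slice_diff_at h x0 y0.

(** Locally uniform limits of functions with a slice derivative. Such limits are
    holomorphic, but to prove this one needs Cauchy's formula; the closure is stable
    under limits by construction and still satisfies Cauchy's theorem on rectangles,
    from which the identity principle follows directly. *)
Definition slice_hol h := forall r e, 0 < e -> exists2 g, slice_diff g &
  forall x y, `|x| <= r -> `|y| <= r -> `|h (sl x y) - g (sl x y)| <= e.

Lemma slice_diff_cst p : slice_diff (cst p).
Proof.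
move=> x0 y0; exists 0 => e e0; exists 1 => // x y _.
by rewrite /= mulr0 !subrr normr0 mulr_ge0 ?addr_ge0// ltW.
Qed.

Lemma slice_diffD g h : slice_diff g -> slice_diff h ->
  slice_diff (fun q => g q + h q).
Proof.
move=> dg dh x0 y0; have [p hp] := dg x0 y0; have [p' hp'] := dh x0 y0.
exists (p + p') => e e0; have e2 : 0 < e / 2 by rewrite divr_gt0.
have [d d0 {}hp] := hp _ e2; have [d' d'0 {}hp'] := hp' _ e2.
exists (Num.min d d'); first by rewrite lt_min d0.
move=> x y; rewrite le_min => /andP[/hp h1 /hp' h2].
rewrite mulrDr (_ : _ - _ - _ = (g (sl x y) - g (sl x0 y0) - sl (x - x0) (y - y0) * p)
 + (h (sl x y) - h (sl x0 y0) - sl (x - x0) (y - y0) * p')).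
  apply: le_trans (ler_normD _ _) _; apply: le_trans (lerD h1 h2) _.
  by rewrite -mulrDl -splitr.
by rewrite !opprD [g _ + h _ + _]addrACA [LHS]addrACA.
Qed.

Lemma slice_diffMr h p : slice_diff h -> slice_diff (fun q => h q * p).
Proof.
move=> dh x0 y0; have [c hc] := dh x0 y0; exists (c * p) => e e0.
have p1 : 0 < `|p| + 1 by rewrite ltr_wpDl.
have [d d0 {}hc] := hc _ (divr_gt0 e0 p1); exists d => // x y /hc xy.
rewrite mulrA -!mulrBl qnormM.
have -> : e = e / (`|p| + 1) * (`|p| + 1) by rewrite divfK// gt_eqF.
rewrite [leRHS]mulrAC; apply: ler_pM => //.
by rewrite lerDl.
Qed.

Let commuting_product_increment (z w u c v : quat R) : z * w = w * z ->
  (z + w) * (u + z * c + v) - w * v - z * (v + w * c) = w * u + z * u + z * (z * c).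
Proof.
move=> zw; rewrite [z * (v + w * c)]mulrDr [z * (w * c)]mulrA zw.
rewrite (mulrDl z w) !mulrDr -[w * z * c]mulrA opprD.
move: (z * u) (z * (z * c)) (z * v) (w * u) (w * (z * c)) (w * v).
move=> [????] [????] [????] [????] [????] [????]; congr Quat => /=; ring.
Qed.

(** Left multiplication by q - w preserves slice derivatives because w lies in the
    same slice and so commutes with the increments. *)
Lemma slice_diffMl h a b : slice_diff h ->
  slice_diff (fun q => (q - sl a b) * h q).
Proof.
move=> dh x0 y0; have [c hc] := dh x0 y0.
pose w := sl x0 y0 - sl a b.
exists (h (sl x0 y0) + w * c) => e e0.
have K0 : 0 < 1 + `|w| + `|c| by rewrite -addrA ltr_pwDl.
have hK : 0 < Num.min 1 (e / (1 + `|w| + `|c|)).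
  by rewrite lt_min ltr01 divr_gt0.
have [d d0 {}hc] := hc _ hK.
exists (Num.min d (Num.min 1 (e / (1 + `|w| + `|c|)))); first by rewrite lt_min d0.
move=> x y; rewrite le_min => /andP[/hc {}hc xyK].
set z := sl (x - x0) (y - y0) in hc *.
set s := `|x - x0| + `|y - y0| in hc xyK *.
have zs : `|z| <= s by exact: norm_slice_le.
set k := Num.min 1 _ in hc xyK hK.
have kle : k <= e / (1 + `|w| + `|c|) by rewrite ge_min lexx orbT.
have k1 : k <= 1 by rewrite ge_min lexx.
set u := h (sl x y) - h (sl x0 y0) - z * c in hc.
have -> : (sl x y - sl a b) * h (sl x y) - (sl x0 y0 - sl a b) * h (sl x0 y0)
   - z * (h (sl x0 y0) + w * c) = w * u + z * u + z * (z * c).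
  have -> : sl x y - sl a b = z + w by rewrite /z /w -sliceB addrA subrK.
  have -> : h (sl x y) = u + z * c + h (sl x0 y0) by rewrite /u !subrK.
  by apply: commuting_product_increment; rewrite /w /z !sliceB sliceMC.
have us : `|u| <= k * s by [].
have s0 : 0 <= s by rewrite addr_ge0.
apply: le_trans (ler_normD _ _) _; apply: le_trans (lerD (ler_normD _ _) (lexx _)) _.
rewrite !qnormM.
have h1 : `|w| * `|u| <= `|w| * (k * s) by rewrite ler_wpM2l.
have h2 : `|z| * `|u| <= k * s.
  rewrite -[k * s]mul1r; apply: ler_pM => //.
  by apply: le_trans zs (le_trans xyK _).
have h3 : `|z| * (`|z| * `|c|) <= k * s * `|c|.
  by rewrite mulrA ler_wpM2r//; apply: ler_pM => //; apply: le_trans zs xyK.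
apply: (@le_trans _ _ (k * (1 + `|w| + `|c|) * s)); first by lra.
by rewrite ler_wpM2r// -ler_pdivlMr.
Qed.

Lemma slice_diff_affine h (a b : R) : slice_diff h ->
  slice_diff (fun q => h (a *: q - b%:A)).
Proof.
move=> dh x0 y0; have [c hc] := dh (a * x0 - b) (a * y0); exists (a *: c) => e e0.
have a1 : 0 < `|a| + 1 by rewrite ltr_wpDl.
have [d d0 {}hc] := hc _ (divr_gt0 e0 a1).
exists (d / (`|a| + 1)); first exact: divr_gt0.
move=> x y xy; have := hc (a * x - b) (a * y).
have -> : a * x - b - (a * x0 - b) = a * (x - x0) by ring.
have -> : a * y - a * y0 = a * (y - y0) by ring.
rewrite !normrM -mulrDr !slice_affine.
have -> : sl (a * (x - x0)) (a * (y - y0)) = a *: sl (x - x0) (y - y0).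
  by rewrite !sliceE scalerDr !scalerA.
rewrite -scalerAl [_ * (a *: c)](_ : _ = a *: (sl (x - x0) (y - y0) * c)); last by rewrite -scalerAr.
set s := _ + _ => h1.
have s0 : 0 <= s by rewrite addr_ge0.
have as_ : `|a| * s <= (`|a| + 1) * s by rewrite ler_wpM2r// lerDl.
apply: le_trans (h1 _) _.
  by apply: le_trans as_ _; rewrite mulrC -ler_pdivlMr.
apply: le_trans (ler_wpM2l _ as_) _; first exact/ltW/divr_gt0.
by rewrite mulrA divfK// gt_eqF.
Qed.

Lemma slice_diff_hol h : slice_diff h -> slice_hol h.
Proof. by move=> dh r e e0; exists h => // x y _ _; rewrite subrr normr0 ltW. Qed.

Lemma slice_holD g h : slice_hol g -> slice_hol h ->
  slice_hol (fun q => g q + h q).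
Proof.
move=> dg dh r e e0; have e2 : 0 < e / 2 by rewrite divr_gt0.
have [g' g'd hg'] := dg r _ e2; have [h' h'd hh'] := dh r _ e2.
exists (fun q => g' q + h' q); first exact: slice_diffD.
move=> x y xr yr; rewrite opprD addrACA; apply: le_trans (ler_normD _ _) _.
by rewrite [leRHS]splitr lerD ?hg' ?hh'.
Qed.

Lemma slice_holMr h p : slice_hol h -> slice_hol (fun q => h q * p).
Proof.
move=> dh r e e0; have p1 : 0 < `|p| + 1 by rewrite ltr_wpDl.
have [g gd hg] := dh r _ (divr_gt0 e0 p1).
exists (fun q => g q * p); first exact: slice_diffMr.
move=> x y xr yr; rewrite -mulrBl qnormM.
have -> : e = e / (`|p| + 1) * (`|p| + 1) by rewrite divfK// gt_eqF.
by apply: ler_pM => //; [exact: hg|rewrite lerDl].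
Qed.

Lemma slice_holN h : slice_hol h -> slice_hol (fun q => - h q).
Proof.
move=> hh; have := slice_holMr (-1) hh.
by congr slice_hol; apply/funext => q; rewrite mulrN1.
Qed.

Lemma slice_holMl h a b : slice_hol h ->
  slice_hol (fun q => (q - sl a b) * h q).
Proof.
move=> dh r e e0; have K0 : 0 < 2 * `|r| + `|sl a b| + 1.
  by rewrite ltr_wpDl// addr_ge0// mulr_ge0.
have [g gd hg] := dh r _ (divr_gt0 e0 K0).
exists (fun q => (q - sl a b) * g q); first exact: slice_diffMl.
move=> x y xr yr; rewrite -mulrBr qnormM.
have -> : e = (2 * `|r| + `|sl a b| + 1) * (e / (2 * `|r| + `|sl a b| + 1)).
  by rewrite mulrC divfK// gt_eqF.
apply: ler_pM => //; last exact: hg.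
apply: le_trans (ler_normB _ _) _.
have := norm_slice_le JJ x y; have := ler_norm r; lra.
Qed.

Lemma slice_hol_affine h (a b : R) : slice_hol h ->
  slice_hol (fun q => h (a *: q - b%:A)).
Proof.
move=> dh r e e0; have [g gd hg] := dh (`|a| * r + `|b|) _ e0.
exists (fun q => g (a *: q - b%:A)); first exact: slice_diff_affine.
move=> x y xr yr; rewrite !slice_affine; apply: hg.
  by apply: le_trans (ler_normB _ _) _; rewrite normrM lerD// ler_wpM2l.
by rewrite normrM ler_wpDr// ler_wpM2l.
Qed.

Lemma slice_hol_lim h : (forall r e, 0 < e -> exists2 g, slice_hol g &
  forall x y, `|x| <= r -> `|y| <= r -> `|h (sl x y) - g (sl x y)| <= e) ->
  slice_hol h.
Proof.
move=> H r e e0; have e2 : 0 < e / 2 by rewrite divr_gt0.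
have [g hg h1] := H r _ e2; have [g' dg' h2] := hg r _ e2.
exists g' => // x y xr yr; rewrite (splitr e).
apply: le_trans (ler_distD (g (sl x y)) _ _) _.
by rewrite lerD ?h1 ?h2.
Qed.

Lemma slice_hol_cst p : slice_hol (cst p).
Proof. exact/slice_diff_hol/slice_diff_cst. Qed.

Lemma slice_hol_sum (T : Type) (s : seq T) (F : T -> quat R -> quat R) :
  (forall i, slice_hol (F i)) -> slice_hol (fun q => \sum_(i <- s) F i q).
Proof.
move=> hF; elim: s => [|i s IH].
  have := slice_hol_cst 0; congr slice_hol; apply/funext => q.
  by rewrite big_nil.
have := slice_holD (hF i) IH; congr slice_hol; apply/funext => q.
by rewrite big_cons.
Qed.

Lemma slice_hol_dist h x0 y0 e : slice_hol h -> 0 < e ->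
  exists2 d : R, 0 < d & forall x y, `|x - x0| + `|y - y0| <= d ->
  `|h (sl x y) - h (sl x0 y0)| <= e.
Proof.
move=> hh e0; have e3 : 0 < e / 3 by rewrite divr_gt0.
have [g dg hg] := hh (`|x0| + `|y0| + 1) _ e3.
have [p hp] := dg x0 y0; have [d d0 {}hp] := hp _ ltr01.
have p1 : 0 < 1 + `|p| by rewrite ltr_pwDl.
exists (Num.min 1 (Num.min d (e / 3 / (1 + `|p|)))).
  by rewrite !lt_min ltr01 d0 divr_gt0.
move=> x y; rewrite !le_min => /and3P[xy1 /hp xyd xye].
set s := _ + _ in xy1 xyd xye.
have gg : `|g (sl x y) - g (sl x0 y0)| <= e / 3.
  rewrite -[X in `|X|](subrK (sl (x - x0) (y - y0) * p)).
  apply: le_trans (ler_normD _ _) _.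
  apply: (@le_trans _ _ (1 * s + s * `|p|)).
    by rewrite lerD// qnormM ler_wpM2r// norm_slice_le.
  by rewrite mulrC -mulrDr -ler_pdivlMr.
have x1 : `|x| <= `|x0| + `|y0| + 1.
  have := ler_normD (x - x0) x0; rewrite subrK.
  by have := normr_ge0 (y - y0); have := normr_ge0 y0; rewrite /s in xy1; lra.
have y1 : `|y| <= `|x0| + `|y0| + 1.
  have := ler_normD (y - y0) y0; rewrite subrK.
  by have := normr_ge0 (x - x0); have := normr_ge0 x0; rewrite /s in xy1; lra.
have h1 := hg x y x1 y1.
have h2 : `|h (sl x0 y0) - g (sl x0 y0)| <= e / 3.
  by apply: hg; have := normr_ge0 x0; have := normr_ge0 y0; lra.
have -> : h (sl x y) - h (sl x0 y0) = (h (sl x y) - g (sl x y))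
   + (g (sl x y) - g (sl x0 y0)) - (h (sl x0 y0) - g (sl x0 y0)).
  by rewrite addrA subrK opprB addrA subrK.
apply: le_trans (ler_normB _ _) _.
apply: le_trans (lerD (ler_normD _ _) (lexx _)) _.
lra.
Qed.

End slice_holomorphy.

(** * The identity principle on a slice *)

Section real_integrable.
Context d (T : measurableType d) (R : realType).
Variables (mu : {measure set T -> \bar R}) (D : set T).
Hypothesis mD : measurable D.
Implicit Types f g : T -> R.
Local Notation integ f := (mu.-integrable D (fun x => (f x)%:E)).

Lemma rintegrableZ (k : R) f : integ f -> integ (fun x => k * f x).
Proof. by move=> fi; exact: (integrableZl mD k fi). Qed.

Lemma rintegrableD f g : integ f -> integ g -> integ (fun x => f x + g x).
Proof. by move=> fi gi; exact: (integrableD mD fi gi). Qed.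

Lemma rintegrableB f g : integ f -> integ g -> integ (fun x => f x - g x).
Proof. by move=> fi gi; exact: (integrableB mD fi gi). Qed.

End real_integrable.

Section one_variable.
Variable R : realType.
Local Notation mu := (@lebesgue_measure R).
Implicit Types (u : R -> R) (a b c x e : R).

Lemma continuous_bounded_itv u a b : continuous u ->
  exists2 M : R, 0 <= M & forall x, a <= x <= b -> `|u x| <= M.
Proof.
move=> cu.
have /compact_bounded[M [_ hM]] : compact (u @` `[a, b]).
  by apply: continuous_compact; [exact: continuous_subspaceT|exact: segment_compact].
exists (`|M| + 1) => [|x xab]; first by rewrite addr_ge0.
apply: (hM (`|M| + 1)); first by have := ler_norm M; lra.
by exists x => //=; rewrite in_itv.
Qed.

Lemma geometric_domination c K s t : 0 <= s -> s < t ->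
  (forall n, c * t ^+ n <= K * s ^+ n) -> c <= 0.
Proof.
move=> s0 st h; have t0 : 0 < t by lra.
apply/ler_addgt0Pr => e e0; rewrite add0r.
have : (fun n => K * (s / t) ^+ n) @ \oo --> K * 0.
  apply: cvgMr; apply: cvg_expr; rewrite ger0_norm ?divr_ge0//; last lra.
  by rewrite ltr_pdivrMr// mul1r.
rewrite mulr0 => /cvgrPdist_le/(_ _ e0)[n _ /(_ n (leqnn n))].
rewrite /= sub0r normrN => hn; apply: le_trans (le_trans (ler_norm _) hn).
by rewrite expr_div_n mulrA ler_pdivlMr ?exprn_gt0.
Qed.

(** The powers of a bump that peaks at the centre of the interval concentrate
    there: if u were positive at the centre, the integral would be bounded below, up
    to an error of smaller order, by a multiple of t^n for some t > s. *)
Lemma peak_kernel_le0 u x0 r K s : continuous u -> 0 < r -> 0 <= s -> s < 1 ->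
  (forall n, \int[mu]_(x in `[x0 - r, x0 + r])
      ((1 - ((x - x0) / r) ^+ 2) ^+ n * u x) <= K * s ^+ n) -> u x0 <= 0.
Proof.
move=> cu r0 s0 s1 H; rewrite leNgt; apply/negP => u0.
have [M M0 hM] := continuous_bounded_itv (x0 - r) (x0 + r) cu.
have u2 : 0 < u x0 / 2 by rewrite divr_gt0.
have /cvgrPdist_le/(_ _ u2)/nbhs_ballP[d /= d0 hd] := cu x0.
pose dl := Num.min (d / 2) r.
have dl0 : 0 < dl by rewrite lt_min r0 andbT divr_gt0.
have dlr : dl <= r by rewrite ge_min lexx orbT.
have dld : dl < d by apply: (@le_lt_trans _ _ (d / 2)); [rewrite ge_min lexx|lra].
have pos x : `|x - x0| <= dl -> u x0 / 2 <= u x.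
  move=> xd; have /hd : ball x0 d x.
    by rewrite /ball/= distrC; apply: le_lt_trans dld.
  by rewrite /= ler_norml => /andP[]; lra.
pose ka v : R := 1 - (v / r) ^+ 2.
have ka_anti v w : 0 <= v -> v <= w -> ka w <= ka v.
  move=> v0 vw; have w0 : 0 <= w by apply: le_trans vw.
  rewrite /ka lerD2l lerN2 ler_pXn2r ?nnegrE ?divr_ge0 ?(ltW r0)//.
  by rewrite ler_pM2r// invr_gt0.
pose s' := Num.max s (ka dl).
have s'1 : s' < 1.
  rewrite gt_max s1/= /ka ltrBlDr ltrDl exprn_gt0// divr_gt0//.
have s'0 : 0 <= s' by rewrite le_max s0.
(* ka is close to 1 near 0, hence above s and above its values beyond dl *)
have [eta [eta0 etad etak]] : exists eta, [/\ 0 < eta, eta <= dl & s' < ka eta].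
  pose m := Num.min (dl / r) (1 - s').
  have m0 : 0 < m by rewrite lt_min divr_gt0//= subr_gt0.
  have m1 : m <= dl / r by rewrite ge_min lexx.
  have m2 : m <= 1 - s' by rewrite ge_min lexx orbT.
  have mm : m / 2 <= 1 by lra.
  exists (m / 2 * r); split; first by rewrite mulr_gt0// divr_gt0.
    by rewrite -ler_pdivlMr//; lra.
  rewrite /ka mulfK ?gt_eqF//.
  have : (m / 2) ^+ 2 <= m / 2.
    by rewrite expr2 -[leRHS]mulr1 ler_pM2l// divr_gt0.
  lra.
have etar : eta <= r by apply: le_trans dlr.
have c0 : 0 < eta * u x0 by rewrite mulr_gt0.
suff : eta * u x0 <= 0 by rewrite leNgt c0.
apply: (@geometric_domination _ (2 * r * M + `|K|) s' (ka eta)) => // n.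
have ka0 x : `|x - x0| <= r -> 0 <= ka (x - x0).
  move=> xr; rewrite /ka subr_ge0 -[(_ / r) ^+ 2]real_normK ?num_real//.
  rewrite normrM [`|r^-1|]gtr0_norm ?invr_gt0// expr_le1//.
    by rewrite ler_pdivrMr// mul1r.
  by rewrite divr_ge0// ltW.
have ka_abs x : ka (x - x0) = ka `|x - x0|.
  rewrite /ka -[in LHS](real_normK (num_real ((x - x0) / r))) normrM.
  by rewrite [`|r^-1|]gtr0_norm ?invr_gt0.
(* a lower bound of the integrand: it exceeds u x0 / 2 * ka eta ^+ n near x0, is
   nonnegative as long as |x - x0| <= dl, and at least - M * s' ^+ n beyond *)
pose lo (x : R) := u x0 / 2 * ka eta ^+ n * \1_(`[x0 - eta, x0 + eta]) x - M * s' ^+ n.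
have lole x : x0 - r <= x <= x0 + r -> lo x <= ka (x - x0) ^+ n * u x.
  move=> xr; have xr' : `|x - x0| <= r by rewrite ler_norml; lra.
  have kx0 := ka0 x xr'.
  have sn0 : 0 <= M * s' ^+ n by rewrite mulr_ge0// exprn_ge0.
  rewrite /lo indicE; have [|] := boolP (x \in _).
    rewrite inE/= in_itv/= => xeta; rewrite mulr1.
    have xe' : `|x - x0| <= eta by rewrite ler_norml; lra.
    apply: (@le_trans _ _ (u x0 / 2 * ka eta ^+ n)); first by rewrite gerBl.
    have ke0 : 0 <= ka eta by apply: le_trans (ltW etak).
    rewrite mulrC; apply: ler_pM; rewrite ?exprn_ge0 ?(ltW u2)//.
      by apply: lerXn2r; rewrite ?nnegrE// ka_abs ka_anti.
    by apply: pos; apply: le_trans etad.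
  move=> _; rewrite mulr0 sub0r.
  have [xd|xd] := leP `|x - x0| dl.
    apply: (@le_trans _ _ 0); first by rewrite oppr_le0.
    by rewrite mulr_ge0 ?exprn_ge0// (le_trans _ (pos _ xd))// ltW.
  have : `|ka (x - x0) ^+ n * u x| <= M * s' ^+ n.
    rewrite normrM mulrC; apply: ler_pM => //; first exact: hM.
    rewrite normrX ger0_norm//; apply: lerXn2r; rewrite ?nnegrE//.
    by rewrite le_max ka_abs ka_anti ?orbT// ltW.
  by rewrite ler_norml => /andP[].
have kc : continuous (fun x : R => ka (x - x0) ^+ n * u x).
  move=> x; apply: cvgM; last exact: cu.
  apply: (@continuous_comp _ _ _ (fun x => ka (x - x0)) (fun z => z ^+ n));
    last exact: exprn_continuous.
  apply: cvgB; first exact: cvg_cst.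
  apply: (@continuous_comp _ _ _ (fun x => (x - x0) / r) (fun z => z ^+ 2));
    last exact: exprn_continuous.
  by apply: cvgMl; apply: cvgB; [exact: cvg_id|exact: cvg_cst].
have lI : mu.-integrable `[x0 - r, x0 + r] (EFin \o \1_(`[x0 - eta, x0 + eta])).
  apply: integrableS (integrable_indic_itv (x0 - eta) (x0 + eta) true false) => //.
have cI v : mu.-integrable `[x0 - r, x0 + r] (EFin \o cst v).
  by apply: continuous_integrable_itv => x; exact: cvg_cst.
have lI' v : mu.-integrable `[x0 - r, x0 + r]
    (EFin \o (fun x => v * \1_(`[x0 - eta, x0 + eta]) x)).
  exact: rintegrableZ.
have il : \int[mu]_(x in `[x0 - r, x0 + r]) lo x =
    eta * u x0 * ka eta ^+ n - 2 * r * M * s' ^+ n.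
  rewrite /lo RintegralB//; last exact: cI.
  rewrite RintegralZl// Rintegral_cst// fine_measure_itv; last lra.
  have -> : \int[mu]_(x in `[x0 - r, x0 + r]) \1_(`[x0 - eta, x0 + eta]) x = 2 * eta.
    rewrite /Rintegral integral_indic// setIidl.
      by rewrite fine_measure_itv; [ring|lra].
    by move=> x/=; rewrite !in_itv/=; lra.
  by field.
have : \int[mu]_(x in `[x0 - r, x0 + r]) lo x <= K * s ^+ n.
  apply: le_trans (H n); apply: le_Rintegral => //.
  - by apply: rintegrableB => //; [exact: lI'|exact: cI].
  - exact: continuous_integrable_itv.
rewrite il => h.
have : K * s ^+ n <= `|K| * s' ^+ n.
  apply: (@le_trans _ _ (`|K| * s ^+ n)).
    by rewrite ler_wpM2r ?exprn_ge0// ler_norm.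
  by rewrite ler_wpM2l//; apply: lerXn2r; rewrite ?nnegrE// le_max lexx.
lra.
Qed.

End one_variable.

Section slice_uniqueness.
Variables (R : realType) (J : quat R).
Hypothesis JJ : imag_units J.
Local Notation mu := (@lebesgue_measure R).
Local Notation sl := (slice J).
Implicit Types (h g : quat R -> quat R).

(* A real-linear functional of norm at most one, standing for any of the four
   coordinates. *)
Variable l : quat R -> R.
Hypothesis lD : forall p q, l (p + q) = l p + l q.
Hypothesis lZ : forall (a : R) q, l (a *: q) = a * l q.
Hypothesis ln : forall q, `|l q| <= `|q|.

Let lB p q : l (p - q) = l p - l q.
Proof. by rewrite lD -scaleN1r lZ mulN1r. Qed.

(** h dz = h dx + J h dy, seen through l. *)
Let dx h x y := l (h (sl x y)).
Let dy h x y := l (J * h (sl x y)).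

(** A slice derivative p makes the form closed: its differential at the point is
    (l p) dx + (l (J p)) dy in the first coefficient and (l (J p)) dx - (l p) dy in
    the second, with the same mixed term. *)
Let circ_diff g (a b c d : R) : slice_diff J g -> a <= b -> c <= d ->
  circulation (dx g) (dy g) a b c d = 0.
Proof.
move=> dg; apply: goursat => x0 y0; have [p hp] := dg x0 y0.
exists (l p), (l (J * p)), (- l p) => e e0.
have [d' d0 {}hp] := hp _ e0; exists d' => // x y /hp {}hp; split.
  apply: le_trans hp; apply: le_trans (ln _).
  by rewrite slice_mull !lB lD !lZ /dx; rewrite le_eqVlt; apply/orP; left; apply/eqP; congr (`|_|); ring.
apply: le_trans hp; rewrite -[leRHS]mul1r -(imag_unit_norm JJ) -qnormM.
apply: le_trans (ln _).
rewrite slice_mull !(mulrBr J) (mulrDr J) -!scalerAr mulrA imag_unit_sqr// mulN1r.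
rewrite scalerN !lB !lZ /dy; rewrite le_eqVlt; apply/orP; left; apply/eqP.
by congr (`|_|); ring.
Qed.

Let cont_dir (phi : quat R -> R) h : slice_hol J h ->
  (forall p q, `|phi p - phi q| <= `|p - q|) ->
  (forall y, continuous (fun x => phi (h (sl x y)))) /\
  (forall x, continuous (fun y => phi (h (sl x y)))).
Proof.
move=> hh hphi; split => [y x|x y]; apply/cvgrPdist_le => e e0;
  have [d d0 hd] := slice_hol_dist JJ x y hh e0;
  apply/nbhs_ballP; exists d => // z; rewrite /ball/= distrC => zd;
  rewrite distrC; apply: le_trans (hphi _ _) _; apply: hd; rewrite subrr normr0.
  by rewrite addr0 ltW.
by rewrite add0r ltW.
Qed.

Let lphi p q : `|l p - l q| <= `|p - q|.
Proof. by rewrite -lB. Qed.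

Let lJphi p q : `|l (J * p) - l (J * q)| <= `|p - q|.
Proof.
rewrite -lB -mulrBr; apply: le_trans (ln _) _.
by rewrite qnormM imag_unit_norm// mul1r.
Qed.

(** Cauchy's theorem on rectangles passes to uniform limits. *)
Let circ_hol h (a b c d : R) : slice_hol J h -> a <= b -> c <= d ->
  circulation (dx h) (dy h) a b c d = 0.
Proof.
move=> hh ab cd; apply/eqP; rewrite -normr_eq0; apply/eqP/le_anti.
rewrite normr_ge0 andbT; apply/ler_addgt0Pr => e e0; rewrite add0r.
pose S := 2 * (b - a) + 2 * (d - c) + 1.
have S0 : 0 < S by rewrite /S; lra.
have eS : 0 < e / S by exact: divr_gt0.
have [g dg hg] := hh (`|a| + `|b| + `|c| + `|d|) _ eS.
have gh := slice_diff_hol dg.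
have [ch1 ch2] := cont_dir hh lphi; have [ch3 ch4] := cont_dir hh lJphi.
have [cg1 cg2] := cont_dir gh lphi; have [cg3 cg4] := cont_dir gh lJphi.
have inr (t u v : R) : u <= t <= v -> `|t| <= `|u| + `|v|.
  move=> /andP[ut tv]; rewrite ler_norml.
  by have := ler_norm (- u); have := ler_norm v; rewrite normrN;
     have := normr_ge0 u; have := normr_ge0 v; lra.
have close x y : a <= x <= b -> c <= y <= d ->
    `|h (sl x y) - g (sl x y)| <= e / S.
  move=> /inr xab /inr ycd; apply: hg.
    by have := normr_ge0 c; have := normr_ge0 d; lra.
  by have := normr_ge0 a; have := normr_ge0 b; lra.
have dX y : c <= y <= d -> `|\int[mu]_(x in `[a, b]) dx h x y -
    \int[mu]_(x in `[a, b]) dx g x y| <= e / S * (b - a).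
  move=> ycd; rewrite -RintegralB//; [|exact: (continuous_integrable_itv _ _ (ch1 y))
    |exact: (continuous_integrable_itv _ _ (cg1 y))].
  apply: Rintegral_le_bound => //.
    by apply: continuous_integrable_itv => x; apply: cvgB; [exact: ch1|exact: cg1].
  by move=> x xab; rewrite /dx; apply: le_trans (lphi _ _) _; exact: close.
have dY x : a <= x <= b -> `|\int[mu]_(y in `[c, d]) dy h x y -
    \int[mu]_(y in `[c, d]) dy g x y| <= e / S * (d - c).
  move=> xab; rewrite -RintegralB//; [|exact: (continuous_integrable_itv _ _ (ch4 x))
    |exact: (continuous_integrable_itv _ _ (cg4 x))].
  apply: Rintegral_le_bound => //.
    by apply: continuous_integrable_itv => y; apply: cvgB; [exact: ch4|exact: cg4].
  by move=> y ycd; rewrite /dy; apply: le_trans (lJphi _ _) _; exact: close.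
rewrite -(subr0 (circulation _ _ _ _ _ _)) -(circ_diff dg ab cd) /circulation.
have := dX c; have := dX d; have := dY a; have := dY b.
rewrite !lexx ab cd => /(_ isT) + /(_ isT) + /(_ isT) + /(_ isT).
move: (\int[mu]_(x in _) dx h x c) (\int[mu]_(x in _) dx h x d)
  (\int[mu]_(x in _) dx g x c) (\int[mu]_(x in _) dx g x d)
  (\int[mu]_(y in _) dy h a y) (\int[mu]_(y in _) dy h b y)
  (\int[mu]_(y in _) dy g a y) (\int[mu]_(y in _) dy g b y) => p1 p2 p3 p4 q1 q2 q3 q4.
move=> h1 h2 h3 h4.
have -> : p1 + q2 - p2 - q1 - (p3 + q4 - p4 - q3) =
  (p1 - p3) + (q2 - q4) - ((p2 - p4) + (q1 - q3)) by ring.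
apply: le_trans (ler_normB _ _) _.
apply: le_trans (lerD (ler_normD _ _) (ler_normD _ _)) _.
have SE : e = e / S * S by rewrite divfK ?gt_eqF.
rewrite [leRHS]SE {2}/S.
have := ltW eS; move: (e / S) h1 h2 h3 h4 => eps h1 h2 h3 h4 eps0.
rewrite mulrDr mulrDr; lra.
Qed.

(** The product of h with (1 - ((q - z0) / r)^2)^n; the factors lie in one slice
    and commute. *)
Let peaked (r : R) z0 h n : quat R -> quat R :=
  iter n (fun g q => g q - r ^- 2 *: ((q - z0) * ((q - z0) * g q))) h.

Let peaked_hol r x0 y0 h n : slice_hol J h -> slice_hol J (peaked r (sl x0 y0) h n).
Proof.
move=> hh; elim: n => [//|n IH] /=; apply: slice_holD => //; apply: slice_holN.
have := slice_holMr (r ^- 2)%:A (slice_holMl JJ x0 y0 (slice_holMl JJ x0 y0 IH)).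
by congr slice_hol; apply/funext => q; rewrite -scalerAr mulr1.
Qed.

(** On the vertical sides x - x0 = r or - r. With t = (y0 - y) / r, at most 1/4, the
    components of 1 - ((q - z0) / r)^2 have absolute values t^2 and 2 t, and
    1/16 + 1/2 <= 3/4. *)
Let peaked_norm r x0 y0 h n x y : 0 < y0 -> r = 4 * y0 -> `|x - x0| = r ->
  0 <= y <= y0 ->
  `|peaked r (sl x0 y0) h n (sl x y)| <= (3 / 4) ^+ n * `|h (sl x y)|.
Proof.
move=> y00 r4 xr /andP[y0' yy]; have r0 : 0 < r by rewrite r4; lra.
elim: n => [|n IH]; first by rewrite expr0 mul1r.
rewrite /peaked iterS -/(peaked _ _ _ _).
set p := peaked _ _ _ _ _ in IH *.
have -> : p - r ^- 2 *: ((sl x y - sl x0 y0) * ((sl x y - sl x0 y0) * p)) =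
    sl (1 - r ^- 2 * ((x - x0) ^+ 2 - (y - y0) ^+ 2))
       (- (r ^- 2 * (2 * (x - x0) * (y - y0)))) * p.
  rewrite mulrA sliceB sliceM// !slice_mull scalerDr !scalerA scalerBl scale1r.
  rewrite scaleNr opprD addrA -!expr2; congr (_ - _ *: _ - _ *: _); ring.
rewrite qnormM [_ ^+ n.+1]exprS -[leRHS]mulrA; apply: ler_pM => //.
apply: le_trans (norm_slice_le JJ _ _) _.
have xr2 : (x - x0) ^+ 2 = r ^+ 2 by rewrite -real_normK ?num_real// xr.
pose t := (y0 - y) / r.
have t1 : t <= 1 / 4 by rewrite /t ler_pdivrMr// r4; lra.
have t0 : 0 <= t by rewrite /t divr_ge0//; lra.
have -> : `|1 - r ^- 2 * ((x - x0) ^+ 2 - (y - y0) ^+ 2)| = t ^+ 2.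
  rewrite (_ : 1 - _ = t ^+ 2); first by rewrite ger0_norm// sqr_ge0.
  by rewrite xr2 /t; field; rewrite gt_eqF.
have -> : `|- (r ^- 2 * (2 * (x - x0) * (y - y0)))| = 2 * t.
  rewrite [X in `|X|](_ : _ = 2 * t * ((x - x0) / r)); last by rewrite /t; field; rewrite gt_eqF.
  rewrite normrM [`|(x - x0) / r|]normrM xr [`|r^-1|]gtr0_norm ?invr_gt0//.
  by rewrite divff ?gt_eqF// mulr1 ger0_norm// mulr_ge0.
have : t ^+ 2 <= (1 / 4) ^+ 2 by rewrite ler_pXn2r ?nnegrE//; lra.
by rewrite expr2; lra.
Qed.

(** On the horizontal line through z0 the factor is a real bump centred at x0. *)
Let peaked_top r x0 y0 h n x : 0 < r ->
  l (peaked r (sl x0 y0) h n (sl x y0)) =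
  (1 - ((x - x0) / r) ^+ 2) ^+ n * l (h (sl x y0)).
Proof.
move=> r0; elim: n => [|n IH]; first by rewrite expr0 mul1r.
rewrite /peaked iterS -/(peaked _ _ _ _) lB lZ sliceB subrr slice_real.
rewrite -!scalerAl !mul1r !lZ IH [_ ^+ n.+1]exprS; field; rewrite gt_eqF//.
Qed.

Let peaked_real r z0 h n (x : R) : h x%:A = 0 -> peaked r z0 h n x%:A = 0.
Proof.
move=> h0; elim: n => [//|n IH]; rewrite /peaked iterS -/(peaked _ _ _ _) IH.
by rewrite !mulr0 scaler0 subr0.
Qed.

(** Cauchy's theorem for [peaked] on the rectangle between the real axis, where h
    vanishes, and the segment at height y0: the vertical sides contribute
    O((3/4)^n), hence so does the top side, against [peak_kernel_le0]. *)
Let unique_le0 h (s : R) : slice_hol J h -> `|s| <= 1 ->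
  (forall x : R, h x%:A = 0) -> forall x0 y0 : R, 0 < y0 -> s * l (h (sl x0 y0)) <= 0.
Proof.
move=> hh s1 h0 x0 y0 y00; pose r := 4 * y0.
have r0 : 0 < r by rewrite /r; lra.
have [c1 _] := cont_dir hh lphi.
have [_ c4] : (forall y, continuous (fun x => `|h (sl x y)|)) /\
     (forall x, continuous (fun y => `|h (sl x y)|)).
  by apply: cont_dir => // p q; exact: ler_dist_dist.
have [M1 M10 hM1] := continuous_bounded_itv 0 y0 (c4 (x0 - r)).
have [M2 M20 hM2] := continuous_bounded_itv 0 y0 (c4 (x0 + r)).
apply: (@peak_kernel_le0 _ (fun x => s * l (h (sl x y0))) x0 r ((M1 + M2) * y0) (3 / 4)).
- by move=> x; apply: cvgMr; exact: c1.
- by [].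
- lra.
- lra.
move=> n; pose g := peaked r (sl x0 y0) h n.
have gh : slice_hol J g by exact: peaked_hol.
have [cg1 cg2] := cont_dir gh lphi; have [cg3 cg4] := cont_dir gh lJphi.
have /(_ _ _)/eqP := @circ_hol g (x0 - r) (x0 + r) 0 y0 gh.
have le1 : x0 - r <= x0 + r by lra.
move=> /(_ le1 (ltW y00)); rewrite /circulation.
have -> : \int[mu]_(x in `[x0 - r, x0 + r]) dx g x 0 = 0.
  rewrite (_ : (fun x => dx g x 0) = cst 0) ?Rintegral_cst ?mul0r//.
  apply/funext => x; rewrite /dx slice_real /g peaked_real//.
  by have := lZ 0 0; rewrite scaler0 mul0r.
have side (x M : R) : `|x - x0| = r -> (forall y : R, 0 <= y <= y0 -> `| `|h (sl x y)| | <= M) ->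
    `|\int[mu]_(y in `[0, y0]) dy g x y| <= (3 / 4) ^+ n * M * y0.
  move=> xr hM; rewrite -[X in _ * X](subr0 y0); apply: Rintegral_le_bound => //.
  - exact: ltW.
  - exact: (continuous_integrable_itv _ _ (cg4 x)).
  - move=> y yy; rewrite /dy; apply: le_trans (ln _) _.
    rewrite qnormM imag_unit_norm// mul1r.
    apply: le_trans (peaked_norm h n y00 _ xr yy) _ => //.
    apply: ler_wpM2l; first by rewrite exprn_ge0//; lra.
    by have := hM _ yy; rewrite normr_id.
have hs1 := side (x0 - r) M1 _ hM1; have hs2 := side (x0 + r) M2 _ hM2.
move: hs1; rewrite addrAC subrr sub0r normrN (gtr0_norm r0) => /(_ erefl) hs1.
move: hs2; rewrite addrAC subrr add0r (gtr0_norm r0) => /(_ erefl) hs2.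
have -> : \int[mu]_(x in `[x0 - r, x0 + r])
     ((1 - ((x - x0) / r) ^+ 2) ^+ n * (s * l (h (sl x y0)))) =
     s * \int[mu]_(x in `[x0 - r, x0 + r]) dx g x y0.
  rewrite -RintegralZl//; last exact: (continuous_integrable_itv _ _ (cg1 y0)).
  by apply: eq_Rintegral => x _; rewrite /dx peaked_top// mulrCA.
move: hs1 hs2; set q1 := \int[mu]_(y in _) dy g (x0 - r) y.
set q2 := \int[mu]_(y in _) dy g (x0 + r) y.
set t := \int[mu]_(x in _) _ => hs1 hs2 /eqP tq.
have {tq} -> : t = q2 - q1 by lra.
apply: le_trans (ler_norm _) _; rewrite normrM.
apply: le_trans (ler_wpM2r (normr_ge0 _) s1) _; rewrite mul1r.
apply: le_trans (ler_normB _ _) _; lra.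
Qed.

Lemma slice_hol_unique_functional h : slice_hol J h ->
  (forall x : R, h x%:A = 0) -> forall x0 y0 : R, 0 < y0 -> l (h (sl x0 y0)) = 0.
Proof.
move=> hh h0 x0 y0 y00.
have := @unique_le0 h 1 hh _ h0 x0 y0 y00; rewrite normr1 lexx => /(_ isT).
have := @unique_le0 h (-1) hh _ h0 x0 y0 y00; rewrite normrN1 lexx => /(_ isT).
lra.
Qed.

End slice_uniqueness.

Section identity_principle.
Variable R : realType.
Implicit Types (J : quat R) (g h : quat R -> quat R).

Lemma slice_holNJ J h : slice_hol J h -> slice_hol (- J) h.
Proof.
have diffN g : slice_diff J g -> slice_diff (- J) g.
  move=> dg x0 y0; have [p hp] := dg x0 (- y0); exists p => e /hp[d d0 {}hp].
  exists d => // x y xy; have := hp x (- y).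
  have -> : - y - - y0 = - (y - y0) by ring.
  by rewrite !slice_opp normrN; exact.
move=> hh r e e0; have [g dg hg] := hh r e e0; exists g; first exact: diffN.
by move=> x y xr yr; rewrite !slice_opp; apply: hg; rewrite ?normrN.
Qed.

(** [slice_hol_unique_functional] for each of the four coordinates gives the upper
    half of the slice; the lower half is the upper half of the slice of - J. *)
Lemma slice_hol_eq0 J h : imag_units J -> slice_hol J h ->
  (forall x : R, h x%:A = 0) -> forall x y : R, h (slice J x y) = 0.
Proof.
have pos J' h' : imag_units J' -> slice_hol J' h' ->
    (forall x : R, h' x%:A = 0) -> forall x y : R, 0 < y -> h' (slice J' x y) = 0.
  move=> JJ hh h0 x y y0; apply: quat_eq0.
  - by apply: (slice_hol_unique_functional JJ (l := @qre R)) => //; exact: qre_le_norm.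
  - by apply: (slice_hol_unique_functional JJ (l := @qi R)) => //; exact: qi_le_norm.
  - by apply: (slice_hol_unique_functional JJ (l := @qj R)) => //; exact: qj_le_norm.
  - by apply: (slice_hol_unique_functional JJ (l := @qk R)) => //; exact: qk_le_norm.
move=> JJ hh h0 x y; have [y0|y0|->] := ltgtP y 0.
- rewrite -[J]opprK slice_opp; apply: pos => //; last by rewrite oppr_gt0.
    exact: imag_unitN.
  exact: slice_holNJ.
- exact: pos.
- by rewrite slice_real.
Qed.

Lemma slice_hol_eq J g h : imag_units J -> slice_hol J g -> slice_hol J h ->
  (forall x : R, g x%:A = h x%:A) ->
  forall x y : R, g (slice J x y) = h (slice J x y).
Proof.
move=> JJ hg hh gh x y; apply/eqP; rewrite -subr_eq0; apply/eqP.
apply: (@slice_hol_eq0 J (fun q => g q - h q)) => //.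
  by apply: slice_holD => //; exact: slice_holN.
by move=> z; rewrite gh subrr.
Qed.

End identity_principle.

(** * The cardinal sine on the real line *)

Section real_sinc.
Variable R : realType.
Local Notation mu := (@lebesgue_measure R).
Implicit Types (x w t : R) (k : int).

Definition rsinc x : R := if x == 0 then 1 else sin (pi * x) / (pi * x).

Lemma rsinc0 : rsinc 0 = 1.
Proof. by rewrite /rsinc eqxx. Qed.

Lemma rsincN x : rsinc (- x) = rsinc x.
Proof.
rewrite /rsinc oppr_eq0; case: eqP => // _.
by rewrite mulrN sinN invrN mulrNN.
Qed.

Let pi0 : pi != 0 :> R. Proof. by rewrite gt_eqF// pi_gt0. Qed.

Lemma rsincE x : pi * x * rsinc x = sin (pi * x).
Proof.
rewrite /rsinc; have [->|x0] := eqVneq; first by rewrite mulr0 sin0 mul0r.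
by rewrite mulrC divfK// mulf_neq0.
Qed.

Lemma sin_piDn x (n : nat) : sin (pi * (x + n%:R)) = (-1) ^+ n * sin (pi * x).
Proof.
elim: n => [|n IH]; first by rewrite addr0 mul1r.
have -> : pi * (x + n.+1%:R) = pi * (x + n%:R) + pi by rewrite -natr1; ring.
by rewrite sinDpi IH exprS mulN1r mulNr.
Qed.

Lemma sin_piBz x k : sin (pi * (x - k%:~R)) = (-1) ^+ `|k|%N * sin (pi * x).
Proof.
have sg (n : nat) : (-1) ^+ n * (-1) ^+ n = 1 :> R.
  by rewrite -exprMn mulrNN mulr1 expr1n.
case: k => n /=; last by rewrite NegzE mulrNz opprK -sin_piDn.
have := sin_piDn (x - n%:R) n; rewrite subrK => ->.
by rewrite mulrA sg mul1r.
Qed.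

Lemma sqr_sin_piBz x k : sin (pi * (x - k%:~R)) ^+ 2 = sin (pi * x) ^+ 2.
Proof. by rewrite sin_piBz exprMn -exprM mulnC exprM sqrrN !expr1n mul1r. Qed.

Lemma rsinc_int k : rsinc k%:~R = (k == 0)%:R.
Proof.
have [->|k0] := eqVneq k 0; first by rewrite rsinc0.
have := rsincE k%:~R.
have -> : pi * k%:~R = pi * (0 - (- k)%:~R) :> R by rewrite mulrNz opprK add0r.
rewrite sin_piBz mulr0 sin0 mulr0 => /eqP; rewrite mulf_eq0 => /orP[|/eqP//].
by rewrite mulf_eq0 (negPf pi0)/= mulrNz sub0r opprK intr_eq0 (negPf k0).
Qed.

Lemma Rintegral_FTC (f F : R -> R) (a b : R) : a < b -> continuous f ->
  (forall x, is_derive x 1 F (f x)) ->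
  \int[mu]_(x in `[a, b]) f x = F b - F a.
Proof.
move=> ab cf dF; rewrite /Rintegral (@continuous_FTC2 _ f F)//.
- exact: continuous_subspaceT.
- have cF : continuous F.
    by move=> x; apply/differentiable_continuous/derivable1_diffP; case: (dF x).
  split; first by move=> x _; case: (dF x).
    by apply: cvg_at_right_filter; exact: cF.
  by apply: cvg_at_left_filter; exact: cF.
- by move=> x _; rewrite derive1E; apply: derive_val.
Qed.

Lemma continuous_cosM w : continuous (fun t => cos (w * t)).
Proof.
move=> t; apply: (@continuous_comp _ _ _ (fun t => w * t) cos); last exact: continuous_cos.
by apply: cvgMr; exact: cvg_id.
Qed.

Lemma continuous_sinM w : continuous (fun t => sin (w * t)).
Proof.
move=> t; apply: (@continuous_comp _ _ _ (fun t => w * t) sin); last exact: continuous_sin.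
by apply: cvgMr; exact: cvg_id.
Qed.

Lemma Rintegral_cos (A w : R) : 0 < A ->
  \int[mu]_(t in `[(- A), A]) cos (w * t) = 2 * A * rsinc (A * w / pi).
Proof.
move=> A0; have [->|w0] := eqVneq w 0.
  rewrite mulr0 mul0r rsinc0 mulr1.
  under eq_Rintegral do rewrite mul0r cos0.
  rewrite Rintegral_cst// fine_measure_itv; last lra.
  by ring.
have dF (x : R) : is_derive x 1 (fun t => w^-1 * sin (w * t)) (cos (w * x)).
  apply: is_derive_eq.
  by rewrite /GRing.scale/= mulr1 mulrCA mulVf ?mulr1.
have NA : - A < A by lra.
rewrite (Rintegral_FTC NA (@continuous_cosM w) dF).
rewrite mulrN sinN mulrN opprK.
have -> : sin (w * A) = w * A * rsinc (A * w / pi).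
  have e : pi * (A * w / pi) = w * A by rewrite mulrC divfK// mulrC.
  by rewrite -e rsincE e.
by move: (rsinc _) => r; field; rewrite w0.
Qed.

(** Positive-definiteness of the sinc kernel, as an integral identity: the two
    squares add up to cosines of differences, and the integral of cos (w t) over
    [-A, A] is a sinc. *)
Lemma Rintegral_trig_squares (A : R) (I : Type) (s : seq I) (d lam : I -> R) :
  0 < A ->
  \int[mu]_(t in `[(- A), A]) (\sum_(i <- s) d i * cos (lam i * t)) ^+ 2 +
  \int[mu]_(t in `[(- A), A]) (\sum_(i <- s) d i * sin (lam i * t)) ^+ 2 =
  2 * A * \sum_(i <- s) \sum_(j <- s) d i * d j * rsinc (A * (lam i - lam j) / pi).
Proof.
move=> A0.
have cc (F : I -> R -> R) : (forall i, continuous (F i)) ->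
    continuous (fun t => \sum_(i <- s) F i t).
  by move=> cF t; apply: cvg_big => // *; [exact: add_continuous|exact: cF].
have isum (F : I -> R -> R) : (forall i, continuous (F i)) ->
    \int[mu]_(t in `[(- A), A]) \sum_(i <- s) F i t =
    \sum_(i <- s) \int[mu]_(t in `[(- A), A]) F i t.
  move=> cF; elim: s {cc} => [|i s' IH].
    under eq_Rintegral do rewrite big_nil.
    by rewrite big_nil Rintegral_cst// mul0r.
  under eq_Rintegral do rewrite big_cons.
  rewrite big_cons -IH RintegralD//; first exact: continuous_integrable_itv.
  apply: continuous_integrable_itv => t.
  by apply: cvg_big => // *; [exact: add_continuous|exact: cF].
have cMd (d' : R) (F : R -> R) : continuous F -> continuous (fun t => d' * F t).
  by move=> cF t; apply: cvgMr; exact: cF.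
have csq (F : R -> R) : continuous F -> continuous (fun t => F t ^+ 2).
  move=> cF t; apply: (@continuous_comp _ _ _ F (fun z => z ^+ 2)); first exact: cF.
  exact: exprn_continuous.
rewrite -RintegralD//; last 2 first.
- apply: continuous_integrable_itv; apply: csq; apply: cc => i; apply: cMd.
  exact: continuous_cosM.
- apply: continuous_integrable_itv; apply: csq; apply: cc => i; apply: cMd.
  exact: continuous_sinM.
transitivity (\int[mu]_(t in `[(- A), A]) \sum_(i <- s) \sum_(j <- s)
    (d i * d j) * cos ((lam i - lam j) * t)).
  apply: eq_Rintegral => t _; rewrite !expr2 !big_distrl/= -big_split/=.
  apply: eq_bigr => i _; rewrite !big_distrr/= -big_split/=.
  by apply: eq_bigr => j _; rewrite mulrBl cosB; ring.
rewrite isum; last first.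
  by move=> i; apply: cc => j; apply: cMd; exact: continuous_cosM.
rewrite big_distrr/=; apply: eq_bigr => i _; rewrite isum; last first.
  by move=> j; apply: cMd; exact: continuous_cosM.
rewrite big_distrr/=; apply: eq_bigr => j _.
rewrite RintegralZl//; last exact: (continuous_integrable_itv _ _ (@continuous_cosM _)).
by rewrite Rintegral_cos// mulrCA.
Qed.

Lemma sinc_kernel_ge0 (I : Type) (s : seq I) (d lam : I -> R) :
  0 <= \sum_(i <- s) \sum_(j <- s) d i * d j * rsinc (lam i - lam j).
Proof.
have := Rintegral_trig_squares s d lam (pi_gt0 R).
set S := \sum_(i <- s) _; set S' := (X in _ = X); move=> h.
have {h} : 0 <= S' by rewrite -h addr_ge0// Rintegral_ge0// => t _; exact: sqr_ge0.
rewrite /S' => {S'}; rewrite pmulr_rge0 ?mulr_gt0 ?pi_gt0//.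
congr (0 <= _); apply: eq_bigr => i _; apply: eq_bigr => j _.
by rewrite [pi * _]mulrC mulfK.
Qed.

(** Bessel's inequality for the integer translates of the sinc kernel: test
    [sinc_kernel_ge0] at the point w with weight 1 and at the integers k of s with
    weights - sinc (w - k). Sinc vanishes at the nonzero integers, so the rows of the
    integers cancel. *)
Lemma rsinc_bessel w (s : seq int) : uniq s ->
  \sum_(k <- s) rsinc (w - k%:~R) ^+ 2 <= 1.
Proof.
move=> us.
(* None stands for the point w, Some k for the integer k *)
pose d o := if o is Some k then - rsinc (w - k%:~R) else 1.
pose lam o := if o is Some k then k%:~R else w.
have := sinc_kernel_ge0 (None :: map Some s) d lam.
rewrite !big_cons !big_map /= subrr rsinc0 !mul1r.
have e1 : \sum_(j <- s) 1 * - rsinc (w - j%:~R) * rsinc (w - j%:~R) =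
    - \sum_(k <- s) rsinc (w - k%:~R) ^+ 2.
  by rewrite -sumrN; apply: eq_bigr => k _; ring.
rewrite e1.
have e2 : \sum_(j <- s) (\sum_(j0 <- None :: map Some s) d (Some j) * d j0 *
    rsinc (j%:~R - lam j0)) = 0.
  rewrite big_seq big1// => k ks; rewrite big_cons big_map/= (bigD1_seq k)//=.
  rewrite subrr rsinc0 big1 => [|j jk]; last first.
    by rewrite -intrB rsinc_int subr_eq0 eq_sym (negPf jk) mulr0.
  have -> : rsinc (k%:~R - w) = rsinc (w - k%:~R).
    by rewrite -rsincN opprB.
  ring.
rewrite e2; lra.
Qed.

End real_sinc.

Section sinc_completeness.
Variable R : realType.
Implicit Types (x w : R).

Lemma ge0_of_derive (f df : R -> R) b : 0 <= b -> f 0 = 0 ->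
  (forall y : R, is_derive y 1 f (df y)) -> (forall y, 0 <= y <= b -> 0 <= df y) ->
  0 <= f b.
Proof.
move=> b0 f0 dfP df0; rewrite -f0; apply: (@ger0_derive1_le_cc _ f 0 b) => //.
- move=> y; rewrite in_itv/= => /andP[y0 yb].
  by rewrite derive1E (@derive_val _ _ _ _ _ _ _ (dfP y)) df0// !ltW.
- apply: continuous_subspaceT => y.
  by apply/differentiable_continuous/derivable1_diffP; case: (dfP y).
- by rewrite in_itv/= lexx.
- by rewrite in_itv/= b0 lexx.
Qed.

Lemma mul_cos_le_sin x : 0 <= x <= pi / 2 -> x * cos x <= sin x.
Proof.
move=> /andP[x0 xpi]; rewrite -subr_ge0.
apply: (@ge0_of_derive (fun y => sin y - y * cos y) (fun y => y * sin y)) => //.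
- by rewrite sin0 mul0r subr0.
- by move=> y; apply: is_derive_eq; rewrite /GRing.scale/=; ring.
move=> y /andP[y0 yx]; rewrite mulr_ge0// sin_ge0_pi// y0/=.
by have := pi_gt0 R; lra.
Qed.

(** This is 1 / sin^2 <= 1 + 1 / x^2 with the denominators cleared, and it comes
    from squaring x cos x <= sin x. *)
Lemma sqr_le_sin x : `|x| <= pi / 2 -> x ^+ 2 <= sin x ^+ 2 * (1 + x ^+ 2).
Proof.
have pos (y : R) : 0 <= y <= pi / 2 -> y ^+ 2 <= sin y ^+ 2 * (1 + y ^+ 2).
  move=> yp; have /andP[y0 yp2] := yp; have := mul_cos_le_sin yp.
  have c0 : 0 <= cos y by apply: cos_ge0_pihalf; rewrite yp2 andbT; lra.
  rewrite -(@ler_pXn2r _ 2)// ?nnegrE ?mulr_ge0//; last first.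
    by apply: sin_ge0_pi; rewrite y0/=; have := pi_gt0 R; lra.
  by rewrite exprMn cos2sin2; lra.
move=> xp; have [x0|x0] := leP 0 x; first by apply: pos; rewrite x0/= -(ger0_norm x0).
have := pos (- x); rewrite sinN !sqrrN; apply.
by rewrite -(ltr0_norm x0) xp normr_ge0.
Qed.

(** The partial-fraction expansion of 1 / sin^2, in the finite form obtained by
    halving the angle m times with 1 / sin^2 + 1 / cos^2 = 4 / sin^2 (double angle). *)
Lemma sum_inv_sqr_sin m w : sin (pi * w) != 0 ->
  (forall k : nat, sin (pi * (w - k%:R) / 2 ^+ m) != 0) /\
  \sum_(0 <= k < 2 ^ m) sin (pi * (w - k%:R) / 2 ^+ m) ^- 2 =
  4 ^+ m / sin (pi * w) ^+ 2.
Proof.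
move=> sw; elim: m => [|m [nz IH]].
  split=> [k|]; last first.
    by rewrite expn0 big_nat1 !expr0 subr0 divr1 mul1r.
  rewrite expr0 divr1; have := sin_piBz w k; rewrite /= => ->.
  by rewrite mulf_neq0// expf_neq0// oppr_eq0 oner_eq0.
have dbl k : pi * (w - k%:R) / 2 ^+ m = (pi * (w - k%:R) / 2 ^+ m.+1) *+ 2.
  by rewrite exprS -mulr_natr; field; rewrite expf_neq0// pnatr_eq0.
have nz' k : sin (pi * (w - k%:R) / 2 ^+ m.+1) != 0 /\
    cos (pi * (w - k%:R) / 2 ^+ m.+1) != 0.
  have := nz k; rewrite dbl sin_mulr2n mulrn_eq0/= mulf_eq0 negb_or.
  by move=> /andP[].
split=> [k|]; first by have [] := nz' k.
have -> : (2 ^ m.+1 = 2 ^ m + 2 ^ m)%N by rewrite expnS mul2n addnn.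
rewrite (@big_cat_nat _ _ _ (2 ^ m))//= ?leq_addr//.
rewrite -{2}[(2 ^ m)%N]add0n big_addn addnK -big_split/=.
rewrite [4 ^+ m.+1]exprS -[RHS]mulrA -IH big_distrr/=; apply: eq_bigr => k _.
have [s0 c0] := nz' k.
have -> : pi * (w - (k + 2 ^ m)%:R) / 2 ^+ m.+1 =
    pi * (w - k%:R) / 2 ^+ m.+1 - pi / 2.
  rewrite natrD natrX exprS; field; rewrite expf_neq0// pnatr_eq0//.
rewrite sinBpihalf dbl sin_mulr2n.
set a := pi * (w - k%:R) / 2 ^+ m.+1 in s0 c0 *; have := cos2Dsin2 a.
move: (sin a) (cos a) s0 c0 => sa ca s0 c0 e.
transitivity ((ca ^+ 2 + sa ^+ 2) / (sa ^+ 2 * ca ^+ 2)).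
  by field; rewrite s0 c0.
by rewrite e; field; rewrite s0 c0.
Qed.

(** The squares of the integer translates of sinc add up to one. Off the integers,
    [sum_inv_sqr_sin] writes 1 as a sum of 2^n terms, and [sqr_le_sin] bounds each of
    them by the square of a sinc up to a total error of at most 2^-n. *)
Lemma rsinc_complete w e : 0 < e ->
  exists2 s : seq int, uniq s & 1 - e <= \sum_(k <- s) rsinc (w - k%:~R) ^+ 2.
Proof.
move=> e0; have [sw|sw] := eqVneq (sin (pi * w)) 0.
  exists [:: Num.floor w] => //; rewrite big_seq1.
  have -> : rsinc (w - (Num.floor w)%:~R) = 1; last by rewrite expr1n; lra.
  rewrite /rsinc; case: eqP => // /eqP wn0; exfalso.
  have := floor_itv w => /andP[f1 f2].
  have f3 : 0 < w - (Num.floor w)%:~R by rewrite lt_neqAle eq_sym wn0/= subr_ge0.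
  have sp : 0 < sin (pi * (w - (Num.floor w)%:~R)).
    apply: sin_gt0_pi; rewrite mulr_gt0 ?pi_gt0//= gtr_pMr ?pi_gt0//.
    by rewrite ltrBlDl -[X in _ + X]/(1%:~R) -intrD.
  have := sqr_sin_piBz w (Num.floor w); rewrite sw expr0n/= => /eqP.
  by rewrite sqrf_eq0 gt_eqF.
have [m hm] : exists m, (2^-1 : R) ^+ m <= e.
  have : (fun n => (2^-1 : R) ^+ n) @ \oo --> (0 : R).
    by apply: cvg_expr; rewrite ger0_norm//; lra.
  move=> /cvgrPdist_le/(_ _ e0)[m _ /(_ m (leqnn m))].
  rewrite /= sub0r normrN => h; exists m; apply: le_trans h; exact: ler_norm.
(* translate by j so that v lies between N - 1 and N: then |v - k| <= N for all
   0 <= k < 2 N, and every angle below is at most pi / 2 *)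
pose N := (2 ^ m)%N.
pose j : int := (N%:Z - 1 - Num.floor w)%R.
pose v : R := w + j%:~R.
have jE : j%:~R = N%:R - 1 - (Num.floor w)%:~R :> R by rewrite /j !intrB.
have /andP[v1 v2] : N%:R - 1 <= v < N%:R.
  by have := floor_itv w; rewrite /v jE intrD => /andP[? ?]; apply/andP; lra.
exists [seq k%:Z - j | k <- iota 0 (2 ^ m.+1)].
  by rewrite map_inj_uniq ?iota_uniq// => a b /addIr[].
have sv : sin (pi * v) != 0.
  by rewrite -sqrf_eq0 -(sqr_sin_piBz v j) /v addrK sqrf_eq0.
have [nz hsum] := sum_inv_sqr_sin m.+1 sv.
set S := sin (pi * v) ^+ 2 in hsum.
have S0 : 0 < S by rewrite exprn_even_gt0.
have S1 : S <= 1 by rewrite /S sin2cos2 gerBl sqr_ge0.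
pose q : R := 4 ^+ m.+1.
have q0 : 0 < q by rewrite exprn_gt0.
have q4 : q = (2 ^+ m.+1) ^+ 2 by rewrite /q -exprM mulnC exprM; congr (_ ^+ _); ring.
rewrite big_map (_ : iota 0 (2 ^ m.+1) = index_iota 0 (2 ^ m.+1)); last first.
  by rewrite /index_iota subn0.
have term k : (k < 2 ^ m.+1)%N ->
    S / q * sin (pi * (v - k%:R) / 2 ^+ m.+1) ^- 2 <=
    rsinc (w - (k%:Z - j)%:~R) ^+ 2 + S / q.
  move=> kN; have -> : w - (k%:Z - j)%:~R = v - k%:R by rewrite intrB /v; ring.
  have vk0 : v - k%:R != 0.
    by apply: contra_neq (nz k) => ->; rewrite mulr0 mul0r sin0.
  have pi0 : pi != 0 :> R by rewrite gt_eqF// pi_gt0.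
  have sinvk : sin (pi * (v - k%:R)) ^+ 2 = S by have := sqr_sin_piBz v k.
  have -> : rsinc (v - k%:R) ^+ 2 = S / (pi * (v - k%:R)) ^+ 2.
    by rewrite /rsinc (negPf vk0) expr_div_n sinvk.
  set x := pi * (v - k%:R) / 2 ^+ m.+1.
  have -> : (pi * (v - k%:R)) ^+ 2 = x ^+ 2 * q.
    by rewrite q4 -exprMn divfK// expf_neq0.
  have x0 : x != 0 by rewrite !mulf_neq0// invr_neq0// expf_neq0.
  have xpi : `|x| <= pi / 2.
    have kN' : k%:R + 1 <= 2 * N%:R :> R.
      by rewrite -natrM natr1 ler_nat /N -expnS.
    have k0 : 0 <= k%:R :> R by [].
    rewrite /x !normrM [`|pi|]gtr0_norm ?pi_gt0//.
    rewrite [`|(2 ^+ m.+1)^-1|]gtr0_norm ?invr_gt0 ?exprn_gt0//.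
    rewrite -mulrA ler_pM2l ?pi_gt0// ler_pdivrMr ?exprn_gt0//.
    rewrite exprS mulrA mulVf ?pnatr_eq0// mul1r -natrX -/N ler_norml.
    by apply/andP; lra.
  have := sqr_le_sin xpi; have := nz k; rewrite -/x.
  move: (sin x) => sx sx0 h.
  have sx2 : 0 < sx ^+ 2 by rewrite exprn_even_gt0.
  have x2 : 0 < x ^+ 2 by rewrite exprn_even_gt0.
  have -> : S / (x ^+ 2 * q) + S / q = S / q * (x ^- 2 + 1).
    by field; rewrite x0 gt_eqF.
  rewrite ler_pM2l ?divr_gt0//.
  have -> : x ^- 2 + 1 = (1 + x ^+ 2) / x ^+ 2 by field; rewrite x0.
  by rewrite ler_pdivlMr// mulrC ler_pdivrMr// mulrC.
have : \sum_(0 <= k < 2 ^ m.+1) S / q * sin (pi * (v - k%:R) / 2 ^+ m.+1) ^- 2 <=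
    \sum_(0 <= k < 2 ^ m.+1) (rsinc (w - (k%:Z - j)%:~R) ^+ 2 + S / q).
  by rewrite !big_mkord; apply: ler_sum => k _; exact: term.
rewrite -big_distrr/= hsum big_split/= sumr_const_nat subn0.
have -> : S / q * (4 ^+ m.+1 / S) = 1.
  by rewrite -/q; field; rewrite !gt_eqF.
have -> : S / q *+ 2 ^ m.+1 = S / 2 ^+ m.+1.
  by rewrite -mulr_natr natrX q4; field; rewrite expf_neq0.
have : S / 2 ^+ m.+1 <= e.
  apply: le_trans hm; rewrite exprS invfM mulrA -exprVn.
  by rewrite ler_piMl ?exprn_ge0//; lra.
set X := \sum_(_ <= _ < _) _; lra.
Qed.

End sinc_completeness.

(** * Band-limited transforms and sampling on the real line *)

Lemma sum_uniq_subset (V : nmodType) (I : eqType) (s s' : seq I) (F : I -> V) :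
  uniq s -> uniq s' -> {subset s <= s'} ->
  \sum_(k <- s') F k = \sum_(k <- s) F k + \sum_(k <- s' | k \notin s) F k.
Proof.
move=> us us' ss'; rewrite (bigID (mem s))/=; congr (_ + _).
rewrite -big_filter; apply: perm_big; apply: uniq_perm => //.
  exact: filter_uniq.
by move=> k; rewrite mem_filter; case ks: (k \in s) => //=; exact: ss'.
Qed.

Section cauchy_schwarz.
Context d (T : measurableType d) (R : realType).
Variables (mu : {measure set T -> \bar R}) (D : set T).
Hypothesis mD : measurable D.
Implicit Types f g : T -> R.

Definition square_integrable f :=
  measurable_fun D f /\ mu.-integrable D (fun x => (f x ^+ 2)%:E).

Lemma square_integrableM f g : square_integrable f -> square_integrable g ->
  mu.-integrable D (fun x => (f x * g x)%:E).
Proof.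
move=> [mf f2] [mg g2]; apply: le_integrable (rintegrableD mD f2 g2) => //.
  by apply/measurable_EFinP; exact: measurable_funM.
move=> x _ /=; rewrite lee_fin [leRHS]ger0_norm ?addr_ge0 ?sqr_ge0//.
rewrite normrM -[f x ^+ 2]real_normK ?num_real// -[g x ^+ 2]real_normK ?num_real//.
have := sqr_ge0 (`|f x| - `|g x|); have := mulr_ge0 (normr_ge0 (f x)) (normr_ge0 (g x)).
by rewrite sqrrB mulr2n; lra.
Qed.

Lemma discriminant_le (a b c : R) : (forall t, 0 <= a * t ^+ 2 + 2 * b * t + c) ->
  b ^+ 2 <= a * c.
Proof.
move=> h; have [a0|a0] := eqVneq a 0.
  have [->|b0] := eqVneq b 0; first by rewrite a0 expr0n mul0r.
  have := h (- (c + 1) / (2 * b)); rewrite a0 mul0r add0r mulrC divfK; first lra.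
  by rewrite mulf_neq0.
have a_gt0 : 0 < a.
  rewrite lt_neqAle eq_sym a0/= leNgt; apply/negP => alt0.
  pose s := (`|b| * 2 + `|c| + 1) / - a + 1.
  have na : 0 < - a by rewrite oppr_gt0.
  have s1 : 1 <= s by rewrite lerDr divr_ge0 ?addr_ge0 ?mulr_ge0// ltW.
  have sa : - a * s = `|b| * 2 + `|c| + 1 - a.
    by rewrite /s mulrDr mulr1 mulrC divfK// gt_eqF.
  have := h s; have := ler_norm b; have := ler_norm c.
  have c0 := normr_ge0 c.
  have e : a * s ^+ 2 = - (`|b| * 2 + `|c| + 1 - a) * s by rewrite -sa; ring.
  rewrite e; have s0 : 0 <= s by lra.
  move=> cc bb; apply/negP; rewrite -ltNge.
  have h1 : b * s <= `|b| * s by rewrite ler_wpM2r.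
  have h2 : `|c| <= `|c| * s by rewrite ler_peMr.
  have h3 : 0 <= - a * s by rewrite mulr_ge0// ltW.
  lra.
have := h (- b / a); rewrite -(pmulr_rge0 _ a_gt0).
have -> : a * (a * (- b / a) ^+ 2 + 2 * b * (- b / a) + c) = a * c - b ^+ 2.
  by field; rewrite gt_eqF.
by rewrite subr_ge0.
Qed.

Lemma cauchy_schwarz f g : square_integrable f -> square_integrable g ->
  (\int[mu]_(x in D) (f x * g x)) ^+ 2 <=
  \int[mu]_(x in D) (f x ^+ 2) * \int[mu]_(x in D) (g x ^+ 2).
Proof.
move=> hf hg; have fg := square_integrableM hf hg.
have [_ f2] := hf; have [_ g2] := hg.
apply: discriminant_le => t.
have -> : \int[mu]_(x in D) (f x ^+ 2) * t ^+ 2 +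
    2 * \int[mu]_(x in D) (f x * g x) * t + \int[mu]_(x in D) (g x ^+ 2) =
    \int[mu]_(x in D) (t * f x + g x) ^+ 2.
  transitivity (\int[mu]_(x in D) (t ^+ 2 * f x ^+ 2 + (2 * t) * (f x * g x) + g x ^+ 2)).
    rewrite RintegralD//; last first.
      by apply: rintegrableD => //; exact: rintegrableZ.
    rewrite RintegralD//; [|exact: rintegrableZ..].
    rewrite !RintegralZl//; ring.
  by apply: eq_Rintegral => x _; ring.
by apply: Rintegral_ge0 => x _; exact: sqr_ge0.
Qed.

End cauchy_schwarz.

Lemma continuous_square_integrable (R : realType) (f : R -> R) (a b : R) :
  continuous f -> square_integrable (@lebesgue_measure R) `[a, b] f.
Proof.
move=> cf; split; first by apply: measurable_funTS; exact: continuous_measurable_fun.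
apply: continuous_integrable_itv => x.
by apply: (@continuous_comp _ _ _ f (fun z => z ^+ 2)); [exact: cf|exact: exprn_continuous].
Qed.

Section band_limited.
Variables (R : realType) (A : R).
Hypothesis A0 : 0 < A.
Local Notation mu := (@lebesgue_measure R).
Local Notation band := (`[(- A), A]%classic : set R).
Implicit Types (u v : R -> R) (x w : R).

(** The inverse transform, up to a constant, of a pair of real spectra supported
    in [-A, A]. *)
Definition band_transform u v x : R :=
  \int[mu]_(t in `[(- A), A]) (cos (x * t) * u t + sin (x * t) * v t).

Definition band_energy u v : R :=
  2 * (\int[mu]_(t in `[(- A), A]) u t ^+ 2 + \int[mu]_(t in `[(- A), A]) v t ^+ 2)
  * (2 * A).

Let cos_ctn (I : Type) (s : seq I) (d lam : I -> R) :
  continuous (fun t => \sum_(i <- s) d i * cos (lam i * t)).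
Proof.
move=> t; apply: cvg_big => // *; [exact: add_continuous|apply: cvgMr].
exact: continuous_cosM.
Qed.

Let sin_ctn (I : Type) (s : seq I) (d lam : I -> R) :
  continuous (fun t => \sum_(i <- s) d i * sin (lam i * t)).
Proof.
move=> t; apply: cvg_big => // *; [exact: add_continuous|apply: cvgMr].
exact: continuous_sinM.
Qed.

Section spectrum.
Variables u v : R -> R.
Hypotheses (hu : square_integrable mu band u) (hv : square_integrable mu band v).

Let iC x : mu.-integrable band (fun t => (cos (x * t) * u t)%:E).
Proof.
apply: square_integrableM => //; apply: continuous_square_integrable.
exact: continuous_cosM.
Qed.

Let iS x : mu.-integrable band (fun t => (sin (x * t) * v t)%:E).
Proof.
apply: square_integrableM => //; apply: continuous_square_integrable.
exact: continuous_sinM.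
Qed.

(** By the Cauchy-Schwarz inequality against the combinations of cosines and sines,
    all finite combinations of samples are controlled by the sinc kernel. Bessel's
    inequality and the sampling error are two instances. *)
Lemma band_transform_sum (I : Type) (s : seq I) (d lam : I -> R) :
  (\sum_(i <- s) d i * band_transform u v (lam i)) ^+ 2 <=
  band_energy u v *
    \sum_(i <- s) \sum_(j <- s) d i * d j * rsinc (A * (lam i - lam j) / pi).
Proof.
pose C t := \sum_(i <- s) d i * cos (lam i * t).
pose S t := \sum_(i <- s) d i * sin (lam i * t).
have hC : square_integrable mu band C.
  by apply: continuous_square_integrable; exact: cos_ctn.
have hS : square_integrable mu band S.
  by apply: continuous_square_integrable; exact: sin_ctn.
have -> : \sum_(i <- s) d i * band_transform u v (lam i) =
    \int[mu]_(t in `[(- A), A]) (C t * u t) + \int[mu]_(t in `[(- A), A]) (S t * v t).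
  rewrite -RintegralD//; [|exact: square_integrableM..].
  rewrite /C /S {C S hC hS}.
  elim: s => [|i s' IH].
    rewrite big_nil; under eq_Rintegral do rewrite !big_nil !mul0r addr0.
    by rewrite Rintegral_cst// mul0r.
  rewrite big_cons IH /band_transform -RintegralZl//; last exact: rintegrableD.
  rewrite -RintegralD//; last 2 first.
  - by apply: rintegrableZ => //; exact: rintegrableD.
  - apply: rintegrableD => //; apply: square_integrableM => //;
      apply: continuous_square_integrable; [exact: cos_ctn|exact: sin_ctn].
  by apply: eq_Rintegral => t _; rewrite !big_cons; ring.
have h1 : (\int[mu]_(t in `[(- A), A]) (C t * u t)) ^+ 2 <= _ :=
  cauchy_schwarz (mu := mu) (measurable_itv _) hC hu.
have h2 : (\int[mu]_(t in `[(- A), A]) (S t * v t)) ^+ 2 <= _ :=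
  cauchy_schwarz (mu := mu) (measurable_itv _) hS hv.
have h3 := Rintegral_trig_squares s d lam A0.
rewrite -/C -/S in h3.
have nn (f : R -> R) : 0 <= \int[mu]_(t in `[(- A), A]) f t ^+ 2.
  by apply: Rintegral_ge0 => t _; exact: sqr_ge0.
rewrite /band_energy -[leRHS]mulrA -h3.
move: (nn C) (nn S) (nn u) (nn v) h1 h2.
move: (\int[mu]_(t in _) C t ^+ 2) (\int[mu]_(t in _) S t ^+ 2) => c2 s2.
move: (\int[mu]_(t in _) u t ^+ 2) (\int[mu]_(t in _) v t ^+ 2) => u2 v2.
move: (\int[mu]_(t in _) (C t * u t)) (\int[mu]_(t in _) (S t * v t)) => p r.
move=> c0 s0 u0 v0 h1 h2.
have := sqr_ge0 (p - r); have := mulr_ge0 c0 v0; have := mulr_ge0 s0 u0.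
rewrite sqrrB sqrrD !mulr2n => m1 m2 m3.
have -> : 2 * (u2 + v2) * (c2 + s2) =
  2 * (c2 * u2) + 2 * (s2 * v2) + 2 * (c2 * v2) + 2 * (s2 * u2) by ring.
lra.
Qed.

Lemma band_energy_ge0 : 0 <= band_energy u v.
Proof.
by rewrite !mulr_ge0 ?addr_ge0 ?Rintegral_ge0// => [t _|t _|]; rewrite ?sqr_ge0// ltW.
Qed.

Let sample_diff (k j : int) :
  A * (pi * k%:~R / A - pi * j%:~R / A) / pi = (k - j)%:~R :> R.
Proof.
have p0 : pi != 0 :> R by rewrite gt_eqF// pi_gt0.
rewrite -mulrBl -mulrBr -intrB; move: (k - j) => m.
rewrite [A * _]mulrC divfK ?gt_eqF// [pi * _]mulrC mulfK//.
Qed.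

(** The samples themselves are taken as weights; the nodes are pi / A apart, so the
    quadratic form of [band_transform_sum] is diagonal. *)
Lemma band_transform_bessel (s : seq int) : uniq s ->
  \sum_(k <- s) band_transform u v (pi * k%:~R / A) ^+ 2 <= band_energy u v.
Proof.
move=> us; pose L k := band_transform u v (pi * k%:~R / A).
have := @band_transform_sum _ s L (fun k => pi * k%:~R / A).
have -> : \sum_(i <- s) \sum_(j <- s) L i * L j *
    rsinc (A * (pi * i%:~R / A - pi * j%:~R / A) / pi) = \sum_(k <- s) L k ^+ 2.
  rewrite [LHS]big_seq [RHS]big_seq; apply: eq_bigr => k ks.
  rewrite (bigD1_seq k)//= sample_diff subrr rsinc0 big1 ?addr0 ?mulr1//.
  by move=> j jk; rewrite sample_diff rsinc_int subr_eq0 eq_sym (negPf jk) mulr0.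
have -> : \sum_(i <- s) L i * band_transform u v (pi * i%:~R / A) =
    \sum_(k <- s) L k ^+ 2 by apply: eq_bigr => k _; rewrite expr2.
have : 0 <= \sum_(k <- s) L k ^+ 2 by apply: sumr_ge0 => k _; exact: sqr_ge0.
set X := \sum_(k <- s) L k ^+ 2; rewrite le_eqVlt => /predU1P[<- _|X0].
  exact: band_energy_ge0.
by rewrite expr2 ler_pM2r.
Qed.

(** Weight 1 at the point x and - sinc (A x / pi - k) at the nodes k of s, as in
    [rsinc_bessel]. *)
Lemma band_transform_sampling_error (s : seq int) x : uniq s ->
  (band_transform u v x -
    \sum_(k <- s) rsinc (A / pi * x - k%:~R) * band_transform u v (pi * k%:~R / A)) ^+ 2
  <= band_energy u v * (1 - \sum_(k <- s) rsinc (A / pi * x - k%:~R) ^+ 2).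
Proof.
move=> us; pose d o := if o is Some k then - rsinc (A / pi * x - k%:~R) else 1.
pose lam o := if o is Some k then pi * k%:~R / A else x.
have p0 : pi != 0 :> R by rewrite gt_eqF// pi_gt0.
have := @band_transform_sum _ (None :: map Some s) d lam.
rewrite !big_cons !big_map /= subrr mulr0 mul0r rsinc0 !mul1r.
have -> : \sum_(j <- s) - rsinc (A / pi * x - j%:~R) *
    band_transform u v (pi * j%:~R / A) = - \sum_(k <- s) rsinc (A / pi * x - k%:~R) *
    band_transform u v (pi * k%:~R / A).
  by rewrite -sumrN; apply: eq_bigr => k _; rewrite mulNr.
have nx (k : int) : A * (x - pi * k%:~R / A) / pi = A / pi * x - k%:~R.
  rewrite mulrBr mulrBl [A * (_ / A)]mulrC divfK ?gt_eqF// [pi * _]mulrC mulfK//.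
  by rewrite mulrAC.
have -> : \sum_(j <- s) 1 * - rsinc (A / pi * x - j%:~R) *
    rsinc (A * (x - pi * j%:~R / A) / pi) = - \sum_(k <- s) rsinc (A / pi * x - k%:~R) ^+ 2.
  by rewrite -sumrN; apply: eq_bigr => k _; rewrite nx mul1r mulNr expr2.
have -> : \sum_(j <- s) \sum_(j0 <- None :: map Some s) d (Some j) * d j0 *
    rsinc (A * (pi * j%:~R / A - lam j0) / pi) = 0.
  rewrite big_seq big1// => k ks; rewrite big_cons big_map/= (bigD1_seq k)//=.
  rewrite sample_diff subrr rsinc0 big1 => [|j jk]; last first.
    by rewrite sample_diff rsinc_int subr_eq0 eq_sym (negPf jk) mulr0.
  have -> : rsinc (A * (pi * k%:~R / A - x) / pi) = rsinc (A / pi * x - k%:~R).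
    by rewrite -nx -rsincN -mulNr -mulrN opprB.
  by move: (rsinc _) => r; ring.
by rewrite addr0.
Qed.

(** Shannon's sampling theorem: by [rsinc_complete] the error of
    [band_transform_sampling_error] is small as soon as s is large. *)
Lemma band_transform_sampling x e : 0 < e -> exists2 s : seq int, uniq s &
  forall s', uniq s' -> {subset s <= s'} ->
  `|band_transform u v x - \sum_(k <- s')
     rsinc (A / pi * x - k%:~R) * band_transform u v (pi * k%:~R / A)| <= e.
Proof.
move=> e0; have E0 := band_energy_ge0; have E1 : 0 < band_energy u v + 1 by lra.
have eE : 0 < e ^+ 2 / (band_energy u v + 1) by rewrite divr_gt0// exprn_gt0.
have [s us hs] := rsinc_complete (A / pi * x) eE; exists s => // s' us' ss'.
rewrite -(@ler_pXn2r _ 2)// ?nnegrE ?(ltW e0)// real_normK ?num_real//.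
apply: le_trans (band_transform_sampling_error x us') _.
have le_s : \sum_(k <- s) rsinc (A / pi * x - k%:~R) ^+ 2 <=
    \sum_(k <- s') rsinc (A / pi * x - k%:~R) ^+ 2.
  by rewrite (sum_uniq_subset _ us us' ss') lerDl sumr_ge0// => k _; exact: sqr_ge0.
have : 1 - \sum_(k <- s') rsinc (A / pi * x - k%:~R) ^+ 2 <=
  e ^+ 2 / (band_energy u v + 1) by lra.
have := rsinc_bessel (A / pi * x) us'.
move: (\sum_(k <- s') _) => X X1 hX.
apply: (@le_trans _ _ ((band_energy u v + 1) * (1 - X))).
  by rewrite ler_wpM2r; lra.
by rewrite mulrC -ler_pdivlMr.
Qed.

End spectrum.
End band_limited.

(** * The quaternionic sinc on strips *)

Section quaternion_limits.
Variable R : realType.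
Implicit Types (u : nat -> quat R).

Lemma quat_cvg u (a b c d : R) :
  (qre (u n) @[n --> \oo] --> a) -> (qi (u n) @[n --> \oo] --> b) ->
  (qj (u n) @[n --> \oo] --> c) -> (qk (u n) @[n --> \oo] --> d) ->
  u n @[n --> \oo] --> Quat a b c d.
Proof.
move=> ha hb hc hd; apply/cvgrPdist_le => e e0; have e4 : 0 < e / 4 by lra.
have /cvgrPdist_le/(_ _ e4) na := ha; have /cvgrPdist_le/(_ _ e4) nb := hb.
have /cvgrPdist_le/(_ _ e4) nc := hc; have /cvgrPdist_le/(_ _ e4) nd := hd.
near=> n; apply: le_trans (qnorm_le_sum _) _ => /=.
have h1 : `|a - qre (u n)| <= e / 4 by near: n.
have h2 : `|b - qi (u n)| <= e / 4 by near: n.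
have h3 : `|c - qj (u n)| <= e / 4 by near: n.
have h4 : `|d - qk (u n)| <= e / 4 by near: n.
lra.
Unshelve. all: by end_near. Qed.

(** The Weierstrass M-test: each of the four real coordinates of the series
    converges absolutely. *)
Lemma quat_series_dominated u (v : nat -> R) :
  (forall n, `|u n| <= v n) -> cvgn (series v) ->
  exists2 l, series u n @[n --> \oo] --> l &
    forall n, `|l - series u n| <= limn (series v) - series v n.
Proof.
move=> uv cv.
have cp (p : quat R -> R) : (forall q, `|p q| <= `|q|) -> cvgn (series (p \o u)).
  move=> pn; apply: normed_cvg.
  apply: (series_le_cvg _ _ _ cv) => n //=; first by apply: le_trans (uv n).
  by apply: le_trans (pn _) (uv n).
have sp (p : quat R -> R) n : p 0 = 0 -> {morph p : a b / a + b} ->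
    p (series u n) = series (p \o u) n.
  move=> p0 pD; rewrite /series/=; elim: n => [|n IH]; first by rewrite !big_geq.
  by rewrite !big_nat_recr//= pD IH.
pose l := Quat (limn (series (qre \o u))) (limn (series (qi \o u)))
  (limn (series (qj \o u))) (limn (series (qk \o u))).
have ul : series u n @[n --> \oo] --> l.
  apply: quat_cvg.
  - by under eq_cvg do rewrite sp//; exact: (cp _ (@qre_le_norm R)).
  - by under eq_cvg do rewrite sp//; exact: (cp _ (@qi_le_norm R)).
  - by under eq_cvg do rewrite sp//; exact: (cp _ (@qj_le_norm R)).
  - by under eq_cvg do rewrite sp//; exact: (cp _ (@qk_le_norm R)).
exists l => // n.
have h1 : (fun m => `|series u m - series u n|) m @[m --> \oo] --> `|l - series u n|.
  by apply: cvg_norm; apply: cvgB => //; exact: cvg_cst.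
have h2 : (fun m => series v m - series v n) m @[m --> \oo] -->
    limn (series v) - series v n.
  by apply: cvgB => //; exact: cvg_cst.
rewrite -(cvg_lim (@Rhausdorff R) h1) -(cvg_lim (@Rhausdorff R) h2).
apply: ler_lim; [by apply: cvgP h1|by apply: cvgP h2|].
near=> m; have nm : (n <= m)%N by near: m; exact: nbhs_infty_ge.
rewrite !sub_series_geq//; apply: le_trans (ler_norm_sum _ _ _) _.
by apply: ler_sum => i _.
Unshelve. all: by end_near. Qed.

End quaternion_limits.

Section quaternionic_sinc.
Variable R : realType.
Implicit Types (q : quat R) (x y : R).

Definition sinc_coeff (k : nat) : R := (- pi ^+ 2) ^+ k / (2 * k + 1)`!%:R.

Lemma qnormX q n : `|q ^+ n| = `|q| ^+ n.
Proof.
elim: n => [|n IH]; last by rewrite !exprS qnormM IH.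
by rewrite !expr0; have := qnormA (1 : R); rewrite scale1r normr1.
Qed.

(** Since (2 k + 1)! >= k!, the exponential series dominates the one of sinc. *)
Lemma sinc_term_le q r k : `|q| <= r ->
  `|sinc_coeff k *: q ^+ (2 * k)| <= exp_coeff ((pi * r) ^+ 2) k.
Proof.
move=> qr; have r0 : 0 <= r by apply: le_trans qr.
have -> : exp_coeff ((pi * r) ^+ 2) k = ((pi * r) ^+ 2) ^+ k / k`!%:R by [].
have cE : `|sinc_coeff k| = (pi ^+ 2) ^+ k / (2 * k + 1)`!%:R.
  rewrite /sinc_coeff normrM normrX normrN [`|pi ^+ 2|]ger0_norm ?sqr_ge0//.
  by rewrite ger0_norm ?invr_ge0.
rewrite qnormZ qnormX cE mulrAC; apply: ler_pM.
- by rewrite mulr_ge0// !exprn_ge0// pi_ge0.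
- by rewrite invr_ge0.
- rewrite exprM -exprMn; apply: lerXn2r; rewrite ?nnegrE ?mulr_ge0 ?exprn_ge0 ?pi_ge0//.
  by rewrite exprMn ler_wpM2l ?sqr_ge0//; apply: lerXn2r; rewrite ?nnegrE.
- rewrite lef_pV2 ?posrE ?ltr0n ?fact_gt0// ler_nat leq_fact//.
  by rewrite mul2n -addnn -addnA leq_addr.
Qed.

Lemma qsinc_sub_series_le r q : `|q| <= r -> forall n,
  `|qsinc q - series (fun k => sinc_coeff k *: q ^+ (2 * k)) n| <=
  expR ((pi * r) ^+ 2) - series (exp_coeff ((pi * r) ^+ 2)) n.
Proof.
move=> qr n.
have [|l ul hl] := quat_series_dominated (fun k => sinc_term_le k qr).
  exact: is_cvg_series_exp_coeff.
have -> : qsinc q = l by apply: cvg_lim ul; exact: norm_hausdorff.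
exact: hl.
Qed.

Lemma qsinc_le r q : `|q| <= r -> `|qsinc q| <= expR ((pi * r) ^+ 2).
Proof.
move=> qr; have := qsinc_sub_series_le qr 0; rewrite /series/= !big_geq// !subr0.
exact.
Qed.

(** The partial sums are polynomials with real coefficients, and they converge
    uniformly on bounded sets. *)
Lemma slice_hol_qsinc J : imag_units J -> slice_hol J (@qsinc R).
Proof.
move=> JJ; apply: slice_hol_lim => r e e0.
pose rho := (pi * (2 * `|r|)) ^+ 2.
have /cvgrPdist_le/(_ _ e0)[n _ /(_ n (leqnn n)) hn] :
    series (exp_coeff rho) n @[n --> \oo] --> expR rho.
  exact: is_cvg_series_exp_coeff.
exists (fun q => series (fun k => sinc_coeff k *: q ^+ (2 * k)) n).
  rewrite /series/=; apply: slice_hol_sum => k.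
  have hX m : slice_hol J (fun q => q ^+ m).
    elim: m => [|m IH]; first exact: (slice_hol_cst J 1).
    have := slice_holMl JJ 0 0 IH; congr slice_hol; apply/funext => q.
    by rewrite slice_real scale0r subr0 exprS.
  have := slice_holMr (sinc_coeff k)%:A (hX (2 * k)%N).
  by congr slice_hol; apply/funext => q; rewrite -scalerAr mulr1.
move=> x y xr yr; have zr : `|slice J x y| <= 2 * `|r|.
  by apply: le_trans (norm_slice_le JJ _ _) _; have := ler_norm r; lra.
apply: le_trans (qsinc_sub_series_le zr n) _; apply: le_trans hn.
exact: ler_norm.
Qed.

Lemma qsinc_real x : qsinc (x%:A) = (rsinc x)%:A.
Proof.
have cs : series (fun k => sinc_coeff k * x ^+ (2 * k)) n @[n --> \oo] --> rsinc x.
  have pi0 : pi != 0 :> R by rewrite gt_eqF// pi_gt0.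
  rewrite /rsinc; have [->|x0] := eqVneq.
    apply: (@cvg_trans _ ((1 : R) @[n --> \oo])); last exact: cvg_cst.
    apply: near_eq_cvg; near=> n.
    have n0 : (0 < n)%N by near: n; exact: nbhs_infty_gt.
    rewrite -(prednK n0) /series/= big_nat_recl//= big1 => [|i _].
      by rewrite /sinc_coeff expr0 mul1r mulr1 addr0 invr1.
    by rewrite mulnS expr0n mulr0.
  have h : series (sin_coeff' (pi * x)) n * (pi * x)^-1 @[n --> \oo] -->
      sin (pi * x) * (pi * x)^-1.
    by apply: cvgMl; exact: cvg_sin_coeff'.
  apply: cvg_trans h; apply: near_eq_cvg; near=> n.
  rewrite /series/= big_distrl/=; apply: eq_bigr => k _.
  rewrite /sin_coeff' /sinc_coeff -exprnP mul2n addn1 exprS.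
  rewrite [(- pi ^+ 2) ^+ k]exprNn -exprM mul2n [(pi * x) ^+ k.*2]exprMn.
  have f0 : (k.*2.+1)`!%:R != 0 :> R by rewrite pnatr_eq0 -lt0n fact_gt0.
  move: ((k.*2.+1)`!%:R) (pi ^+ k.*2) (x ^+ k.*2) ((-1) ^+ k) f0 => a b c d a0.
  by move: pi pi0 => p p0; field; rewrite p0 x0 a0.
have qs (n : nat) : series (fun k => sinc_coeff k *: (x%:A : quat R) ^+ (2 * k)) n =
   (series (fun k => sinc_coeff k * x ^+ (2 * k)) n)%:A.
  rewrite /series/= scaler_suml; apply: eq_bigr => k _.
  by rewrite exprZn expr1n scalerA.
have ql : series (fun k => sinc_coeff k *: (x%:A : quat R) ^+ (2 * k)) n @[n --> \oo]
    --> ((rsinc x)%:A : quat R).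
  apply/cvgrPdist_le => e e0; have /cvgrPdist_le/(_ _ e0) := cs.
  by apply: filterS => n; rewrite qs -scalerBl qnormA.
by apply: cvg_lim ql; exact: norm_hausdorff.
Unshelve. all: by end_near. Qed.

(** By the identity principle this can be read on the real axis, where q sinc(q) is
    sin (pi x) / pi. *)
Lemma qsinc_antiperiodic J x y : imag_units J ->
  slice J (x + 1) y * qsinc (slice J (x + 1) y) = - (slice J x y * qsinc (slice J x y)).
Proof.
move=> JJ; pose S q : quat R := q * qsinc q.
have hS : slice_hol J S.
  have := slice_holMl JJ 0 0 (slice_hol_qsinc JJ); congr slice_hol.
  by apply/funext => q; rewrite slice_real scale0r subr0.
have hS1 : slice_hol J (fun q => S (1 *: q - (-1)%:A)) by exact: slice_hol_affine.
have := @slice_hol_eq R J _ (fun q => - S q) JJ hS1 (slice_holN hS).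
have sv z : S z%:A = (sin (pi * z) / pi)%:A.
  rewrite /S qsinc_real -scalerAl mul1r scalerA; congr (_ *: _).
  by rewrite -rsincE [RHS]mulrC -[pi * z * _]mulrA mulKf// gt_eqF// pi_gt0.
have sr z : S (1 *: z%:A - (-1)%:A) = - S z%:A.
  rewrite scale1r -scalerBl opprK !sv -scaleNr; congr (_ *: _).
  by rewrite mulrDr mulr1 sinDpi mulNr.
move=> /(_ sr x y); rewrite slice_affine mul1r opprK mul1r; exact.
Qed.

(** |q sinc(q)| has period 1 in x by [qsinc_antiperiodic] and is bounded for
    |x| <= 1, hence on the whole strip; divide by |q| >= |x|. *)
Lemma qsinc_decay M : exists2 C : R, 0 <= C & forall J x y, imag_units J ->
  `|y| <= M -> `|qsinc (slice J x y)| * (1 + `|x|) <= C.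
Proof.
pose E := expR ((pi * (1 + `|M|)) ^+ 2).
have E0 : 0 <= E by exact: expR_ge0.
exists (2 * (1 + `|M|) * E) => [|J x y JJ yM].
  by rewrite !mulr_ge0// addr_ge0.
have M0 : 0 <= `|M| by [].
have yM' : `|y| <= `|M| by apply: le_trans yM (ler_norm _).
pose N z := `|slice J z y * qsinc (slice J z y)|.
have N1 z : N (z + 1) = N z by rewrite /N qsinc_antiperiodic// normrN.
have Nn z (n : nat) : N (z + n%:R) = N z.
  elim: n => [|n IH]; first by rewrite addr0.
  by rewrite -natr1 addrA N1.
have Nz z (k : int) : N (z + k%:~R) = N z.
  case: k => n; first by rewrite -pmulrn Nn.
  by rewrite NegzE mulrNz -pmulrn -[LHS](Nn _ n.+1) subrK.
have small z : `|z| <= 1 -> `|qsinc (slice J z y)| <= E.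
  move=> z1; apply: qsinc_le; apply: le_trans (norm_slice_le JJ _ _) _.
  exact: lerD.
have NE z : N z <= (1 + `|M|) * E.
  rewrite -(Nz z (- Num.floor z)) mulrNz /N qnormM.
  have /andP[f1 f2] := floor_itv z; rewrite intrD in f2.
  have f3 : `|z - (Num.floor z)%:~R| <= 1 by rewrite ler_norml; apply/andP; lra.
  apply: ler_pM => //; last exact: small.
  by apply: le_trans (norm_slice_le JJ _ _) _; exact: lerD.
have [x1|x1] := leP `|x| 1.
  apply: (@le_trans _ _ (E * 2)).
    by apply: ler_pM => //; [exact: small|lra].
  have := mulr_ge0 M0 E0; lra.
have h : `|x| * `|qsinc (slice J x y)| <= (1 + `|M|) * E.
  apply: le_trans (NE x); rewrite /N qnormM ler_wpM2r//.
  exact: re_le_slice.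
have := ler_wpM2r (normr_ge0 (qsinc (slice J x y))) (ltW x1).
by rewrite mul1r; lra.
Qed.

(** At a half-integer w near x, sin (pi w)^2 = 1, so sinc (w - k)^2 is equal to
    (pi (w - k))^-2. The decay on the strip bounds the terms by these squares, and
    [rsinc_bessel] bounds their sum. *)
Lemma qsinc_square_sum M : exists2 C : R, 0 <= C & forall J x y (s : seq int),
  imag_units J -> `|y| <= M -> uniq s ->
  \sum_(k <- s) `|qsinc (slice J (x - k%:~R) y)| ^+ 2 <= C.
Proof.
have [C C0 hC] := qsinc_decay M.
exists (C ^+ 2 * pi ^+ 2) => [|J x y s JJ yM us].
  by apply: mulr_ge0; exact: sqr_ge0.
pose w : R := (Num.floor x)%:~R + 1 / 2.
have sw (k : int) : sin (pi * (w - k%:~R)) ^+ 2 = 1.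
  rewrite sqr_sin_piBz; have := sqr_sin_piBz w (Num.floor x).
  by rewrite /w addrAC subrr add0r mul1r sin_pihalf expr1n => <-.
have xw : `|x - w| <= 1.
  have /andP[f1 f2] := floor_itv x; rewrite intrD in f2.
  by rewrite /w ler_norml; apply/andP; lra.
have wk k : w - k%:~R != 0.
  by apply/eqP => h; have := sw k; rewrite h mulr0 sin0 expr0n => /eqP; rewrite eq_sym oner_eq0.
apply: (@le_trans _ _ (\sum_(k <- s) C ^+ 2 * pi ^+ 2 * rsinc (w - k%:~R) ^+ 2)); last first.
  rewrite -big_distrr/= -[leRHS]mulr1 ler_wpM2l//.
    by apply: mulr_ge0; exact: sqr_ge0.
  exact: rsinc_bessel.
apply: ler_sum => k _.
have pi0 : pi != 0 :> R by rewrite gt_eqF// pi_gt0.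
have -> : C ^+ 2 * pi ^+ 2 * rsinc (w - k%:~R) ^+ 2 = (C / `|w - k%:~R|) ^+ 2.
  rewrite /rsinc (negPf (wk k)) !expr_div_n sw exprMn real_normK ?num_real//.
  by move: pi0 => /(expf_neq0 2); move: (pi ^+ 2) => p p0; field; rewrite wk p0.
rewrite ler_pXn2r ?nnegrE ?divr_ge0// ler_pdivlMr ?normr_gt0 ?wk//.
apply: le_trans (hC J (x - k%:~R) y JJ yM); rewrite ler_wpM2l//.
have -> : w - k%:~R = - (x - w) + (x - k%:~R) by ring.
by apply: le_trans (ler_normD _ _) _; rewrite normrN lerD2r.
Qed.

End quaternionic_sinc.

(** * Order of integration on a rectangle *)

Lemma mu_itv_lty (R : realType) (a b : R) :
  (lebesgue_measure `[a, b]%classic < +oo)%E.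
Proof. by rewrite lebesgue_measure_itv/=; case: ifP => _; rewrite -?EFinB ltry. Qed.

Section rectangle_fubini.
Variable R : realType.
Local Notation mu := (@lebesgue_measure R).
Variables (a b c d : R) (f : R -> R -> R) (M : R).
Local Notation TR := (measurableTypeR R).
Hypothesis mf : measurable_fun [set: TR * TR] (fun z => f z.1 z.2).
Hypothesis fM : forall x y, a <= x <= b -> c <= y <= d -> `|f x y| <= M.

Local Notation X := (`[a, b]%classic : set R).
Local Notation Y := (`[c, d]%classic : set R).

(** f cut off outside the rectangle, for integration over the whole plane. *)
Let F (z : TR * TR) : R := f z.1 z.2 * \1_X z.1 * \1_Y z.2.

Let F_integrable : (mu \x mu)%E.-integrable [set: TR * TR] (EFin \o F).
Proof.
have mXY : measurable ((X : set TR) `*` (Y : set TR)) by exact: measurableX.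
have -> : EFin \o F = (EFin \o (fun z => f z.1 z.2)) \_ (X `*` Y).
  apply/funext => -[x y]; rewrite /F /patch /= !indicE in_setX/=.
  by case: (x \in X); case: (y \in Y); rewrite /= ?mulr1 ?mulr0.
apply/(integrable_mkcond _ mXY).
apply: (@measurable_bounded_integrable _ _ _ (mu \x mu)%E (fun z => f z.1 z.2)) => //.
- rewrite /= product_measure1E//; apply: lte_mul_pinfty; last exact: mu_itv_lty.
    exact: measure_ge0.
  by rewrite ge0_fin_numE ?measure_ge0//; exact: mu_itv_lty.
- exact: measurable_funTS.
exists M; split; first exact: num_real.
move=> t Mt [x y] /= [xX yY]; apply: le_trans (ltW Mt).
by apply: fM; [move: xX|move: yY]; rewrite /= in_itv.
Qed.

Let msec1 y : measurable_fun [set: TR] (f ^~ y).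
Proof. exact: (measurableT_comp mf (pair2_measurable y)). Qed.

Let msec2 x : measurable_fun [set: TR] (f x).
Proof. exact: (measurableT_comp mf (pair1_measurable x)). Qed.

Lemma rectangle_integrable2 x : a <= x <= b ->
  mu.-integrable Y (fun y => (f x y)%:E).
Proof.
move=> xab; apply: (@measurable_bounded_integrable _ _ _ mu (f x)) => //.
- exact: mu_itv_lty.
- exact: measurable_funTS.
- exists M; split; first exact: num_real.
  by move=> t Mt y /= yY; apply: le_trans (ltW Mt); apply: fM; rewrite -?in_itv.
Qed.

Lemma rectangle_integrable1 y : c <= y <= d ->
  mu.-integrable X (fun x => (f x y)%:E).
Proof.
move=> ycd; apply: (@measurable_bounded_integrable _ _ _ mu (f ^~ y)) => //.
- exact: mu_itv_lty.
- exact: measurable_funTS.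
- exists M; split; first exact: num_real.
  by move=> t Mt x /= xX; apply: le_trans (ltW Mt); apply: fM; rewrite -?in_itv.
Qed.

Let inner2 x : (\int[mu]_y (F (x, y))%:E =
  (((fun x => \int[mu]_(y in Y) f x y) \_ X) x)%:E)%E.
Proof.
rewrite /patch; case: ifPn => xX.
  rewrite /Rintegral fineK; last first.
    apply: integrable_fin_num => //; apply: rectangle_integrable2.
    by move: xX; rewrite inE /= in_itv.
  rewrite [RHS]integral_mkcond; apply: eq_integral => y _.
  rewrite /F /patch /= !indicE xX mulr1; case: (y \in Y); by rewrite ?mulr1 ?mulr0.
rewrite (_ : (fun y => _) = cst 0%E) ?integral0//.
by apply/funext => y; rewrite /F /= indicE (negPf xX) mulr0 mul0r.
Qed.

Let inner1 y : (\int[mu]_x (F (x, y))%:E =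
  (((fun y => \int[mu]_(x in X) f x y) \_ Y) y)%:E)%E.
Proof.
rewrite /patch; case: ifPn => yY.
  rewrite /Rintegral fineK; last first.
    apply: integrable_fin_num => //; apply: rectangle_integrable1.
    by move: yY; rewrite inE /= in_itv.
  rewrite [RHS]integral_mkcond; apply: eq_integral => x _.
  rewrite /F /patch /= !indicE yY mulr1; case: (x \in X); by rewrite ?mulr1 ?mulr0.
rewrite (_ : (fun x => _) = cst 0%E) ?integral0//.
by apply/funext => x; rewrite /F /= [X in _ * X]indicE (negPf yY) mulr0.
Qed.

Lemma rectangle_fubini :
  \int[mu]_(x in `[a, b]) \int[mu]_(y in `[c, d]) f x y =
  \int[mu]_(y in `[c, d]) \int[mu]_(x in `[a, b]) f x y.
Proof.
rewrite Rintegral_mkcond [RHS]Rintegral_mkcond /Rintegral; congr fine.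
transitivity (\int[mu]_x \int[mu]_y (F (x, y))%:E)%E.
  by apply: eq_integral => x _; rewrite inner2.
transitivity (\int[mu]_y \int[mu]_x (F (x, y))%:E)%E.
  exact: (Fubini F_integrable).
by apply: eq_integral => y _; rewrite inner1.
Qed.

End rectangle_fubini.

(** * The Fejer kernel *)

Section fejer_kernel.
Variable R : realType.
Local Notation mu := (@lebesgue_measure R).
Implicit Types (N s t x : R).

Lemma sin_le_abs x : `|sin x| <= `|x|.
Proof.
have pos (y : R) : 0 <= y -> `|sin y| <= y.
  move=> y0; rewrite ler_norml -subr_ge0 opprK -[sin y <= y]subr_ge0.
  apply/andP; split.
    apply: (@ge0_of_derive R (fun z => sin z + z) (fun z => cos z + 1) y y0).
    - by rewrite sin0 addr0.
    - by move=> z _; rewrite -lerBlDr sub0r cos_geN1.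
  apply: (@ge0_of_derive R (fun z => z - sin z) (fun z => 1 - cos z) y y0).
  - by rewrite sin0 subr0.
  - by move=> z _; rewrite subr_ge0 cos_le1.
have [x0|x0] := leP 0 x; first by rewrite (ger0_norm x0) pos.
by rewrite (ltr0_norm x0) -normrN -sinN pos// oppr_ge0 ltW.
Qed.

Lemma cosB_le s t : `|cos s - cos t| <= `|s - t|.
Proof.
have -> : cos s - cos t = - 2 * sin ((s + t) / 2) * sin ((s - t) / 2).
  have id (p q : R) : cos (p + q) - cos (p - q) = - 2 * sin p * sin q.
    by rewrite cosD cosB; ring.
  rewrite -id; congr (cos _ - cos _); by field.
rewrite normrM; apply: (@le_trans _ _ (2 * `|(s - t) / 2|)).
  apply: ler_pM => //; last exact: sin_le_abs.
  rewrite normrM normrN (ger0_norm (ler0n _ 2)) -[leRHS]mulr1.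
  by rewrite ler_wpM2l// sin_max.
by rewrite normrM [`|2^-1|]ger0_norm// mulrC divfK.
Qed.

Definition tent N t : R := 1 - `|t| / N.

(** The Fejer kernel is the transform of the tent of half-width N. *)
Definition fejer N s : R := \int[mu]_(t in `[(- N), N]) (tent N t * cos (s * t)).

Lemma continuous_tent N : continuous (tent N).
Proof.
move=> t; apply: cvgB; first exact: cvg_cst.
by apply: cvgMl; exact: norm_continuous.
Qed.

Lemma tent_ge0 N t : 0 < N -> - N <= t <= N -> 0 <= tent N t <= 1.
Proof.
move=> N0 tN; have tN' : `|t| <= N by rewrite ler_norml.
rewrite subr_ge0 ler_pdivrMr// mul1r tN'/= gerBl.
by rewrite divr_ge0// ltW.
Qed.

Let tent_cos_ctn N s : continuous (fun t => tent N t * cos (s * t)).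
Proof.
by move=> t; apply: cvgM; [exact: continuous_tent|exact: continuous_cosM].
Qed.

Let tent_sin_ctn N s : continuous (fun t => tent N t * sin (s * t)).
Proof.
by move=> t; apply: cvgM; [exact: continuous_tent|exact: continuous_sinM].
Qed.

Lemma tent_split N (F : R -> R) : 0 < N -> continuous F ->
  \int[mu]_(t in `[(- N), N]) (tent N t * F t) =
  \int[mu]_(t in `[(- N), 0]) ((1 + t / N) * F t) +
  \int[mu]_(t in `[0, N]) ((1 - t / N) * F t).
Proof.
move=> N0 cF; rewrite (@Rintegral_split _ _ _ 0); [|lra|lra|]; last first.
  by move=> t; apply: cvgM; [exact: continuous_tent|exact: cF].
congr (_ + _); apply: eq_Rintegral => t; rewrite inE/= in_itv/= => /andP[t0 t1].
  by rewrite /tent ler0_norm// mulNr opprK.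
by rewrite /tent ger0_norm.
Qed.

Let lin_ctn (a b : R) (F : R -> R) : continuous F ->
  continuous (fun t => (a + t / b) * F t).
Proof.
move=> cF t; apply: cvgM; last exact: cF.
apply: cvgD; first exact: cvg_cst.
by apply: cvgMl; exact: cvg_id.
Qed.

Let linN_ctn (a b : R) (F : R -> R) : continuous F ->
  continuous (fun t => (a - t / b) * F t).
Proof.
move=> cF t; apply: cvgM; last exact: cF.
apply: cvgB; first exact: cvg_cst.
by apply: cvgMl; exact: cvg_id.
Qed.

Lemma fejerE N s : 0 < N -> s != 0 ->
  fejer N s = 2 * (1 - cos (N * s)) / (N * s ^+ 2).
Proof.
move=> N0 s0; have Nn : N != 0 by rewrite gt_eqF.
rewrite /fejer tent_split//; last exact: continuous_cosM.
have d1 (x : R) : is_derive x 1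
    (fun t => s^-1 * ((1 + t * N^-1) * sin (s * t)) + (N * s ^+ 2)^-1 * cos (s * t))
    ((1 + x / N) * cos (s * x)).
  apply: is_derive_eq; rewrite /GRing.scale/=; field; by rewrite s0 Nn.
have d2 (x : R) : is_derive x 1
    (fun t => s^-1 * ((1 - t * N^-1) * sin (s * t)) - (N * s ^+ 2)^-1 * cos (s * t))
    ((1 - x / N) * cos (s * x)).
  apply: is_derive_eq; rewrite /GRing.scale/=; field; by rewrite s0 Nn.
have NN : - N < 0 by lra.
rewrite (Rintegral_FTC NN (@lin_ctn 1 N (fun t => cos (s * t)) (@continuous_cosM R s)) d1).
rewrite (Rintegral_FTC N0 (@linN_ctn 1 N (fun t => cos (s * t)) (@continuous_cosM R s)) d2).
rewrite !mul0r !mulr0 sin0 cos0 mulNr divff// !mulrN cosN [s * N]mulrC.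
by field; rewrite s0 Nn.
Qed.

Lemma tent_sin0 N s : 0 < N ->
  \int[mu]_(t in `[(- N), N]) (tent N t * sin (s * t)) = 0.
Proof.
move=> N0; have Nn : N != 0 by rewrite gt_eqF.
have [->|s0] := eqVneq s 0.
  under eq_Rintegral do rewrite mul0r sin0 mulr0.
  by rewrite Rintegral_cst// mul0r.
rewrite tent_split//; last exact: continuous_sinM.
have d1 (x : R) : is_derive x 1
    (fun t => (N * s ^+ 2)^-1 * sin (s * t) - s^-1 * ((1 + t * N^-1) * cos (s * t)))
    ((1 + x / N) * sin (s * x)).
  apply: is_derive_eq; rewrite /GRing.scale/=; field; by rewrite s0 Nn.
have d2 (x : R) : is_derive x 1
    (fun t => - ((N * s ^+ 2)^-1 * sin (s * t)) - s^-1 * ((1 - t * N^-1) * cos (s * t)))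
    ((1 - x / N) * sin (s * x)).
  apply: is_derive_eq; rewrite /GRing.scale/=; field; by rewrite s0 Nn.
have NN : - N < 0 by lra.
rewrite (Rintegral_FTC NN (@lin_ctn 1 N (fun t => sin (s * t)) (@continuous_sinM R s)) d1).
rewrite (Rintegral_FTC N0 (@linN_ctn 1 N (fun t => sin (s * t)) (@continuous_sinM R s)) d2).
rewrite !mul0r !mulr0 sin0 cos0 mulNr divff// !mulrN sinN cosN.
by field; rewrite s0 Nn.
Qed.

Let tent_cos_int N s := continuous_integrable_itv (- N) N (@tent_cos_ctn N s).

Lemma continuous_fejer N : 0 < N -> continuous (fejer N).
Proof.
move=> N0 s; apply: (@locally_lipschitz_continuous _ _ _ (N * (2 * N))).
exists 1 => // z _; rewrite /fejer -RintegralB//.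
have -> : N * (2 * N) * `|z - s| = N * `|z - s| * (N - - N) by ring.
apply: Rintegral_le_bound; first lra.
  by apply: continuous_integrable_itv => t; apply: cvgB; exact: tent_cos_ctn.
move=> t tN; rewrite -mulrBr normrM -[leRHS]mul1r.
have /andP[t0 t1] := tent_ge0 N0 tN.
apply: ler_pM => //; first by rewrite ger0_norm.
apply: le_trans (cosB_le _ _) _; rewrite -mulrBl normrM mulrC ler_wpM2r//.
by rewrite ler_norml.
Qed.

Lemma fejer_ge0 N s : 0 < N -> 0 <= fejer N s.
Proof.
move=> N0; have [->|s0] := eqVneq s 0.
  apply: Rintegral_ge0 => t; rewrite /= in_itv/= mul0r cos0 mulr1.
  by move=> /(tent_ge0 N0)/andP[].
rewrite fejerE//; apply: divr_ge0; apply: mulr_ge0;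
  by rewrite ?subr_ge0 ?cos_le1 ?sqr_ge0 ?ler0n ?(ltW N0).
Qed.

Let one_sub_cos x : 1 - cos x = 2 * sin (x / 2) ^+ 2.
Proof.
have -> : cos x = cos (x / 2 + x / 2) by congr cos; field.
by rewrite cosD -!expr2 cos2sin2; ring.
Qed.

Lemma fejer_le_sqr N s : 0 < N -> s != 0 -> fejer N s <= 4 / (N * s ^+ 2).
Proof.
move=> N0 s0; rewrite fejerE// ler_pM2r; last first.
  by rewrite invr_gt0 mulr_gt0// exprn_even_gt0.
by have := cos_geN1 (N * s); lra.
Qed.

(** Unlike [fejer_le_sqr] this is uniform in N near the origin, where it balances a
    Lipschitz bound. It follows from sin^2 <= |sin|. *)
Lemma fejer_le_inv N s : 0 < N -> fejer N s * `|s| <= 2.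
Proof.
move=> N0; have [->|s0] := eqVneq s 0; first by rewrite normr0 mulr0.
rewrite fejerE// one_sub_cos.
have h : sin (N * s / 2) ^+ 2 <= N * `|s| / 2.
  have e : `|N * s / 2| = N * `|s| / 2.
    by rewrite !normrM (gtr0_norm N0) [`|2^-1|]ger0_norm.
  rewrite -e -real_normK ?num_real// expr2 -[leRHS]mul1r.
  by apply: ler_pM => //; [exact: sin_max|exact: sin_le_abs].
have s1 : 0 < `|s| by rewrite normr_gt0.
have -> : s ^+ 2 = `|s| ^+ 2 by rewrite real_normK ?num_real.
move: `|s| s1 h => r r0 h.
have -> : 2 * (2 * sin (N * s / 2) ^+ 2) / (N * r ^+ 2) * r =
   4 * sin (N * s / 2) ^+ 2 / (N * r) by field; rewrite !gt_eqF.
by rewrite ler_pdivrMr ?mulr_gt0//; lra.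
Qed.

(** For |s| <= 1 / N the cosines under the integral are at least cos 1, so the kernel
    is at least N cos 1 on an interval of length 2 / N. *)
Lemma fejer_mass N : 1 <= N -> cos 1 <= \int[mu]_(s in `[(- 1), 1]) fejer N s.
Proof.
move=> N1; have N0 : 0 < N by lra.
have cF := continuous_fejer N0.
have tentI : \int[mu]_(t in `[(- N), N]) tent N t = N.
  transitivity (\int[mu]_(t in `[(- N), N]) (tent N t * cos (0 * t))).
    by apply: eq_Rintegral => t _; rewrite mul0r cos0 mulr1.
  rewrite tent_split//; last exact: continuous_cosM.
  have d1 (x : R) : is_derive x 1 (fun t => t + t ^+ 2 * (2 * N)^-1)
      ((1 + x / N) * cos (0 * x)).
    apply: is_derive_eq; rewrite /GRing.scale/= mul0r cos0; field.
    by rewrite gt_eqF.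
  have d2 (x : R) : is_derive x 1 (fun t => t - t ^+ 2 * (2 * N)^-1)
      ((1 - x / N) * cos (0 * x)).
    apply: is_derive_eq; rewrite /GRing.scale/= mul0r cos0; field.
    by rewrite gt_eqF.
  have NN : - N < 0 by lra.
  rewrite (Rintegral_FTC NN (@lin_ctn 1 N (fun t => cos (0 * t)) (@continuous_cosM R 0)) d1).
  rewrite (Rintegral_FTC N0 (@linN_ctn 1 N (fun t => cos (0 * t)) (@continuous_cosM R 0)) d2).
  by field; rewrite gt_eqF.
have near0 s : `|s| <= N^-1 -> N * cos 1 <= fejer N s.
  move=> sN; rewrite /fejer -[X in X * _]tentI -RintegralZr//; last first.
    exact: (continuous_integrable_itv _ _ (@continuous_tent N)).
  apply: le_Rintegral => //.
    apply: (continuous_integrable_itv (- N) N) => t.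
    by apply: cvgMl; exact: continuous_tent.
  move=> t; rewrite /= in_itv/= => tN; have /andP[t0 t1] := tent_ge0 N0 tN.
  rewrite ler_wpM2l// -(cos_norm (s * t)).
  have st : `|s * t| <= 1.
    rewrite normrM -(mulVf (lt0r_neq0 N0)); apply: ler_pM => //.
    by rewrite ler_norml.
  have p1 : 1 <= pi :> R.
    by apply: le_trans (pi_ge2 R); lra.
  by rewrite leNgt ltr_cos -?leNgt// in_itv/= ?ler01 ?normr_ge0 ?(le_trans st).
have N1' : N^-1 <= 1 by rewrite invf_le1.
have Ni : 0 < N^-1 by rewrite invr_gt0.
rewrite (@Rintegral_split _ _ _ (- N^-1)); [|lra|lra|exact: cF].
rewrite (@Rintegral_split _ _ (- N^-1) N^-1); [|lra|lra|exact: cF].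
have i1 : 0 <= \int[mu]_(x in `[(- 1), (- N^-1)]) fejer N x.
  by apply: Rintegral_ge0 => s _; exact: fejer_ge0.
have i2 : 0 <= \int[mu]_(x in `[N^-1, 1]) fejer N x.
  by apply: Rintegral_ge0 => s _; exact: fejer_ge0.
have i3 : 2 * cos 1 <= \int[mu]_(x in `[(- N^-1), N^-1]) fejer N x.
  have -> : 2 * cos 1 = \int[mu]_(x in `[(- N^-1), N^-1]) (N * cos 1).
    rewrite Rintegral_cst// fine_measure_itv; last lra.
    by move: (cos 1) => c; field; rewrite gt_eqF.
  apply: le_Rintegral => //.
  - by apply: (continuous_integrable_itv (- N^-1) N^-1) => t; exact: cvg_cst.
  - exact: (continuous_integrable_itv _ _ cF).
  - by move=> s; rewrite /= in_itv/= => sN; apply: near0; rewrite ler_norml.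
apply: le_trans (ler_wpDl i1 (ler_wpDr i2 i3)).
by rewrite ler_peMl ?ler1n// ltW// cos1_gt0.
Qed.

Lemma Rintegral_shift (f : R -> R) (a b c : R) : a < b -> continuous f ->
  \int[mu]_(x in `[a, b]) f (x - c) = \int[mu]_(x in `[(a - c), (b - c)]) f x.
Proof.
move=> ab cf; rewrite /Rintegral; congr fine.
pose F (x : R) := x - c.
have dF (x : R) : is_derive x 1 F 1 by apply: is_derive_eq; rewrite subr0.
have F1 : F^`()%classic = cst 1.
  by apply/funext => x; rewrite derive1E (@derive_val _ _ _ _ _ _ _ (dF x)).
have cF : continuous F.
  by move=> x; apply/differentiable_continuous/derivable1_diffP; case: (dF x).
have := @integration_by_substitution_increasing R F f a b (ltW ab).
rewrite F1 => ->.
- by apply: eq_integral => x _; rewrite /= /F mulr1.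
- by move=> x y _ _ xy; rewrite /F ltrD2r.
- by move=> x _; exact: cvg_cst.
- exact: is_cvg_cst.
- exact: is_cvg_cst.
- split; first by move=> x _; case: (dF x).
    by apply: cvg_at_right_filter; exact: cF.
  by apply: cvg_at_left_filter; exact: cF.
- exact: continuous_subspaceT.
Qed.

End fejer_kernel.

Section fejer_approximation.
Variable R : realType.
Local Notation mu := (@lebesgue_measure R).

Lemma integrable_inv_oneDsqr :
  mu.-integrable [set: R] (fun x => ((1 + x ^+ 2)^-1)%:E).
Proof.
have cf : continuous (fun x : R => (1 + x ^+ 2)^-1) by exact: continuous_oneDsqrV.
apply/integrableP; split.
  by apply/measurable_EFinP; exact: continuous_measurable_fun.
have p (x : R) : 0 <= (1 + x ^+ 2)^-1 by rewrite invr_ge0 addr_ge0// sqr_ge0.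
under eq_integral => x _ do rewrite gee0_abs ?lee_fin ?p//.
rewrite ge0_symfun_integralT//; last by move=> x /=; rewrite sqrrN.
rewrite (_ : [set x | (0 <= x)%R] = `[0%R, +oo[%classic); last first.
  by apply/seteqP; split => x /=; rewrite in_itv/= andbT.
by rewrite (integral0y_oneDsqr R) -EFinM ltry.
Qed.

Variables (a : R -> R) (x0 : R).
Hypothesis ca : continuous a.
Hypothesis lipa : exists C : R, exists2 d : R, 0 < d &
  forall x, `|x - x0| <= d -> `|a x - a x0| <= C * `|x - x0|.
Hypothesis a2 : mu.-integrable [set: R] (fun x => (a x ^+ 2)%:E).

Let lip1 : exists2 C : R, 0 <= C &
  forall x, `|x - x0| <= 1 -> `|a x - a x0| <= C * `|x - x0|.
Proof.
have [C [d d0 hC]] := lipa.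
have [M M0 hM] := continuous_bounded_itv (x0 - 1) (x0 + 1) ca.
exists (`|C| + 2 * M / d) => [|x x1].
  by rewrite addr_ge0// divr_ge0 ?mulr_ge0// ltW.
have x1' : x0 - 1 <= x <= x0 + 1 by move: x1; rewrite ler_norml; lra.
have [xd|xd] := leP `|x - x0| d.
  apply: le_trans (hC _ xd) _; rewrite ler_wpM2r//.
  by apply: le_trans (ler_norm _) _; rewrite lerDl divr_ge0 ?mulr_ge0// ltW.
have h : `|a x - a x0| <= 2 * M.
  apply: le_trans (ler_normB _ _) _; have := hM _ x1'; have := hM x0 _; lra.
apply: (le_trans h); rewrite [leRHS]mulrDl. apply: ler_wpDl; first by rewrite mulr_ge0.
by rewrite mulrAC ler_pdivlMr// ler_wpM2l ?mulr_ge0// ltW.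
Qed.

Local Notation B := (`[x0 - 1, x0 + 1]%classic : set R).
Local Notation N m := (m.+1%:R : R).

(** The integrand of the convolution at x0, minus its main part near x0. *)
Let dev (m : nat) (x : R) : R := fejer (N m) (x - x0) * (a x - a x0 * \1_B x).

Let shift_ctn (m : nat) : continuous (fun x => fejer (N m) (x - x0)).
Proof.
move=> x; apply: (@continuous_comp _ _ _ (fun x => x - x0) (fejer (N m))).
  by apply: cvgB; [exact: cvg_id|exact: cvg_cst].
exact: continuous_fejer.
Qed.

Let dev_measurable m : measurable_fun [set: R] (dev m).
Proof.
apply: measurable_funM; first exact: continuous_measurable_fun.
apply: measurable_funB; first exact: continuous_measurable_fun.
by apply: measurable_funM => //; exact: measurable_indic.
Qed.

(** A domination that is uniform in m. Near x0 the Lipschitz bound on a is balanced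
    by [fejer_le_inv]; away from x0 the kernel is O(1 / (1 + s^2)), and its product
    with |a x| is split into a x ^+ 2 and the square of the kernel. *)
Let dev_bound : exists2 K : R, 0 <= K &
  forall m x, `|dev m x| <= a x ^+ 2 + K * (1 + x ^+ 2)^-1.
Proof.
have [C C0 hC] := lip1.
pose K := (4 * C + 16) * (2 * (1 + x0 ^+ 2)).
have x02 := sqr_ge0 x0.
exists K => [|m x]; first by rewrite !mulr_ge0; lra.
pose s := x - x0.
have K' : (4 * C + 16) / (1 + s ^+ 2) <= K * (1 + x ^+ 2)^-1.
  have s2 := sqr_ge0 s; have xx2 := sqr_ge0 x.
  rewrite ler_pdivrMr; last lra.
  rewrite mulrAC ler_pdivlMr; last lra.
  rewrite /K -mulrA ler_wpM2l//; first lra.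
  have sx0 := sqr_ge0 (s - x0).
  have -> : x ^+ 2 = s ^+ 2 + 2 * s * x0 + x0 ^+ 2 by rewrite /s; ring.
  have sx02 := mulr_ge0 x02 s2; rewrite sqrrB mulr2n in sx0.
  lra.
apply: (@le_trans _ _ (a x ^+ 2 + (4 * C + 16) / (1 + s ^+ 2))); last first.
  by rewrite lerD2l.
have F0 : 0 <= fejer (N m) s by exact: fejer_ge0.
have Nm : 1 <= N m by rewrite ler1n.
have a20 := sqr_ge0 (a x).
have s2 := sqr_ge0 s.
rewrite /dev -/s indicE normrM (ger0_norm F0); have [|xB] := boolP (x \in B).
  rewrite inE/= in_itv/= mulr1 => xB.
  have s1 : `|s| <= 1 by rewrite /s ler_norml; lra.
  have s1' : s ^+ 2 <= 1 by rewrite -real_normK ?num_real// expr_le1.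
  apply: (@le_trans _ _ (2 * C)).
    apply: (@le_trans _ _ (fejer (N m) s * (C * `|s|))).
      by rewrite ler_wpM2l// hC.
    by rewrite mulrCA [2 * C]mulrC ler_wpM2l// fejer_le_inv.
  apply: ler_wpDl => //; rewrite ler_pdivlMr; last lra.
  have := mulr_ge0 C0 s2; have : C * s ^+ 2 <= C * 1 by rewrite ler_wpM2l.
  lra.
rewrite mulr0 subr0.
have s1 : 1 < `|s|.
  rewrite ltNge; apply/negP => s1; move/negP: xB; apply.
  by rewrite inE/= in_itv/=; move: s1; rewrite /s ler_norml; lra.
have s1' : 1 < s ^+ 2 by rewrite -real_normK ?num_real// exprn_egt1.
have s0 : s != 0 by rewrite -normr_gt0; lra.
have F1 : fejer (N m) s <= 8 / (1 + s ^+ 2).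
  apply: le_trans (fejer_le_sqr _ s0) _ => //.
  rewrite ler_pdivrMr; last by rewrite mulr_gt0//; lra.
  rewrite mulrAC ler_pdivlMr; last lra.
  have : s ^+ 2 <= N m * s ^+ 2 by rewrite ler_peMl.
  lra.
have q0 : 0 < (1 + s ^+ 2)^-1 by rewrite invr_gt0; lra.
have q1 : (1 + s ^+ 2)^-1 <= 1 by rewrite invf_le1; lra.
apply: (@le_trans _ _ (8 / (1 + s ^+ 2) * `|a x|)); first by rewrite ler_wpM2r.
rewrite -[a x ^+ 2]real_normK ?num_real//.
move: (_^-1) `|a x| q0 q1 => q y q0 q1.
have := sqr_ge0 (y - 4 * q).
have h1 : q ^+ 2 <= q by rewrite expr2 ler_piMl// ltW.
have := mulr_ge0 C0 (ltW q0).
have -> : (y - 4 * q) ^+ 2 = y ^+ 2 - 8 * q * y + 16 * q ^+ 2 by ring.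
lra.
Qed.

Let err (m : nat) : R := \int[mu]_x `|dev m x|.

Let dom K := rintegrableD (mu := mu) measurableT a2
  (rintegrableZ measurableT K integrable_inv_oneDsqr).

Let dev_int m : mu.-integrable [set: R] (fun x => (dev m x)%:E).
Proof.
have [K K0 hK] := dev_bound; apply: le_integrable (dom K) => //.
  by apply/measurable_EFinP; exact: dev_measurable.
move=> x _ /=; rewrite lee_fin; apply: le_trans (hK m x) _; exact: ler_norm.
Qed.

Let err_cvg : err @ \oo --> 0.
Proof.
have [K K0 hK] := dev_bound.
have [] := @dominated_convergence _ _ _ mu [set: R] measurableT
  (fun m x => `|dev m x|%:E) (cst 0%E) _ _ _ _ (dom K) _.
- move=> m; apply/measurable_EFinP.
  by apply: measurableT_comp => //; exact: dev_measurable.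
- exact: measurable_cst.
- apply/nearW => x _.
  have [xx0|xx0] := eqVneq x x0.
    rewrite (_ : (fun m => _) = cst 0%E); first exact: cvg_cst.
    apply/funext => m; rewrite /dev xx0 indicE mem_set ?mulr1 ?subrr ?mulr0 ?normr0//.
    by rewrite /= in_itv/=; lra.
  have s0 : x - x0 != 0 by rewrite subr_eq0.
  have s2 : 0 < (x - x0) ^+ 2 by rewrite exprn_even_gt0.
  apply: cvg_EFin; first by apply/nearW.
  pose V := 4 / (x - x0) ^+ 2 * `|a x - a x0 * \1_B x|.
  have V0 : 0 <= V by rewrite mulr_ge0// divr_ge0// ltW.
  have hV m : `|dev m x| <= V * (N m)^-1.
    have N0 : 0 < N m by rewrite ltr0n.
    rewrite /dev normrM (ger0_norm (fejer_ge0 _ _))// /V mulrAC.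
    rewrite ler_wpM2r//; apply: le_trans (fejer_le_sqr _ s0) _ => //.
    by rewrite invfM mulrA mulrAC.
  have cV : V * (N m)^-1 @[m --> \oo] --> V * 0.
    by apply: cvgMr; exact: cvg_harmonic.
  rewrite mulr0 in cV.
  apply: (@squeeze_cvgr _ _ _ _ (cst 0) (fun m => V * (N m)^-1)) => //.
    by apply/nearW => m /=; rewrite normr_ge0 hV.
  exact: cvg_cst.
- apply/nearW => x m _ /=; rewrite lee_fin ger0_norm//; exact: hK.
move=> _ _; rewrite integral0 => h.
exact: (fine_cvg h).
Qed.

(** Where a is locally Lipschitz, its convolution with the Fejer kernel approaches
    a x0 times the mass of the kernel on [-1, 1]: by dominated convergence [dev] tends
    to 0 in mean. The error does not depend on the cut-off n. *)
Lemma fejer_approx : exists2 r : nat -> R, r @ \oo --> 0 &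
  forall (m : nat) (n : R), `|x0| + 1 <= n ->
  `|\int[mu]_(x in `[(- n), n]) (fejer (N m) (x - x0) * a x) -
    a x0 * \int[mu]_(s in `[(- 1), 1]) fejer (N m) s| <= r m.
Proof.
exists err => // m n x0n.
have nB : B `<=` `[(- n), n]%classic.
  move=> x /=; rewrite !in_itv/=; have := ler_norm x0; have := ler_norm (- x0).
  by rewrite normrN; lra.
have fi : mu.-integrable `[(- n), n] (fun x => (fejer (N m) (x - x0) * a x)%:E).
  by apply: continuous_integrable_itv => x; apply: cvgM; [exact: shift_ctn|exact: ca].
have di : mu.-integrable `[(- n), n] (fun x => (dev m x)%:E).
  by apply: integrableS (dev_int m).
have -> : a x0 * \int[mu]_(s in `[(- 1), 1]) fejer (N m) s =
    \int[mu]_(x in `[(- n), n]) (fejer (N m) (x - x0) * a x - dev m x).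
  transitivity (a x0 * \int[mu]_(x in B) fejer (N m) (x - x0)).
    rewrite Rintegral_shift; [|lra|exact: continuous_fejer].
    have -> : x0 - 1 - x0 = - 1 by ring.
    by have -> : x0 + 1 - x0 = 1 by ring.
  rewrite -RintegralZl//; last exact: (continuous_integrable_itv _ _ (@shift_ctn m)).
  rewrite -(setIidr nB) Rintegral_mkcondr; apply: eq_Rintegral => x _.
  rewrite /dev /patch indicE; case: (x \in B) => /=; first by ring.
  by rewrite mulr0 subr0 subrr.
rewrite RintegralB// subKr.
apply: le_trans (le_normr_Rintegral _ di) _ => //.
rewrite /err /Rintegral fine_le//.
- apply: integrable_fin_num => //; exact: (integrable_norm di).
- apply: integrable_fin_num => //; exact: (integrable_norm (dev_int m)).
apply: ge0_subset_integral => //.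
by apply/measurable_EFinP; apply: measurableT_comp => //; exact: dev_measurable.
Qed.

End fejer_approximation.

(** * Fourier inversion for a band-limited spectrum *)

Section fourier_inversion.
Variable R : realType.
Local Notation mu := (@lebesgue_measure R).
Implicit Types (a b u v : R -> R) (t x n : R).

(** Real and imaginary parts of the transform of (a + i b) cut off at |x| <= n
    are [trig_transform n a b] and [trig_transform n b (- a)]. *)
Definition trig_transform n a b t : R :=
  \int[mu]_(x in `[(- n), n]) (cos (x * t) * a x + sin (x * t) * b x).

Section continuous_data.
Variables a b : R -> R.
Hypotheses (ca : continuous a) (cb : continuous b).

Let ctn_cos t : continuous (fun x : R => cos (x * t)).
Proof. by under eq_fun do rewrite mulrC; exact: continuous_cosM. Qed.

Let ctn_sin t : continuous (fun x : R => sin (x * t)).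
Proof. by under eq_fun do rewrite mulrC; exact: continuous_sinM. Qed.

Let integrand_ctn t : continuous (fun x => cos (x * t) * a x + sin (x * t) * b x).
Proof.
move=> x; apply: cvgD; apply: cvgM.
- exact: ctn_cos.
- exact: ca.
- exact: ctn_sin.
- exact: cb.
Qed.

Let integrand_int n t := continuous_integrable_itv (- n) n (@integrand_ctn t).

Lemma continuous_trig_transform n : 0 <= n -> continuous (trig_transform n a b).
Proof.
move=> n0 t.
have [Ma Ma0 hMa] := continuous_bounded_itv (- n) n ca.
have [Mb Mb0 hMb] := continuous_bounded_itv (- n) n cb.
apply: (@locally_lipschitz_continuous _ _ _ (n * (Ma + Mb) * (n - - n))).
exists 1 => // z _; rewrite /trig_transform -RintegralB//.
have -> : n * (Ma + Mb) * (n - - n) * `|z - t| = n * (Ma + Mb) * `|z - t| * (n - - n).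
  by ring.
apply: Rintegral_le_bound; first lra.
  apply: continuous_integrable_itv => x.
  apply: cvgB; exact: integrand_ctn.
move=> x xn; have xn' : `|x| <= n by rewrite ler_norml.
have -> : cos (x * z) * a x + sin (x * z) * b x - (cos (x * t) * a x + sin (x * t) * b x)
  = (cos (x * z) - cos (x * t)) * a x + (sin (x * z) - sin (x * t)) * b x by ring.
have hz : `|x * z - x * t| <= n * `|z - t|.
  by rewrite -mulrBr normrM ler_wpM2r.
have sB : `|sin (x * z) - sin (x * t)| <= `|x * z - x * t|.
  have := cosB_le (x * z - pi / 2) (x * t - pi / 2).
  by rewrite !cosBpihalf opprB addrA subrK.
rewrite mulrDr mulrDl; apply: le_trans (ler_normD _ _) _; rewrite !normrM.
apply: lerD; rewrite mulrAC; apply: ler_pM => //.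
- exact: le_trans (cosB_le _ _) hz.
- exact: hMa.
- exact: le_trans sB hz.
- exact: hMb.
Qed.

Local Notation TR := (measurableTypeR R).

Let H N x0 t x : R :=
  tent N t * (cos ((x - x0) * t) * a x + sin ((x - x0) * t) * b x).

Let H_measurable N x0 : measurable_fun [set: TR * TR] (fun z => H N x0 z.1 z.2).
Proof.
have mc (f : R -> R) : continuous f -> measurable_fun [set: TR] f.
  exact: continuous_measurable_fun.
have m1 : measurable_fun [set: TR * TR] (fun z => tent N z.1).
  by apply: (measurableT_comp (mc _ (@continuous_tent R N))); exact: measurable_fst.
have ma : measurable_fun [set: TR * TR] (fun z => a z.2).
  by apply: (measurableT_comp (mc _ ca)); exact: measurable_snd.
have mb : measurable_fun [set: TR * TR] (fun z => b z.2).
  by apply: (measurableT_comp (mc _ cb)); exact: measurable_snd.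
have marg : measurable_fun [set: TR * TR] (fun z : TR * TR => (z.2 - x0) * z.1 : R).
  apply: measurable_funM; last exact: measurable_fst.
  by apply: measurable_funB => //; exact: measurable_snd.
have m2 : measurable_fun [set: TR * TR] (fun z => cos ((z.2 - x0) * z.1)).
  exact: (measurableT_comp (mc _ (@continuous_cos R)) marg).
have m3 : measurable_fun [set: TR * TR] (fun z => sin ((z.2 - x0) * z.1)).
  exact: (measurableT_comp (mc _ (@continuous_sin R)) marg).
apply: measurable_funM => //.
by apply: measurable_funD; exact: measurable_funM.
Qed.

(** Interchanging the order of integration turns the tent-weighted inverse
    transform of the cut-off function into convolution with the Fejer kernel. *)
Lemma trig_transform_fejer n N x0 : 0 < N ->
  \int[mu]_(t in `[(- N), N]) (tent N t *
    (cos (x0 * t) * trig_transform n a b t -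
     sin (x0 * t) * trig_transform n b (\- a) t)) =
  \int[mu]_(x in `[(- n), n]) (fejer N (x - x0) * a x).
Proof.
move=> N0.
have [Ma Ma0 hMa] := continuous_bounded_itv (- n) n ca.
have [Mb Mb0 hMb] := continuous_bounded_itv (- n) n cb.
have HM t x : - N <= t <= N -> - n <= x <= n -> `|H N x0 t x| <= Ma + Mb.
  move=> tN xn; rewrite /H normrM -[leRHS]mul1r.
  have /andP[t0 t1] := tent_ge0 N0 tN.
  apply: ler_pM => //; first by rewrite ger0_norm.
  apply: le_trans (ler_normD _ _) _; rewrite !normrM.
  by apply: lerD; rewrite -[leRHS]mul1r; apply: ler_pM => //;
    rewrite ?cos_max ?sin_max ?hMa ?hMb.
have inner_ctn t : continuous
    (fun x => cos ((x - x0) * t) * a x + sin ((x - x0) * t) * b x).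
  have cs : continuous (fun x => (x - x0) * t).
    by move=> x; apply: cvgMl; apply: cvgB; [exact: cvg_id|exact: cvg_cst].
  move=> x; apply: cvgD; apply: cvgM.
  - apply: (@continuous_comp _ _ _ (fun x => (x - x0) * t) cos); first exact: cs.
    exact: continuous_cos.
  - exact: ca.
  - apply: (@continuous_comp _ _ _ (fun x => (x - x0) * t) sin); first exact: cs.
    exact: continuous_sin.
  - exact: cb.
transitivity (\int[mu]_(t in `[(- N), N]) \int[mu]_(x in `[(- n), n]) H N x0 t x).
  apply: eq_Rintegral => t _; rewrite /H RintegralZl//; last first.
    exact: (continuous_integrable_itv _ _ (@inner_ctn t)).
  congr (_ * _); rewrite /trig_transform.
  have i2 : mu.-integrable `[(- n), n]
      (EFin \o (fun x => cos (x * t) * b x + sin (x * t) * (\- a) x)).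
    apply: continuous_integrable_itv => x; apply: cvgD; apply: cvgM.
    - exact: ctn_cos.
    - exact: cb.
    - exact: ctn_sin.
    - by apply: cvgN; exact: ca.
  rewrite -!RintegralZl//.
  rewrite -RintegralB//; [|by apply: rintegrableZ => //; exact: (integrand_int n t)
    |by apply: rintegrableZ => //; exact: i2].
  apply: eq_Rintegral => x _; rewrite [(x - x0) * t]mulrBl cosB sinB /=.
  ring.
rewrite (rectangle_fubini (@H_measurable N x0) HM).
apply: eq_Rintegral => x _.
have tc s : mu.-integrable `[(- N), N] (EFin \o (fun t => tent N t * cos (s * t))).
  apply: continuous_integrable_itv => t.
  by apply: cvgM; [exact: continuous_tent|exact: continuous_cosM].
have ts s : mu.-integrable `[(- N), N] (EFin \o (fun t => tent N t * sin (s * t))).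
  apply: continuous_integrable_itv => t.
  by apply: cvgM; [exact: continuous_tent|exact: continuous_sinM].
transitivity (\int[mu]_(t in `[(- N), N]) (a x * (tent N t * cos ((x - x0) * t)) +
    b x * (tent N t * sin ((x - x0) * t)))).
  by apply: eq_Rintegral => t _; rewrite /H; ring.
rewrite RintegralD//; [|by apply: rintegrableZ => //; exact: tc
  |by apply: rintegrableZ => //; exact: ts].
by rewrite !RintegralZl// tent_sin0// mulr0 addr0 mulrC.
Qed.

End continuous_data.

Section inversion.
Variables (a b u v : R -> R) (A c : R).
Hypotheses (A0 : 0 < A) (c0 : c != 0).
Hypotheses (ca : continuous a) (cb : continuous b).
Hypothesis lipa : forall x0, exists C : R, exists2 d : R, 0 < d &
  forall x, `|x - x0| <= d -> `|a x - a x0| <= C * `|x - x0|.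
Hypothesis a2 : mu.-integrable [set: R] (fun x => (a x ^+ 2)%:E).
Hypotheses (hu : square_integrable mu [set: R] u) (hv : square_integrable mu [set: R] v).
Hypotheses (u0 : {ae mu, forall t, ~ (- A <= t <= A) -> u t = 0})
  (v0 : {ae mu, forall t, ~ (- A <= t <= A) -> v t = 0}).

Definition converges_in_mean (w : nat -> R -> R) := forall e : R, 0 < e ->
  exists k0 : nat, forall k : nat, (k0 <= k)%N ->
    (\int[mu]_t ((w k t) ^+ 2)%:E <= e%:E)%E.

Hypothesis hua : converges_in_mean
  (fun k t => c * trig_transform k%:R a b t - u t).
Hypothesis hvb : converges_in_mean
  (fun k t => c * trig_transform k%:R b (\- a) t - v t).

Let cNa : continuous (\- a). Proof. by move=> x; apply: cvgN; exact: ca. Qed.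

Let sqS (w : R -> R) (s t : R) : square_integrable mu [set: R] w ->
  square_integrable mu `[s, t] w.
Proof.
move=> [mw w2]; split; first exact: measurable_funTS.
exact: integrableS w2.
Qed.

Let sqB (w w' : R -> R) (s t : R) : square_integrable mu `[s, t] w ->
  square_integrable mu `[s, t] w' -> square_integrable mu `[s, t] (fun x => w x - w' x).
Proof.
move=> hw hw'; have [mw w2] := hw; have [mw' w2'] := hw'.
split; first exact: measurable_funB.
have ww' : mu.-integrable `[s, t] (fun x => (w x * w' x)%:E).
  exact: square_integrableM.
rewrite (_ : (fun x => ((w x - w' x) ^+ 2)%:E) =
    (fun x => (w x ^+ 2 - 2 * (w x * w' x) + w' x ^+ 2)%:E)); last first.
  by apply/funext => x; congr EFin; ring.
apply: rintegrableD => //; apply: rintegrableB => //; exact: rintegrableZ.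
Qed.

(** Cauchy-Schwarz on [-N, N]: integrating against a weight bounded by 1 preserves
    convergence in mean. *)
Let pairing N (p : R -> R) (g w : R -> R) e : 0 < N -> continuous p ->
  (forall t, - N <= t <= N -> `|p t| <= 1) -> continuous g ->
  square_integrable mu [set: R] w ->
  (\int[mu]_t ((c * g t - w t) ^+ 2)%:E <= e%:E)%E ->
  (\int[mu]_(t in `[(- N), N]) (p t * (c * g t - w t))) ^+ 2 <= 2 * N * e.
Proof.
move=> N0 cp p1 cg hw he.
have mw : measurable_fun [set: R] w by case: hw.
have hcg : square_integrable mu `[(- N), N] (fun t => c * g t - w t).
  apply: sqB; last exact: sqS.
  by apply: continuous_square_integrable => t; apply: cvgMr; exact: cg.
apply: le_trans (cauchy_schwarz (mu := mu) (measurable_itv _) (continuous_square_integrable (- N) N cp) hcg) _.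
apply: ler_pM.
- by apply: Rintegral_ge0 => t _; exact: sqr_ge0.
- by apply: Rintegral_ge0 => t _; exact: sqr_ge0.
- have [_ p2] := continuous_square_integrable (- N) N cp.
  have -> : 2 * N = \int[mu]_(t in `[(- N), N]) 1.
    by rewrite Rintegral_cst// fine_measure_itv; [ring|lra].
  apply: le_Rintegral => //.
    by apply: (continuous_integrable_itv (- N) N) => t; exact: cvg_cst.
  move=> t; rewrite /= in_itv/= => tN.
  by rewrite -real_normK ?num_real// expr_le1// p1.
- rewrite -lee_fin /Rintegral fineK; last first.
    by apply: integrable_fin_num => //; case: hcg.
  apply: le_trans he; apply: ge0_subset_integral => //.
  + apply/measurable_EFinP; apply: measurable_funX; apply: measurable_funB => //.
    by apply: measurable_funM => //; exact: continuous_measurable_fun.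
  + by move=> t _; rewrite lee_fin sqr_ge0.
Qed.

Let spectrum x0 t := cos (x0 * t) * u t - sin (x0 * t) * v t.

Let spectrum_int x0 (s t : R) : mu.-integrable `[s, t] (EFin \o spectrum x0).
Proof.
apply: rintegrableB => //; apply: square_integrableM => //; try exact: sqS;
  apply: continuous_square_integrable; [exact: continuous_cosM|exact: continuous_sinM].
Qed.

(** The inverse transform of the spectrum, reached as a limit of its tent-weighted
    versions. *)
Let L x0 := \int[mu]_(t in `[(- A), A]) spectrum x0 t.

Local Notation N m := (m.+1%:R : R).

Let LN x0 m := \int[mu]_(t in `[(- N m), N m]) (tent (N m) t * spectrum x0 t).

Let tent_spectrum_int m x0 (s t : R) :
  mu.-integrable `[s, t] (EFin \o (fun t => tent (N m) t * spectrum x0 t)).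
Proof.
have tc : continuous (fun t => tent (N m) t * cos (x0 * t)).
  by move=> z; apply: cvgM; [exact: continuous_tent|exact: continuous_cosM].
have ts : continuous (fun t => tent (N m) t * sin (x0 * t)).
  by move=> z; apply: cvgM; [exact: continuous_tent|exact: continuous_sinM].
rewrite (_ : EFin \o _ = (fun t => (tent (N m) t * cos (x0 * t) * u t -
   tent (N m) t * sin (x0 * t) * v t)%:E)); last first.
  by apply/funext => z; congr EFin; rewrite /spectrum; ring.
apply: rintegrableB => //; apply: square_integrableM => //; try exact: sqS;
  exact: continuous_square_integrable.
Qed.

(** For fixed m the cut-off n goes to infinity: the transforms of the cut-off data
    converge in mean to the spectrum, and [trig_transform_fejer] turns their
    tent-weighted inverse transforms into convolutions with the Fejer kernel. *)
Let LN_approx x0 : exists2 r : nat -> R, r @ \oo --> 0 & forall m : nat,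
  `|LN x0 m - c * (a x0 * \int[mu]_(s in `[(- 1), 1]) fejer (N m) s)| <= r m.
Proof.
have [r r0 hr] := fejer_approx ca (lipa x0) a2.
exists (fun m => `|c| * r m).
  by rewrite -(mulr0 `|c|); apply: cvgMr.
move=> m; apply/ler_addgt0Pr => e e0.
have N0 : 0 < N m by rewrite ltr0n.
pose d := (e / 2) ^+ 2 / (2 * N m).
have d0 : 0 < d by rewrite divr_gt0 ?mulr_gt0// exprn_gt0// divr_gt0.
have [n1 hn1] := hua d0; have [n2 hn2] := hvb d0.
have [n3 hn3] : exists n3 : nat, `|x0| + 1 <= n3%:R.
  by exists (Num.bound (`|x0| + 1)); apply/ltW; apply: archi_boundP; rewrite addr_ge0.
pose n := maxn n1 (maxn n2 n3).
have nn1 : (n1 <= n)%N by rewrite leq_maxl.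
have nn2 : (n2 <= n)%N by rewrite /n maxnCA leq_maxl.
have nn3 : (n3 <= n)%N by rewrite /n maxnA leq_maxr.
have xn : `|x0| + 1 <= n%:R :> R by apply: le_trans hn3 _; rewrite ler_nat.
have ctr1 : continuous (trig_transform n%:R a b) by exact: continuous_trig_transform.
have ctr2 : continuous (trig_transform n%:R b (\- a)) by exact: continuous_trig_transform.
have := trig_transform_fejer ca cb n%:R x0 N0.
have := hr m n%:R xn.
set J := \int[mu]_(x in _) _; set K := \int[mu]_(s in _) _ => hJ hJ'.
pose p t := tent (N m) t * cos (x0 * t).
pose q t := tent (N m) t * sin (x0 * t).
have cp : continuous p.
  by move=> t; apply: cvgM; [exact: continuous_tent|exact: continuous_cosM].
have cq : continuous q.
  by move=> t; apply: cvgM; [exact: continuous_tent|exact: continuous_sinM].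
have p1 t : - N m <= t <= N m -> `|p t| <= 1.
  move=> tN; have /andP[t0 t1] := tent_ge0 N0 tN.
  rewrite /p normrM ger0_norm// -[leRHS]mulr1; apply: ler_pM => //; exact: cos_max.
have q1 t : - N m <= t <= N m -> `|q t| <= 1.
  move=> tN; have /andP[t0 t1] := tent_ge0 N0 tN.
  rewrite /q normrM ger0_norm// -[leRHS]mulr1; apply: ler_pM => //; exact: sin_max.
have P1 := pairing N0 cp p1 ctr1 hu (hn1 _ nn1).
have P2 := pairing N0 cq q1 ctr2 hv (hn2 _ nn2).
have e2 : 2 * N m * d = (e / 2) ^+ 2 by rewrite /d mulrC divfK// mulf_neq0.
rewrite e2 in P1 P2.
have root z : z ^+ 2 <= (e / 2) ^+ 2 -> `|z| <= e / 2.
  move=> h; rewrite -(@ler_pXn2r _ 2)// ?nnegrE ?real_normK ?num_real//.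
  by rewrite divr_ge0// ltW.
have {}P1 := root _ P1; have {}P2 := root _ P2.
have iP (g w p' : R -> R) : continuous g -> continuous p' ->
    square_integrable mu [set: R] w ->
    mu.-integrable `[(- N m), N m] (EFin \o (fun t => p' t * (c * g t - w t))).
  move=> cg cp' hw; apply: square_integrableM => //; first exact: continuous_square_integrable.
  apply: sqB; last exact: sqS.
  by apply: continuous_square_integrable => t; apply: cvgMr; exact: cg.
have cJ : c * J - LN x0 m =
    \int[mu]_(t in `[(- N m), N m]) (p t * (c * trig_transform n%:R a b t - u t)) -
    \int[mu]_(t in `[(- N m), N m]) (q t * (c * trig_transform n%:R b (\- a) t - v t)).
  rewrite -RintegralB//; [|exact: iP..].
  rewrite -hJ' -RintegralZl//; last first.
    apply: continuous_integrable_itv => t; apply: cvgM; first exact: continuous_tent.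
    apply: cvgB; apply: cvgM.
    - exact: continuous_cosM.
    - exact: ctr1.
    - exact: continuous_sinM.
    - exact: ctr2.
  rewrite /LN -RintegralB//; last first.
    apply: rintegrableZ => //.
    apply: continuous_integrable_itv => t; apply: cvgM; first exact: continuous_tent.
    apply: cvgB; apply: cvgM.
    - exact: continuous_cosM.
    - exact: ctr1.
    - exact: continuous_sinM.
    - exact: ctr2.
  by apply: eq_Rintegral => t _; rewrite /spectrum /p /q; ring.
have cJle : `|c * J - LN x0 m| <= e.
  by rewrite cJ; apply: le_trans (ler_normB _ _) _; rewrite [leRHS]splitr lerD.
have -> : LN x0 m - c * (a x0 * K) = c * (J - a x0 * K) - (c * J - LN x0 m) by ring.
apply: le_trans (ler_normB _ _) _; apply: lerD => //.
by rewrite normrM ler_wpM2l.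
Qed.

Let spectrum_outside x0 : {ae mu, forall t, ~ (- A <= t <= A) -> spectrum x0 t = 0}.
Proof.
apply: (@filterS2 _ _ (ae_filter_ringOfSetsType mu) _ _ _ _ u0 v0) => t h1 h2 tA.
by rewrite /spectrum (h1 tA) (h2 tA) !mulr0 subr0.
Qed.

(** The spectrum lives on [-A, A], where the tent of half-width m + 1 is within
    A / (m + 1) of 1. *)
Let LN_cvg x0 : LN x0 @ \oo --> L x0.
Proof.
pose S := \int[mu]_(t in `[(- A), A]) `|spectrum x0 t|.
have hN m : A <= N m -> `|L x0 - LN x0 m| <= A * S * (N m)^-1.
  move=> AN; have N0 : 0 < N m by rewrite ltr0n.
  have AA : `[(- A), A]%classic `<=` (`[(- N m), N m]%classic : set R).
    by move=> t /=; rewrite !in_itv/=; lra.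
  have -> : LN x0 m = \int[mu]_(t in `[(- A), A]) (tent (N m) t * spectrum x0 t).
    rewrite /LN -[X in _ = \int[_]_(t in X) _](setIidr AA) Rintegral_mkcondr.
    rewrite /Rintegral; congr fine; apply: ae_eq_integral => //.
    - apply/measurable_EFinP; have := tent_spectrum_int m x0 (- N m) (N m).
      by move=> /measurable_int /measurable_EFinP.
    - apply/measurable_EFinP; apply/measurable_restrict => //.
      rewrite setIidr//.
      have := tent_spectrum_int m x0 (- A) A.
      by move=> /measurable_int /measurable_EFinP.
    - apply: (@filterS _ _ (ae_filter_ringOfSetsType mu) _ _ _ (spectrum_outside x0)) => t ht tN.
      rewrite /patch; case: ifPn => // tA; rewrite ht ?mulr0// => tA'.
      by move/negP: tA; apply; rewrite inE /= in_itv.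
  rewrite /L -RintegralB//.
  have di : mu.-integrable `[(- A), A]
      (EFin \o (fun t => spectrum x0 t - tent (N m) t * spectrum x0 t)).
    by apply: rintegrableB => //; [exact: spectrum_int|exact: tent_spectrum_int].
  apply: le_trans (le_normr_Rintegral _ di) _ => //.
  rewrite mulrAC /S -RintegralZl//; last exact: (integrable_norm (spectrum_int _ _ _)).
  apply: le_Rintegral => //.
  - exact: (integrable_norm di).
  - apply: rintegrableZ => //; exact: (integrable_norm (spectrum_int _ _ _)).
  move=> t; rewrite /= in_itv/= => tA.
  have -> : spectrum x0 t - tent (N m) t * spectrum x0 t = `|t| / N m * spectrum x0 t.
    by rewrite /tent; ring.
  rewrite normrM ler_wpM2r// normrM normr_id [`|(N m)^-1|]ger0_norm//.
  by rewrite ler_wpM2r// ler_norml.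
apply/cvgrPdist_le => e e0.
have cV : A * S * (N m)^-1 @[m --> \oo] --> A * S * 0.
  by apply: cvgMr; exact: cvg_harmonic.
rewrite mulr0 in cV; have /cvgrPdist_le/(_ _ e0) cV' := cV.
near=> m; apply: le_trans (hN m _) _.
  near: m; exists (Num.bound A) => // m /= Am.
  apply: ltW; apply: lt_le_trans (archi_boundP (ltW A0)) _.
  by rewrite ler_nat (leq_trans Am).
have : `|0 - A * S * (N m)^-1| <= e by near: m.
by rewrite sub0r normrN; apply: le_trans; exact: ler_norm.
Unshelve. all: by end_near. Qed.

Let mass m := \int[mu]_(s in `[(- 1), 1]) fejer (N m) s.

Let mass_cvg x0 : c * (a x0 * mass m) @[m --> \oo] --> L x0.
Proof.
have [r r0 hr] := LN_approx x0.
have h : (fun m => LN x0 m - (LN x0 m - c * (a x0 * mass m))) @ \oo --> L x0 - 0.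
  apply: cvgB; first exact: LN_cvg.
  apply/cvgrPdist_le => e e0; have /cvgrPdist_le/(_ _ e0) := r0.
  apply: filterS => m; rewrite !sub0r !normrN => rm.
  by apply: le_trans (hr m) _; apply: le_trans rm; exact: ler_norm.
rewrite subr0 in h; apply: cvg_trans h; apply: near_eq_cvg; apply/nearW => m.
by rewrite /= opprB addrC subrK.
Qed.

(** By [mass_cvg] the product of a x with the mass of the Fejer kernel converges to a
    multiple of the inverse transform at x. A single point where a does not vanish
    forces the masses to converge, and [fejer_mass] keeps their limit away from 0, so
    the constant of the inversion formula need not be computed. *)
Lemma fourier_inversion : exists C : R, forall x,
  a x = C * \int[mu]_(t in `[(- A), A]) (cos (x * t) * u t - sin (x * t) * v t).
Proof.
have [[x1 ax1]|/forallNP a_eq0] := pselect (exists x, a x != 0); last first.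
  by exists 0 => x; rewrite mul0r; apply/eqP; have /negP := a_eq0 x; rewrite negbK.
pose k := L x1 / (c * a x1).
have ca1 : c * a x1 != 0 by rewrite mulf_neq0.
have mk : mass m @[m --> \oo] --> k.
  have h : (c * (a x1 * mass m)) * (c * a x1)^-1 @[m --> \oo] --> L x1 * (c * a x1)^-1.
    by apply: cvgMl; exact: (@mass_cvg x1).
  apply: cvg_trans h; apply: near_eq_cvg; apply/nearW => m /=.
  by rewrite mulrA mulrC mulKf.
have k0 : 0 < k.
  apply: lt_le_trans (cos1_gt0 R) _.
  rewrite -(cvg_lim (@Rhausdorff R) mk).
  apply: limr_ge; first by apply: cvgP mk.
  apply/nearW => m.
  by apply: fejer_mass; rewrite ler1n.
exists (c * k)^-1 => x.
have : c * (a x * mass m) @[m --> \oo] --> c * (a x * k).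
  by apply: cvgMr; apply: cvgMr.
move=> /(cvg_lim (@Rhausdorff R)) h1.
have /(cvg_lim (@Rhausdorff R)) h2 := @mass_cvg x.
have : L x = c * (a x * k) by rewrite -h1 -h2.
rewrite /L /spectrum => ->.
by field; rewrite c0 gt_eqF.
Qed.

End inversion.
End fourier_inversion.

(** * Slice regularity and square-integrable quaternionic functions *)

Section slice_derivative.
Variable R : realType.
Implicit Types (f : quat R -> quat R) (J : quat R).

Lemma derive1_eps (V : normedModType R) (g : R -> V) (x : R) (p : V) :
  (forall e : R, 0 < e -> exists2 d : R, 0 < d &
     forall h, `|h| <= d -> `|g (x + h) - g x - h *: p| <= e * `|h|) ->
  derive1 g x = p.
Proof.
move=> H; apply: cvg_lim; first exact: norm_hausdorff.
apply/cvgrPdist_le => e e0; have [d d0 hd] := H e e0.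
near=> h; have h0 : h != 0 by near: h; exact: nbhs_dnbhs_neq.
have hd' : `|h| <= d.
  by near: h; apply: dnbhs0_le.
have -> : p - h^-1 *: (g (h + x) - g x) = - (h^-1 *: (g (x + h) - g x - h *: p)).
  by rewrite [in RHS]scalerBr scalerA mulVf// scale1r opprB [h + x]addrC.
rewrite normrN normrZ normfV mulrC ler_pdivrMr ?normr_gt0//.
exact: hd.
Unshelve. all: by end_near. Qed.

(** Real differentiability together with the Cauchy-Riemann equation on a slice
    amounts to a left slice derivative. *)
Lemma slice_regular_diff f J : slice_regular f -> imag_units J -> slice_diff J f.
Proof.
move=> [df cr] JJ x0 y0; pose q0 := slice J x0 y0.
have /diff_locally/eqaddoP lin := df q0.
pose D := 'd f q0; pose p := D 1.
have key e : 0 < e -> exists2 d : R, 0 < d & forall x y : R,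
    `|x - x0| + `|y - y0| <= d ->
    `|f (slice J x y) - f q0 - ((x - x0) *: D 1 + (y - y0) *: D J)| <=
    e * (`|x - x0| + `|y - y0|).
  move=> e0; have /nbhs_ballP[d /= d0 hd] := lin _ e0.
  exists (d / 2); first by rewrite divr_gt0.
  move=> x y xy; pose h := slice J (x - x0) (y - y0).
  have hn : `|h| <= `|x - x0| + `|y - y0| by exact: norm_slice_le.
  have : ball (0 : quat R) d h.
    rewrite -ball_normE /ball_/= sub0r normrN.
    by apply: (le_lt_trans (le_trans hn xy)); rewrite ltr_pdivrMr// ltr_pMr// ltr1n.
  move=> /hd /=; rewrite /shift/= => h1.
  apply: le_trans (ler_wpM2l (ltW e0) hn); apply: le_trans h1.
  rewrite le_eqVlt; apply/orP; left; apply/eqP; congr (`|_|).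
  have -> : (x - x0) *: D 1 + (y - y0) *: D J = D h.
    by rewrite /h sliceE linearD !linearZ.
  have hq : h + q0 = slice J x y by rewrite /h -sliceB subrK.
  by rewrite !fctE /= hq opprD addrA.
have dx : derive1 (fun u => f (slice J u y0)) x0 = D 1.
  apply: derive1_eps => e /key[d d0 hd]; exists d => // h hle.
  have := hd (x0 + h) y0; rewrite subrr normr0 addr0 scale0r addr0.
  by rewrite addrAC subrr add0r; exact.
have dy : derive1 (fun v => f (slice J x0 v)) y0 = D J.
  apply: derive1_eps => e /key[d d0 hd]; exists d => // h hle.
  have := hd x0 (y0 + h); rewrite subrr normr0 add0r scale0r add0r.
  by rewrite addrAC subrr add0r; exact.
have DJ : D J = J * D 1.
  have := cr J JJ x0 y0; rewrite dx dy => /eqP; rewrite scaler_eq0 invr_eq0.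
  rewrite pnatr_eq0/= => /eqP /(congr1 (fun q => J * q)).
  by rewrite mulr0 mulrDr mulrA imag_unit_sqr// mulN1r => /eqP; rewrite subr_eq0 => /eqP.
exists (D 1) => e /key[d d0 hd]; exists d => // x y /hd.
by rewrite DJ slice_mull.
Qed.

End slice_derivative.

Section quaternionic_L2.
Variable R : realType.
Local Notation mu := (@lebesgue_measure R).
Implicit Types (F G : R -> quat R).

Lemma qLnorm2_sqr F : (qLnorm 2%:E F `^ 2)%E = (\int[mu]_x (`|F x| ^+ 2)%:E)%E.
Proof.
rewrite /qLnorm poweR_Lnorm//; apply: eq_integral => x _.
by rewrite /= normr_id powR_mulrn.
Qed.

Lemma qLnorm2_le F (e : R) : 0 <= e ->
  (qLnorm 2%:E F <= e%:E)%E -> (\int[mu]_x (`|F x| ^+ 2)%:E <= (e ^+ 2)%:E)%E.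
Proof.
move=> e0 h; rewrite -qLnorm2_sqr -powR_mulrn// -poweR_EFin.
by apply: gt0_ler_poweR => //; rewrite in_itv/= leey andbT ?Lnorm_ge0 ?lee_fin.
Qed.

Lemma qLnorm2_ge F (e : R) : 0 <= e ->
  (\int[mu]_x (`|F x| ^+ 2)%:E <= (e ^+ 2)%:E)%E -> (qLnorm 2%:E F <= e%:E)%E.
Proof.
move=> e0; rewrite -qLnorm2_sqr -powR_mulrn// -poweR_EFin => h.
have h2 x : (0 <= x)%E -> (((x : \bar R) `^ 2) `^ 2^-1 = x)%E.
  by move=> x0; rewrite -poweRrM divff ?poweRe1// pnatr_eq0.
rewrite -(h2 (qLnorm 2%:E F)) ?Lnorm_ge0// -(h2 e%:E) ?lee_fin//.
by apply: gt0_ler_poweR => //; rewrite ?invr_ge0// in_itv/= leey andbT ?poweR_ge0 ?lee_fin ?powR_ge0.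
Qed.

Lemma L2_cvgP (Fn : nat -> R -> quat R) F :
  (forall e : R, 0 < e -> exists k0 : nat, forall k : nat, (k0 <= k)%N ->
    (\int[mu]_x (`|Fn k x - F x| ^+ 2)%:E <= (e ^+ 2)%:E)%E) <->
  L2_cvg Fn F.
Proof.
split=> [H|].
  rewrite /L2_cvg; apply/fine_cvgP.
  have H' (e : R) : 0 < e -> \forall n \near \oo,
      (qLnorm 2%:E (fun x => Fn n x - F x)%R <= e%:E)%E.
    move=> e0; have [k0 hk] := H e e0; exists k0 => // n /= kn.
    by apply: qLnorm2_ge; [exact: ltW|exact: hk].
  have fn (e : R) x : (0 <= x)%E -> (x <= e%:E)%E -> x \is a fin_num.
    by move=> x0 xe; rewrite ge0_fin_numE// (le_lt_trans xe)// ltry.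
  split.
    by have := H' 1 ltr01; apply: filterS => n; apply: fn; exact: Lnorm_ge0.
  apply/cvgrPdist_le => e e0; have := H' e e0; apply: filterS => n hn.
  have n0 : (0 <= qLnorm 2%:E (fun x => Fn n x - F x)%R)%E by exact: Lnorm_ge0.
  rewrite /= sub0r normrN ger0_norm ?fine_ge0//.
  by rewrite -lee_fin fineK// (fn _ _ n0 hn).
move=> /fine_cvgP[fn] /cvgrPdist_le H e e0.
have [k0 _ hk] : \forall n \near \oo, (qLnorm 2%:E (fun x => Fn n x - F x)%R <= e%:E)%E.
  have := H e e0; move: fn; apply: filterS2 => n fn.
  rewrite /= sub0r normrN ger0_norm ?fine_ge0 ?Lnorm_ge0// => h.
  by rewrite -(fineK fn) lee_fin.
by exists k0 => k kk; apply: qLnorm2_le; [exact: ltW|exact: hk].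
Qed.

Definition qmeasurable F := [/\ measurable_fun [set: R] (qre \o F),
  measurable_fun [set: R] (qi \o F), measurable_fun [set: R] (qj \o F) &
  measurable_fun [set: R] (qk \o F)].

Lemma qnorm_sqr_measurable F : qmeasurable F ->
  measurable_fun [set: R] (fun x => `|F x| ^+ 2).
Proof.
move=> [m1 m2 m3 m4]; under eq_fun do rewrite sqr_qnorm.
by apply: measurable_funD; [apply: measurable_funD; [apply: measurable_funD|]|];
  exact: measurable_funX.
Qed.

Lemma qnorm_measurable F : qmeasurable F -> measurable_fun [set: R] (fun x => `|F x|).
Proof.
move=> mF; rewrite (_ : (fun x => _) = Num.sqrt \o (fun x => `|F x| ^+ 2)).
  apply: measurableT_comp; last exact: qnorm_sqr_measurable.
  apply: continuous_measurable_fun; exact: sqrt_continuous.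
by apply/funext => x /=; rewrite sqrtr_sqr normr_id.
Qed.

Lemma qLp2_sqr_integrable F : qLp 2%:E F ->
  mu.-integrable [set: R] (fun x => (`|F x| ^+ 2)%:E).
Proof.
move=> [m1 m2 m3 m4 n2]; apply/integrableP; split.
  by apply/measurable_EFinP; exact: qnorm_sqr_measurable.
under eq_integral => x _ do rewrite gee0_abs ?lee_fin ?sqr_ge0//.
by rewrite -qLnorm2_sqr poweR_lty.
Qed.

Lemma qLp2_coord (p : quat R -> R) F : (forall q, `|p q| <= `|q|) ->
  measurable_fun [set: R] (p \o F) -> qLp 2%:E F ->
  square_integrable mu [set: R] (p \o F).
Proof.
move=> pn mp hF; split => //; apply: le_integrable (qLp2_sqr_integrable hF) => //.
  by apply/measurable_EFinP; exact: measurable_funX.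
move=> x _; rewrite /= lee_fin !normrX normr_id; apply: lerXn2r; rewrite ?nnegrE//.
Qed.

End quaternionic_L2.

Section truncation.
Variable R : realType.
Local Notation mu := (@lebesgue_measure R).
Variable F : R -> quat R.
Hypotheses (c1 : continuous (qre \o F)) (c2 : continuous (qi \o F))
  (c3 : continuous (qj \o F)) (c4 : continuous (qk \o F)).
Hypothesis hF : qLp 2%:E F.

(** Integrable approximants of F in L^2, on which the extended Fourier transform is
    governed by the integral formula. *)
Definition truncation (n : nat) (x : R) : quat R :=
  \1_(`[(- n%:R), n%:R]%classic : set R) x *: F x.

Let trunc_coord (p : quat R -> R) n : (forall (a : R) q, p (a *: q) = a * p q) ->
  continuous (p \o F) -> measurable_fun [set: R] (p \o truncation n).
Proof.
move=> pZ pc.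
rewrite (_ : _ \o _ = \1_(`[(- n%:R), n%:R]%classic : set R) \* (p \o F)).
  apply: measurable_funM; first exact: measurable_indic.
  exact: continuous_measurable_fun.
by apply/funext => x /=; rewrite /truncation pZ.
Qed.

Lemma truncation_measurable n : qmeasurable (truncation n).
Proof. by split; apply: trunc_coord. Qed.

Let trunc_le n x : `|truncation n x| <= `|F x|.
Proof.
rewrite /truncation qnormZ indicE; case: (_ \in _); rewrite ?normr1 ?mul1r//.
by rewrite normr0 mul0r.
Qed.

Lemma truncation_qLp n : (qLp 1%:E `&` qLp 2%:E) (truncation n).
Proof.
have [m1 m2 m3 m4] := truncation_measurable n.
split; split => //.
- rewrite /qLnorm Lnorm1.
  have cN (p : quat R -> R) : continuous (p \o F) ->
     exists2 M : R, 0 <= M & forall x : R, - n%:R <= x <= n%:R -> `|p (F x)| <= M.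
    by move=> pc; exact: (continuous_bounded_itv _ _ pc).
  have [M1 M10 h1] := cN _ c1; have [M2 M20 h2] := cN _ c2.
  have [M3 M30 h3] := cN _ c3; have [M4 M40 h4] := cN _ c4.
  pose M := M1 + M2 + M3 + M4.
  have M0 : 0 <= M by rewrite !addr_ge0.
  pose ind : R -> R := \1_(`[(- n%:R), n%:R]%classic : set R).
  apply: (@le_lt_trans _ _ (\int[mu]_x (M * ind x)%:E)%E).
    apply: ge0_le_integral => //.
    + apply/measurable_EFinP; under eq_fun do rewrite /= normr_id.
      exact: qnorm_measurable.
    + apply/measurable_EFinP; apply: measurable_funM => //; exact: measurable_indic.
    + move=> x _; rewrite lee_fin normr_id /truncation qnormZ /ind indicE.
      have [|_] := boolP (x \in _); last by rewrite normr0 mul0r mulr0.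
      rewrite inE /= in_itv /= normr1 mul1r mulr1 => xn.
      apply: le_trans (qnorm_le_sum _) _.
      by rewrite !lerD// ?h1 ?h2 ?h3 ?h4.
  have : mu.-integrable [set: R] (fun x => (M * ind x)%:E).
    apply: rintegrableZ => //; exact: (integrable_indic_itv (- n%:R) n%:R true false).
  by move=> /(integrable_lty measurableT).
- apply: (@lty_poweRy _ _ 2) => //; rewrite qLnorm2_sqr.
  apply: (@le_lt_trans _ _ (\int[mu]_x (`|F x| ^+ 2)%:E)%E); last first.
    exact: (integrable_lty measurableT (qLp2_sqr_integrable hF)).
  have [n1 n2 n3 n4 _] := hF.
  apply: ge0_le_integral => //.
  + by apply/measurable_EFinP; exact: qnorm_sqr_measurable.
  + by apply/measurable_EFinP; exact: qnorm_sqr_measurable.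
  + move=> x _; rewrite lee_fin; apply: lerXn2r; rewrite ?nnegrE//.
Qed.

Lemma truncation_cvg : L2_cvg truncation F.
Proof.
apply/L2_cvgP => e e0.
pose D n x := `|truncation n x - F x| ^+ 2.
have Dle n x : D n x <= `|F x| ^+ 2.
  rewrite /D; apply: lerXn2r; rewrite ?nnegrE// /truncation -{2}[F x]scale1r -scalerBl.
  rewrite qnormZ indicE; case: (_ \in _); rewrite ?subrr ?normr0 ?mul0r//.
  by rewrite sub0r normrN1 mul1r.
have mD n : measurable_fun [set: R] (D n).
  have [m1 m2 m3 m4] := truncation_measurable n; have [n1 n2 n3 n4 _] := hF.
  apply: (@qnorm_sqr_measurable _ (fun x => truncation n x - F x)).
  by split; [exact: (measurable_funB m1 n1)|exact: (measurable_funB m2 n2)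
    |exact: (measurable_funB m3 n3)|exact: (measurable_funB m4 n4)].
have [] := @dominated_convergence _ _ _ mu [set: R] measurableT
  (fun n x => (D n x)%:E) (cst 0%E) _ _ _ _ (qLp2_sqr_integrable hF) _.
- by move=> n; apply/measurable_EFinP; exact: mD.
- exact: measurable_cst.
- apply/nearW => x _; apply: cvg_near_cst; near=> n.
  have xn : `|x| <= n%:R.
    near: n; exists (Num.bound `|x|) => // n /= xn.
    apply: ltW; apply: (lt_le_trans (archi_boundP (normr_ge0 x))).
    by rewrite ler_nat.
  congr EFin; rewrite /D /truncation indicE mem_set; last first.
    by rewrite /= in_itv/= -ler_norml.
  by rewrite scale1r subrr normr0 expr0n.
- by apply/nearW => x n _; rewrite /= lee_fin ger0_norm ?sqr_ge0.
move=> _ _; rewrite integral0 => /fine_cvgP[fn] /cvgrPdist_le/(_ (e ^+ 2)).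
move=> /(_ (exprn_gt0 _ e0)) h.
have [k0 _ hk] : \forall n \near \oo, (\int[mu]_x (D n x)%:E <= (e ^+ 2)%:E)%E.
  move: fn h; apply: filterS2 => n fn.
  rewrite /= sub0r normrN ger0_norm => [h|]; last first.
    by rewrite fine_ge0// integral_ge0// => x _; rewrite lee_fin sqr_ge0.
  by move: h; rewrite -lee_fin fineK.
by exists k0 => k; exact: hk.
Unshelve. all: by end_near. Qed.

End truncation.

Section quaternionic_fourier.
Variable R : realType.
Local Notation mu := (@lebesgue_measure R).

Definition unit_i : quat R := Quat 0 1 0 0.

Lemma unit_i_imag : imag_units unit_i.
Proof.
rewrite /imag_units /= expr2; apply/eqP; rewrite -subr_eq0; apply/eqP.
by apply: quat_eq0 => /=; ring.
Qed.

Lemma qexp_i (x : R) : qexp (- (unit_i * x%:A)) = Quat (cos x) (- sin x) 0 0.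
Proof.
pose z : quat R := Quat 0 (- x) 0 0.
have -> : - (unit_i * x%:A) = z.
  by rewrite /unit_i /z; congr Quat => /=; ring.
have zX n : n`!%:R^-1 *: z ^+ n = Quat (cos_coeff x n) (- sin_coeff x n) 0 0.
  have zre m : z ^+ m.*2 = ((-1) ^+ m * x ^+ m.*2)%:A.
    elim: m => [|m IH]; first by rewrite expr0 mul1r scale1r.
    rewrite doubleS !exprS IH /z.
    by congr Quat => /=; ring.
  rewrite /cos_coeff /sin_coeff /= -exprnP.
  have [no|no] := boolP (odd n); have nE := odd_double_half n.
    rewrite no add1n in nE; rewrite -nE /= uphalf_double half_double exprS zre.
    move: ((_.*2.+1)`!%:R^-1) => fi.
    by rewrite /z exprS; congr Quat => /=; ring.
  rewrite (negbTE no) add0n in nE; rewrite -nE half_double zre.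
  move: ((_.*2)`!%:R^-1) => fi.
  by congr Quat => /=; ring.
have sE : series (fun n => n`!%:R^-1 *: z ^+ n) =
    fun n => Quat (series (cos_coeff x) n) (- series (sin_coeff x) n) 0 0.
  apply/funext => n; rewrite /series/=.
  elim: n => [|n IH]; first by rewrite !big_geq// oppr0.
  by rewrite !big_nat_recr//= IH zX; congr Quat => /=; ring.
apply: cvg_lim; first exact: norm_hausdorff.
rewrite sE; apply: quat_cvg => /=.
- rewrite unlock; exact: is_cvg_series_cos_coeff.
- apply: cvgN; rewrite unlock; exact: is_cvg_series_sin_coeff.
- exact: cvg_cst.
- exact: cvg_cst.
Qed.

End quaternionic_fourier.

(** * The spectrum of a Paley-Wiener function on the real axis *)

Section spectrum_support.
Variable R : realType.
Local Notation mu := (@lebesgue_measure R).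

(** A function vanishes almost everywhere off its essential support: the
    complement is covered by countably many rational intervals of vanishing. *)
Lemma ess_support_ae (G : R -> quat R) (S : set R) : ess_support G `<=` S ->
  {ae mu, forall t, ~ S t -> G t = 0}.
Proof.
move=> GS; pose I (pq : rat * rat) : set R := [set s | ratr pq.1 < s < ratr pq.2].
pose good pq := {ae mu, forall s, I pq s -> G s = 0}.
pose B n := if unpickle n is Some pq then
  [set s | good pq /\ ~ (I pq s -> G s = 0)] else set0.
have Bn n : mu.-negligible (B n).
  rewrite /B; case: unpickle => [pq|]; last exact: negligible_set0.
  have [g|g] := pselect (good pq); first by apply: negligibleS g => s [].
  by rewrite (_ : [set _ | _] = set0); [exact: negligible_set0|apply/seteqP; split=> s []].
apply: negligibleS (negligible_bigcup Bn).
move=> t /= /not_implyP[nSt Gt].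
have : ~ ess_support G t by move=> /GS.
move=> /existsNP[U /not_implyP[tU /contrapT aeU]].
have /nbhs_ballP[e /= e0 eU] := tU.
have [p] : exists q : rat, ratr q \in `]t - e, t[ by apply: rat_in_itvoo; lra.
rewrite in_itv/= => /andP[p1 p2].
have [q] : exists q : rat, ratr q \in `]t, t + e[ by apply: rat_in_itvoo; lra.
rewrite in_itv/= => /andP[q1 q2].
have gpq : good (p, q).
  apply: (@filterS _ _ (ae_filter_ringOfSetsType mu) _ _ _ aeU) => s h /andP[/= s1 s2].
  by apply: h; apply: eU; rewrite /ball/= ltr_norml; lra.
have tB n : unpickle n = Some (p, q) -> B n t.
  rewrite /B => ->; split=> // h; apply: Gt; apply: h.
  by rewrite /I/= p2 q1.
have [n hn] : exists n, unpickle n = Some (p, q).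
  by exists (pickle (p, q)); apply: pickleK.
by exists n; [exact: Logic.I|exact: tB].
Qed.

End spectrum_support.

Section real_axis_spectrum.
Variables (R : realType) (A : R) (f : quat R -> quat R).
Hypotheses (A0 : 0 < A) (hf : paley_wiener A f).
Local Notation mu := (@lebesgue_measure R).
Local Notation F := (fun x : R => f x%:A).

Let sreg : slice_regular f. Proof. by case: hf. Qed.
Let F2 : qLp 2%:E F. Proof. by case: hf. Qed.

(** The slice derivative at a real point bounds the increments near it. *)
Let lipF x0 : exists C : R, exists2 d : R, 0 < d &
  forall x, `|x - x0| <= d -> `|F x - F x0| <= C * `|x - x0|.
Proof.
have [p hp] := slice_regular_diff sreg (unit_i_imag R) x0 0.
have [d d0 hd] := hp 1 ltr01; exists (1 + `|p|), d => // x xd.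
have := hd x 0; rewrite subrr normr0 addr0 !slice_real => /(_ xd) h.
rewrite -[X in `|X|](subrK ((x - x0)%:A * p)); apply: le_trans (ler_normD _ _) _.
by rewrite mulrDl lerD// qnormM qnormA mulrC.
Qed.

Let lip_coord (p : quat R -> R) : {morph p : a b / a - b} ->
  (forall q, `|p q| <= `|q|) -> forall x0, exists C : R, exists2 d : R, 0 < d &
  forall x, `|x - x0| <= d -> `|(p \o F) x - (p \o F) x0| <= C * `|x - x0|.
Proof.
move=> pB pn x0; have [C [d d0 hC]] := lipF x0; exists C, d => // x xd.
by rewrite /= -pB; apply: le_trans (pn _) _; exact: hC.
Qed.

Let ctn_coord (p : quat R -> R) : {morph p : a b / a - b} ->
  (forall q, `|p q| <= `|q|) -> continuous (p \o F).
Proof.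
move=> pB pn x0; have [C h] := lip_coord pB pn x0.
exact: (locally_lipschitz_continuous h).
Qed.

Let c1 : continuous (qre \o F). Proof. by apply: ctn_coord => //; exact: qre_le_norm. Qed.
Let c2 : continuous (qi \o F). Proof. by apply: ctn_coord => //; exact: qi_le_norm. Qed.
Let c3 : continuous (qj \o F). Proof. by apply: ctn_coord => //; exact: qj_le_norm. Qed.
Let c4 : continuous (qk \o F). Proof. by apply: ctn_coord => //; exact: qk_le_norm. Qed.

Let c : R := (Num.sqrt (2 * pi))^-1.

(** Left multiplication by e^(-i x t) mixes the coordinate of 1 with that of i, and
    the coordinate of j with that of k: the transform splits into two complex ones. *)
Let fourier1_truncation n t :
  fourier1 (unit_i R) (truncation F n) t =
  Quat (c * trig_transform n%:R (qre \o F) (qi \o F) t)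
       (c * trig_transform n%:R (qi \o F) (\- (qre \o F)) t)
       (c * trig_transform n%:R (qj \o F) (qk \o F) t)
       (c * trig_transform n%:R (qk \o F) (\- (qj \o F)) t).
Proof.
rewrite /fourier1 -/c /qintegral /trig_transform.
have E x : qexp (- (unit_i R * (x * t)%:A)) * truncation F n x =
  \1_(`[(- n%:R), n%:R]%classic : set R) x *: Quat
    (cos (x * t) * qre (F x) + sin (x * t) * qi (F x))
    (cos (x * t) * qi (F x) - sin (x * t) * qre (F x))
    (cos (x * t) * qj (F x) + sin (x * t) * qk (F x))
    (cos (x * t) * qk (F x) - sin (x * t) * qj (F x)).
  rewrite qexp_i /truncation -scalerAr; congr (_ *: _).
  by case: (F x) => q1 q2 q3 q4; congr Quat => /=; ring.
have P (p : quat R -> R) (g : R -> R) : (forall (a : R) q, p (a *: q) = a * p q) ->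
    (forall x, p (Quat (cos (x * t) * qre (F x) + sin (x * t) * qi (F x))
    (cos (x * t) * qi (F x) - sin (x * t) * qre (F x))
    (cos (x * t) * qj (F x) + sin (x * t) * qk (F x))
    (cos (x * t) * qk (F x) - sin (x * t) * qj (F x))) = g x) ->
    \int[mu]_x p (qexp (- (unit_i R * (x * t)%:A)) * truncation F n x) =
    \int[mu]_(x in `[(- n%:R), n%:R]) g x.
  move=> pZ pg; rewrite [RHS]Rintegral_mkcond; apply: eq_Rintegral => x _.
  rewrite E pZ pg /patch indicE; case: (x \in _); by rewrite ?mul1r ?mul0r.
by congr Quat; congr (_ * _); [apply: (P qre)|apply: (P qi)|apply: (P qj)|apply: (P qk)] => // x /=;
  rewrite ?mulrN.
Qed.

Definition band_limited_function (a : R -> R) := exists u v,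
  [/\ square_integrable mu `[(- A), A] u, square_integrable mu `[(- A), A] v &
   forall x, a x = band_transform A u v x].

Let inversion_band (a u v : R -> R) : square_integrable mu [set: R] u ->
  square_integrable mu [set: R] v ->
  (exists C : R, forall x, a x = C *
    \int[mu]_(t in `[(- A), A]) (cos (x * t) * u t - sin (x * t) * v t)) ->
  band_limited_function a.
Proof.
move=> hu hv [C hC].
have sqZ (k : R) w : square_integrable mu [set: R] w ->
    square_integrable mu `[(- A), A] (fun t => k * w t).
  move=> [mw w2]; split.
    by apply: measurable_funM => //; exact: measurable_funTS.
  have w2' : mu.-integrable `[(- A), A] (fun t => (w t ^+ 2)%:E).
    exact: integrableS w2.
  rewrite (_ : (fun t => _) = (fun t => (k ^+ 2 * w t ^+ 2)%:E)).
    exact: rintegrableZ.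
  by apply/funext => t; rewrite exprMn.
exists (fun t => C * u t), (fun t => - C * v t); split; [exact: sqZ..|].
move=> x; rewrite hC /band_transform -RintegralZl//.
  by apply: eq_Rintegral => t _; ring.
have sq1 w : square_integrable mu [set: R] w -> square_integrable mu `[(- A), A] w.
  move=> hw; have := sqZ 1 w hw; congr square_integrable.
  by apply/funext => t; rewrite mul1r.
apply: rintegrableB => //; apply: square_integrableM => //; try exact: sq1;
  apply: continuous_square_integrable; [exact: continuous_cosM|exact: continuous_sinM].
Qed.

Let trig_transformN n (a b : R -> R) t : continuous a -> continuous b ->
  trig_transform n (\- a) (\- b) t = - trig_transform n a b t.
Proof.
move=> ca cb; rewrite /trig_transform -[RHS]mulN1r -[RHS]RintegralZl//; last first.
  apply: continuous_integrable_itv => x; apply: cvgD; apply: cvgM.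
  - by apply: (continuous_comp (@mulrr_continuous _ t x)); exact: continuous_cos.
  - exact: ca.
  - by apply: (continuous_comp (@mulrr_continuous _ t x)); exact: continuous_sin.
  - exact: cb.
by apply: eq_Rintegral => x _ /=; ring.
Qed.

(** Here (p, q) is one of the two pairs of coordinates mixed by e^(-i x t). The second
    component is obtained from the first through (a, b) -> (b, - a), which is the
    multiplication of a + i b by - i. *)
Let coord_pair (p q : quat R -> R) :
  p 0 = 0 -> q 0 = 0 -> {morph p : a b / a - b} -> {morph q : a b / a - b} ->
  (forall z, `|p z| <= `|z|) -> (forall z, `|q z| <= `|z|) ->
  (forall G : R -> quat R, qmeasurable G ->
    measurable_fun [set: R] (p \o G) /\ measurable_fun [set: R] (q \o G)) ->
  (forall n t, p (fourier1 (unit_i R) (truncation F n) t) =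
     c * trig_transform n%:R (p \o F) (q \o F) t) ->
  (forall n t, q (fourier1 (unit_i R) (truncation F n) t) =
     c * trig_transform n%:R (q \o F) (\- (p \o F)) t) ->
  band_limited_function (p \o F) /\ band_limited_function (q \o F).
Proof.
move=> p0 q0 pB qB pn qn mpq pT qT.
have [_ _ /(_ _ (unit_i_imag R))[G [[G2 HG] suppG]]] := hf.
have G0 := ess_support_ae suppG.
have mG : qmeasurable G by case: G2.
have [mp mq] := mpq G mG.
have mF : qmeasurable F by case: F2.
have [mpF mqF] := mpq F mF.
have conv := HG (truncation F) (truncation_qLp c1 c2 c3 c4 F2) (truncation_cvg c1 c2 c3 c4 F2).
have c0 : c != 0.
  by rewrite invr_eq0 gt_eqF// sqrtr_gt0 mulr_gt0// pi_gt0.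
have cp := ctn_coord pB pn; have cq := ctn_coord qB qn.
have cNp : continuous (\- (p \o F)) by move=> x; apply: cvgN; exact: cp.
have mfour n : qmeasurable (fun t => fourier1 (unit_i R) (truncation F n) t - G t).
  have cNre : continuous (\- (qre \o F)) by move=> x; apply: cvgN; exact: c1.
  have cNj : continuous (\- (qj \o F)) by move=> x; apply: cvgN; exact: c3.
  have mt (a b g : R -> R) : continuous a -> continuous b ->
      measurable_fun [set: R] g ->
      measurable_fun [set: R] (fun t => c * trig_transform n%:R a b t - g t).
    move=> ca cb mg; apply: measurable_funB => //; apply: measurable_funM => //.
    by apply: continuous_measurable_fun; exact: continuous_trig_transform.
  have [m1 m2 m3 m4] := mG.
  rewrite (_ : (fun t => _) = (fun t => Quat
    (c * trig_transform n%:R (qre \o F) (qi \o F) t - qre (G t))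
    (c * trig_transform n%:R (qi \o F) (\- (qre \o F)) t - qi (G t))
    (c * trig_transform n%:R (qj \o F) (qk \o F) t - qj (G t))
    (c * trig_transform n%:R (qk \o F) (\- (qj \o F)) t - qk (G t)))); last first.
    by apply/funext => t; rewrite fourier1_truncation; case: (G t).
  by split; exact: mt.
have vanish (r : quat R -> R) : r 0 = 0 ->
    {ae mu, forall t, ~ (- A <= t <= A) -> (r \o G) t = 0}.
  move=> r0; apply: (@filterS _ _ (ae_filter_ringOfSetsType mu) _ _ _ G0) => t h tA.
  by rewrite /= h// => tA'; apply: tA; move: tA'; rewrite /= in_itv.
have mconv (r : quat R -> R) (a b : R -> R) : {morph r : a b / a - b} ->
    (forall z, `|r z| <= `|z|) -> measurable_fun [set: R] (r \o G) ->
    continuous a -> continuous b ->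
    (forall n t, r (fourier1 (unit_i R) (truncation F n) t) =
       c * trig_transform n%:R a b t) ->
    converges_in_mean (fun n t => c * trig_transform n%:R a b t - (r \o G) t).
  move=> rB rn mr ca cb rT e e0.
  have se0 : 0 < Num.sqrt e by rewrite sqrtr_gt0.
  have [k0 hk] := (L2_cvgP _ _).2 conv _ se0; exists k0 => k kk.
  have := hk k kk; rewrite sqr_sqrtr ?(ltW e0)//; apply: le_trans.
  apply: ge0_le_integral => //.
  - by move=> t _; rewrite lee_fin sqr_ge0.
  - apply/measurable_EFinP; apply: measurable_funX; apply: measurable_funB => //.
    apply: measurable_funM => //; apply: continuous_measurable_fun.
    exact: continuous_trig_transform.
  - by apply/measurable_EFinP; apply: qnorm_sqr_measurable; exact: mfour.
  - move=> t _; rewrite lee_fin -rT /= -rB -real_normK ?num_real//.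
    by apply: lerXn2r; rewrite ?nnegrE.
have conv_p := mconv p _ _ pB pn mp cp cq pT.
have conv_q := mconv q _ _ qB qn mq cq cNp qT.
have conv_Np : converges_in_mean (fun n t =>
    c * trig_transform n%:R (\- (p \o F)) (\- (q \o F)) t - (\- (p \o G)) t).
  move=> e /conv_p[k0 hk]; exists k0 => k kk; move: (hk k kk).
  congr (_ <= _)%E; apply: eq_integral => t _; congr EFin.
  by rewrite trig_transformN//=; ring.
have sp : square_integrable mu [set: R] (p \o G) by exact: qLp2_coord.
have sq : square_integrable mu [set: R] (q \o G) by exact: qLp2_coord.
have sNp : square_integrable mu [set: R] (\- (p \o G)).
  case: sp => m1 m2; split; first by apply: measurableT_comp.
  by under eq_fun do rewrite /= sqrrN.
have [_ pF2] := qLp2_coord pn mpF F2; have [_ qF2] := qLp2_coord qn mqF F2.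
split.
- apply: (inversion_band sp sq).
  apply: (@fourier_inversion _ (p \o F) (q \o F) _ _ A c) => //.
  + exact: lip_coord.
  + exact: vanish.
  + exact: vanish.
- apply: (inversion_band sq sNp).
  apply: (@fourier_inversion _ (q \o F) (\- (p \o F)) _ _ A c) => //.
  + exact: lip_coord.
  + exact: vanish.
  + apply: (@filterS _ _ (ae_filter_ringOfSetsType mu) _ _ _ (vanish p p0)) => t h tA.
    by change (- (p \o G) t = 0); rewrite h// oppr0.
Qed.

(** Left multiplication by e^(-i x t) acts separately on the span of 1, i and on the
    span of j, k, so the transform for the unit i inverts both pairs. *)
Lemma real_axis_band_limited :
  [/\ band_limited_function (qre \o F), band_limited_function (qi \o F),
     band_limited_function (qj \o F) & band_limited_function (qk \o F)].
Proof.
have [h1 h2] : band_limited_function (qre \o F) /\ band_limited_function (qi \o F).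
  apply: coord_pair => //; try exact: qre_le_norm; try exact: qi_le_norm.
  - by move=> G [].
  - by move=> n t; rewrite fourier1_truncation.
  - by move=> n t; rewrite fourier1_truncation.
have [h3 h4] : band_limited_function (qj \o F) /\ band_limited_function (qk \o F).
  apply: coord_pair => //; try exact: qj_le_norm; try exact: qk_le_norm.
  - by move=> G [].
  - by move=> n t; rewrite fourier1_truncation.
  - by move=> n t; rewrite fourier1_truncation.
by split.
Qed.

End real_axis_spectrum.

(** * Unordered sums of quaternions *)

Section sums_over_integers.
Variable R : realType.

(** A finite sum within e of the supremum leaves at most e for the other indices. *)
Lemma bounded_sum_tail (I : eqType) (b : I -> R) K : (forall k, 0 <= b k) ->
  (forall s, uniq s -> \sum_(k <- s) b k <= K) ->
  forall e, 0 < e -> exists2 s0, uniq s0 &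
    forall s, uniq s -> (forall k, k \in s -> k \notin s0) -> \sum_(k <- s) b k <= e.
Proof.
move=> b0 bK e e0.
pose E := [set x | exists2 s, uniq s & x = \sum_(k <- s) b k].
have supE : has_sup E.
  split; first by exists (\sum_(k <- [::]) b k), [::].
  by exists K => _ [s us ->]; exact: bK.
have [_ [s0 us0 ->] h0] := sup_adherent e0 supE.
exists s0 => // s us ss0.
have us' : uniq (s ++ s0).
  rewrite cat_uniq us us0 andbT /=; apply/hasPn => k ks0.
  by apply/negP => /ss0; rewrite ks0.
have : \sum_(k <- s ++ s0) b k <= sup E by apply: sup_upper_bound => //; exists (s ++ s0).
by rewrite big_cat/=; lra.
Qed.

(** The weight t lets a small second factor compensate a merely bounded first one. *)
Lemma sum_mul_le (I : Type) (s : seq I) (a b : I -> R) t : 0 < t ->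
  \sum_(k <- s) a k * b k <=
  2^-1 * (t * \sum_(k <- s) a k ^+ 2 + t^-1 * \sum_(k <- s) b k ^+ 2).
Proof.
move=> t0; rewrite !mulr_sumr -big_split/= mulr_sumr; apply: ler_sum => k _.
have : 0 <= t^-1 * (t * a k - b k) ^+ 2 by rewrite mulr_ge0 ?sqr_ge0// invr_ge0 ltW.
have -> : t^-1 * (t * a k - b k) ^+ 2 =
    t * a k ^+ 2 + t^-1 * b k ^+ 2 - 2 * (a k * b k).
  by field; rewrite gt_eqF.
lra.
Qed.

Definition symmetric_range n : seq int :=
  [seq Posz i | i <- iota 0 n] ++ [seq Negz i | i <- iota 0 n].

Lemma symmetric_range_uniq n : uniq (symmetric_range n).
Proof.
rewrite cat_uniq !map_inj_uniq ?iota_uniq//=; try by move=> ? ? [].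
by rewrite andbT; apply/hasPn => _ /mapP[i _ ->]; apply/negP => /mapP[].
Qed.

Lemma mem_symmetric_range (s : seq int) :
  exists n0, forall n, (n0 <= n)%N -> {subset s <= symmetric_range n}.
Proof.
elim: s => [|k s [n0 IH]]; first by exists 0%N.
exists (maxn n0 `|k|%N.+1) => n; rewrite geq_max => /andP[/IH h kn] j.
rewrite inE => /orP[/eqP ->|/h//]; rewrite mem_cat.
case: k kn => i /= kn; apply/orP; [left|right]; apply/mapP; exists i => //;
  by rewrite mem_iota add0n//; exact: ltnW.
Qed.

Lemma sum_symmetric_range (V : nmodType) (F : int -> V) n :
  \sum_(k <- symmetric_range n) F k = \sum_(0 <= i < n) (F (Posz i) + F (Negz i)).
Proof. by rewrite big_cat/= !big_map big_split /index_iota subn0. Qed.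

(** The sum is the limit along the symmetric ranges, which eventually contain any
    finite set s; the terms outside s then account for the distance to l. *)
Lemma quat_sum_exists (u : int -> quat R) K :
  (forall s, uniq s -> \sum_(k <- s) `|u k| <= K) ->
  exists l, forall s e, uniq s ->
    (forall s', uniq s' -> (forall k, k \in s' -> k \notin s) ->
       \sum_(k <- s') `|u k| <= e) ->
    `|l - \sum_(k <- s) u k| <= e.
Proof.
move=> uK; pose w n := u (Posz n) + u (Negz n).
pose v n := `|u (Posz n)| + `|u (Negz n)|.
have wv n : `|w n| <= v n by exact: ler_normD.
have v0 n : 0 <= v n by rewrite addr_ge0.
have cv : cvgn (series v).
  apply: nondecreasing_is_cvgn.
    by apply: nondecreasing_series => n *; exact: v0.
  exists K => _ [n _ <-]; rewrite /series/= -(sum_symmetric_range (fun k => `|u k|)).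
  exact/uK/symmetric_range_uniq.
have [l hl _] := quat_series_dominated wv cv.
exists l => s e us he; apply/ler_addgt0Pr => d d0.
have [n0 hn0] := mem_symmetric_range s.
have /cvgrPdist_le/(_ _ d0)[n1 _ hn1] := hl.
have := hn1 (maxn n0 n1) (leq_maxr _ _).
rewrite /series/= -sum_symmetric_range.
have ss := hn0 (maxn n0 n1) (leq_maxl _ _).
set r := symmetric_range _ in ss *; have ur : uniq r := symmetric_range_uniq _.
rewrite (sum_uniq_subset _ us ur ss).
rewrite -[\sum_(k <- r | _) _]big_filter; set s' := [seq k <- r | k \notin s] => h.
have us' : uniq s' by exact: filter_uniq.
have hs' : `|\sum_(k <- s') u k| <= e.
  apply: le_trans (ler_norm_sum _ _ _) _; apply: he => // k.
  by rewrite mem_filter => /andP[].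
have -> : l - \sum_(k <- s) u k = (l - (\sum_(k <- s) u k + \sum_(k <- s') u k))
    + \sum_(k <- s') u k by rewrite opprD addrA subrK.
by apply: le_trans (ler_normD _ _) _; rewrite addrC lerD.
Qed.

End sums_over_integers.

(** * The sampling series *)

Section sampling_series.
Variables (R : realType) (A : R) (f : quat R -> quat R).
Hypotheses (A0 : 0 < A) (hf : paley_wiener A f).

Definition sampling_term (k : int) (q : quat R) :=
  qsinc ((A / pi) *: q - k%:~R) * f (pi * k%:~R / A)%:A.

Let quat_int (k : int) : k%:~R = (k%:~R)%:A :> quat R.
Proof. by rewrite -[LHS](rmorph_int (in_alg (quat R))). Qed.

Lemma sampling_term_slice k J x y : sampling_term k (slice J x y) =
  qsinc (slice J (A / pi * x - k%:~R) (A / pi * y)) * f (pi * k%:~R / A)%:A.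
Proof. by rewrite /sampling_term quat_int slice_affine. Qed.

Lemma slice_hol_sampling_term J k : imag_units J -> slice_hol J (sampling_term k).
Proof.
move=> JJ; rewrite /sampling_term quat_int; apply: slice_holMr => //.
by apply: slice_hol_affine => //; exact: slice_hol_qsinc.
Qed.

Lemma samples_square_sum : exists K, forall s : seq int, uniq s ->
  \sum_(k <- s) `|f (pi * k%:~R / A)%:A| ^+ 2 <= K.
Proof.
have [[u1 [v1 [hu1 hv1 e1]]] [u2 [v2 [hu2 hv2 e2]]]
  [u3 [v3 [hu3 hv3 e3]]] [u4 [v4 [hu4 hv4 e4]]]] := real_axis_band_limited A0 hf.
eexists => s us; under eq_bigr => k _ do rewrite sqr_qnorm.
rewrite !big_split/=; apply: lerD; [apply: lerD; [apply: lerD|]|].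
- by under eq_bigr => k _ do rewrite [qre _]e1; exact: band_transform_bessel.
- by under eq_bigr => k _ do rewrite [qi _]e2; exact: band_transform_bessel.
- by under eq_bigr => k _ do rewrite [qj _]e3; exact: band_transform_bessel.
- by under eq_bigr => k _ do rewrite [qk _]e4; exact: band_transform_bessel.
Qed.

Lemma real_axis_sampling x e : 0 < e -> exists2 s : seq int, uniq s &
  forall s', uniq s' -> {subset s <= s'} ->
  `|f x%:A - \sum_(k <- s') sampling_term k x%:A| <= e.
Proof.
move=> e0; have [h1 h2 h3 h4] := real_axis_band_limited A0 hf.
have e4 : 0 < e / 4 by rewrite divr_gt0.
have coord (p : quat R -> R) : {morph p : a b / a - b} -> {morph p : a b / a + b} ->
    p 0 = 0 -> (forall (a : R) q, p (a *: q) = a * p q) ->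
    band_limited_function A (p \o (fun x : R => f x%:A)) ->
    exists2 s : seq int, uniq s & forall s', uniq s' -> {subset s <= s'} ->
    `|p (f x%:A - \sum_(k <- s') sampling_term k x%:A)| <= e / 4.
  move=> pB pD p0 pZ [u [v [hu hv ha]]].
  have [s us hs] := band_transform_sampling A0 hu hv x e4.
  exists s => // s' us' ss'; have := hs s' us' ss'; congr (_ <= _).
  congr (`| _ |); rewrite pB (big_morph p pD p0) -(ha x); congr (_ - _).
  apply: eq_bigr => k _; rewrite -(slice_real (unit_i R)) sampling_term_slice mulr0.
  rewrite slice_real qsinc_real mulr_algl pZ; congr (_ * _).
  by rewrite -(ha _).
have [s1 us1 hs1] := coord (@qre R) (fun _ _ => erefl) (fun _ _ => erefl) erefl
  (fun _ _ => erefl) h1.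
have [s2 us2 hs2] := coord (@qi R) (fun _ _ => erefl) (fun _ _ => erefl) erefl
  (fun _ _ => erefl) h2.
have [s3 us3 hs3] := coord (@qj R) (fun _ _ => erefl) (fun _ _ => erefl) erefl
  (fun _ _ => erefl) h3.
have [s4 us4 hs4] := coord (@qk R) (fun _ _ => erefl) (fun _ _ => erefl) erefl
  (fun _ _ => erefl) h4.
exists (undup (s1 ++ s2 ++ s3 ++ s4)); first exact: undup_uniq.
move=> s' us' ss'.
have sub s : {subset s <= s1 ++ s2 ++ s3 ++ s4} -> {subset s <= s'}.
  by move=> h k ks; apply: ss'; rewrite mem_undup; exact: h.
apply: le_trans (qnorm_le_sum _) _.
have -> : e = e / 4 + e / 4 + e / 4 + e / 4 by field.
by apply: lerD; [apply: lerD; [apply: lerD; [apply: hs1|apply: hs2]|apply: hs3]|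
  apply: hs4] => //; apply: sub => k ks; rewrite !mem_cat ks ?orbT.
Qed.

Lemma sampling_series_bounded M : exists K, forall J x y (s : seq int),
  imag_units J -> `|y| <= M -> uniq s ->
  \sum_(k <- s) `|sampling_term k (slice J x y)| <= K.
Proof.
have [C C0 hC] := qsinc_square_sum (A / pi * M); have [K hK] := samples_square_sum.
have Ap : 0 < A / pi by rewrite divr_gt0// pi_gt0.
exists (2^-1 * (1 * C + 1^-1 * K)) => J x y s JJ yM us.
under eq_bigr => k _ do rewrite sampling_term_slice qnormM.
apply: le_trans (sum_mul_le _ _ _ ltr01) _; rewrite ler_wpM2l// invr1 !mul1r.
apply: lerD; last exact: hK.
by apply: hC => //; rewrite normrM gtr0_norm// ler_pM2l.
Qed.

(** On a strip the squares of the sinc factors have bounded sums, and the squares of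
    the samples have small tails, both uniformly in the point. *)
Lemma sampling_series_tail M e : 0 < e -> exists2 s0 : seq int, uniq s0 &
  forall J x y (s : seq int), imag_units J -> `|y| <= M -> uniq s ->
  (forall k, k \in s -> k \notin s0) ->
  \sum_(k <- s) `|sampling_term k (slice J x y)| <= e.
Proof.
move=> e0.
have [C C0 hC] := qsinc_square_sum (A / pi * M); have [K hK] := samples_square_sum.
have Ap : 0 < A / pi by rewrite divr_gt0// pi_gt0.
have t0 : 0 < e / (C + 1) by rewrite divr_gt0// ltr_wpDl.
have te0 : 0 < e / (C + 1) * e by rewrite mulr_gt0.
have [s0 us0 hs0] := bounded_sum_tail (fun k => sqr_ge0 _) hK te0.
exists s0 => // J x y s JJ yM us ss0.
under eq_bigr => k _ do rewrite sampling_term_slice qnormM.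
apply: le_trans (sum_mul_le _ _ _ t0) _.
(* the choice of t splits e into two halves, one for each sum *)
rewrite -[e in leRHS](@mulKf _ 2)// ler_wpM2l// mulr_natl mulr2n; apply: lerD.
  apply: (@le_trans _ _ (e / (C + 1) * (C + 1))); last by rewrite divfK// gt_eqF// ltr_wpDl.
  rewrite ler_pM2l//; apply: le_trans (hC _ _ _ _ JJ _ us) _; last by rewrite lerDl.
  by rewrite normrM gtr0_norm// ler_pM2l.
apply: le_trans (ler_wpM2l _ (hs0 s us ss0)) _; first by rewrite invr_ge0 ltW.
by rewrite mulKf// gt_eqF.
Qed.

(** By the uniform tails, the sum S of the series is holomorphic on the slice of J.
    It agrees with f on the real axis by [real_axis_sampling], hence on the slice by
    the identity principle. The finite set s0 comes from the tails alone, so it does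
    not depend on J. *)
Lemma sampling_series_uniform M e : 0 < e -> exists2 s0 : seq int, uniq s0 &
  forall J x y (s : seq int), imag_units J -> `|y| <= M -> uniq s ->
  {subset s0 <= s} ->
  `|f (slice J x y) - \sum_(k <- s) sampling_term k (slice J x y)| <= e.
Proof.
move=> e0; have [s0 us0 hs0] := sampling_series_tail M e0.
exists s0 => // J x y s JJ yM us ss0.
pose total l q := forall s d, uniq s ->
  (forall s', uniq s' -> (forall k, k \in s' -> k \notin s) ->
    \sum_(k <- s') `|sampling_term k q| <= d) ->
  `|l - \sum_(k <- s) sampling_term k q| <= d.
have [S hS] : exists S : quat R -> quat R, forall x y, total (S (slice J x y)) (slice J x y).
  have ex q : exists l, (exists x y, q = slice J x y) -> total l q.
    have [[a [b ->]]|nq] := pselect (exists x y, q = slice J x y); last by exists 0.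
    have [K hK] := sampling_series_bounded `|b|.
    have [l hl] := quat_sum_exists (fun s us => hK J a b s JJ (lexx _) us).
    by exists l.
  have [S hS] := choice ex; exists S => a b; apply: hS; by exists a, b.
have Stail r d : 0 < d -> exists2 s1 : seq int, uniq s1 & forall a b s', `|b| <= r ->
    uniq s' -> {subset s1 <= s'} ->
    `|S (slice J a b) - \sum_(k <- s') sampling_term k (slice J a b)| <= d.
  move=> d0; have [s1 us1 hs1] := sampling_series_tail r d0.
  exists s1 => // a b s' br us' s1s'; apply: hS => // s'' us'' h.
  apply: hs1 => // k /h; apply: contra; exact: s1s'.
have holS : slice_hol J S.
  apply: slice_hol_lim => r d d0; have [s1 us1 hs1] := Stail r d d0.
  exists (fun q => \sum_(k <- s1) sampling_term k q).
    by apply: slice_hol_sum => // k; exact: slice_hol_sampling_term.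
  by move=> a b ar br; exact: hs1.
have holf : slice_hol J f.
  by apply: slice_diff_hol; apply: slice_regular_diff => //; case: hf.
have fS a b : f (slice J a b) = S (slice J a b).
  apply: (slice_hol_eq JJ holf holS) => z; apply/eqP.
  rewrite -subr_eq0 -normr_le0; apply/ler_addgt0Pr => d d0; rewrite add0r.
  have d2 : 0 < d / 2 by rewrite divr_gt0.
  have [s1 us1 hs1] := Stail 0 _ d2; have [s2 us2 hs2] := real_axis_sampling z d2.
  pose s3 := undup (s1 ++ s2); have us3 : uniq s3 := undup_uniq _.
  have h1 := hs1 z 0 s3; rewrite normr0 slice_real in h1.
  rewrite (splitr d); apply: le_trans (ler_distD (\sum_(k <- s3) sampling_term k z%:A) _ _) _.
  apply: lerD.
    by apply: hs2 => // k ks; rewrite mem_undup mem_cat ks orbT.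
  by rewrite distrC; apply: h1 => // k ks; rewrite mem_undup mem_cat ks.
rewrite fS; apply: hS => // s' us' h; apply: hs0 => // k /h; apply: contra; exact: ss0.
Qed.

End sampling_series.

(** * Convergence along the finite sets of indices *)

Section unordered_summation.
Variable R : realType.

Let partial_sumE (u : int -> quat R) B :
  summability.partial_sum u B = \sum_(k <- finmap.enum_fset B) u k.
Proof. by rewrite /summability.partial_sum finmap.big_seq_fsetE. Qed.

Let totally_above (P : set (finmap.finset_of (Phant int))) (s0 : seq int) :
  (forall B, {subset s0 <= finmap.enum_fset B} -> P B) -> summability.totally P.
Proof.
move=> h; exists (finmap.seq_fset tt s0) => // B /finmap.fsubsetP sB.
by apply: h => k ks; apply: sB; rewrite finmap.seq_fsetE.
Qed.

Lemma sum_cvg_seq (u : int -> quat R) l :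
  (forall e : R, 0 < e -> exists s0 : seq int, forall s, uniq s -> {subset s0 <= s} ->
     `|l - \sum_(k <- s) u k| <= e) -> sum_cvg u l.
Proof.
move=> h; have FF := @summability.totally_filter int.
apply/cvgrPdist_le => e /h[s0 hs0]; apply: (totally_above (s0 := s0)) => B sB.
by rewrite partial_sumE; apply: hs0 => //; exact: finmap.fset_uniq.
Qed.

Lemma sum_cvg_abs_unif_seq (S : set (quat R)) (u : int -> quat R -> quat R) f :
  (forall q, S q -> exists K, forall s, uniq s -> \sum_(k <- s) `|u k q| <= K) ->
  (forall e : R, 0 < e -> exists s0 : seq int, forall q s, S q -> uniq s ->
     {subset s0 <= s} -> `|f q - \sum_(k <- s) u k q| <= e) ->
  sum_cvg_abs_unif S u f.
Proof.
move=> hK h; split.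
  move=> q /hK[K uK]; rewrite /summable.
  apply: (@le_lt_trans _ _ K%:E); last exact: ltry.
  apply: ub_ereal_sup => _ [D [fD _] <-]; rewrite fsbig_finite//=.
  under eq_bigr => k _ do rewrite normr_id.
  by rewrite sumEFin lee_fin; apply: uK; exact: finmap.fset_uniq.
move=> P /uniform_nbhs[E [entE EP]].
have [e /= e0 eE] : exists2 e : R, 0 < e & [set xy | ball xy.1 e xy.2] `<=` E.
  by move: entE; rewrite -(@entourage_ballE R) => -[e e0 eE]; exists e.
have e2 : 0 < e / 2 by rewrite divr_gt0.
have [s0 hs0] := h _ e2.
apply: (totally_above (s0 := s0)) => B sB; apply: EP => q Sq; apply: eE => /=.
rewrite -ball_normE/= partial_sumE.
apply: (@le_lt_trans _ _ (e / 2)); last by lra.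
by apply: hs0 => //; exact: finmap.fset_uniq.
Qed.

Lemma quat_in_slice (q : quat R) : exists x y J, imag_units J /\ q = slice J x y.
Proof.
case: q => a b c d; pose r := Num.sqrt (b ^+ 2 + c ^+ 2 + d ^+ 2).
have n0 : 0 <= b ^+ 2 + c ^+ 2 + d ^+ 2 by rewrite !addr_ge0 ?sqr_ge0.
have [r0|r0] := eqVneq r 0.
  exists a, 0, (unit_i R); split; first exact: unit_i_imag.
  have /eqP := r0; rewrite sqrtr_eq0 => n1.
  have /eqP : b ^+ 2 + c ^+ 2 + d ^+ 2 = 0 by apply/eqP; rewrite eq_le n1 n0.
  rewrite !paddr_eq0 ?addr_ge0 ?sqr_ge0// !sqrf_eq0.
  move=> /andP[/andP[/eqP-> /eqP->] /eqP->].
  by rewrite slice_real; congr Quat => /=; rewrite ?mulr1 ?mulr0.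
have r2 : r ^+ 2 = b ^+ 2 + c ^+ 2 + d ^+ 2 by rewrite sqr_sqrtr.
exists a, r, (Quat 0 (b / r) (c / r) (d / r)); split.
  rewrite /imag_units/= expr2; congr Quat => /=; try by rewrite oppr0; ring.
  have -> : 0 * 0 - b / r * (b / r) - c / r * (c / r) - d / r * (d / r) =
    - ((b ^+ 2 + c ^+ 2 + d ^+ 2) / r ^+ 2) by field.
  by rewrite -r2 divff// expf_neq0.
rewrite sliceE; congr Quat => /=; field => //.
Qed.

End unordered_summation.

Theorem theorem4p5 (R : realType) (A : R) (f : quat R -> quat R)
    (hA : 0 < A) (hf : paley_wiener A f) :
  let term (k : int) (q : quat R) :=
    qsinc ((A / pi) *: q - k%:~R) * f (pi * k%:~R / A)%:A in
  [/\ forall q : quat R, sum_cvg (term^~ q) (f q),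
      forall M : R, 0 < M -> sum_cvg_abs_unif (strip M) term f &
      forall K : set (quat R), compact K -> sum_cvg_abs_unif K term f].
Proof.
move=> term.
have bounded_im (M : R) (S : set (quat R)) :
    (forall q, S q -> exists x y J, [/\ imag_units J, `|y| <= M & q = slice J x y]) ->
    sum_cvg_abs_unif S term f.
  move=> SM; apply: sum_cvg_abs_unif_seq => [q /SM[x [y [J [JJ yM ->]]]]|e e0].
    have [K hK] := sampling_series_bounded hA hf M.
    by exists K => s us; exact: hK.
  have [s0 us0 hs0] := sampling_series_uniform hA hf M e0.
  by exists s0 => q s /SM[x [y [J [JJ yM ->]]]] us ss0; exact: hs0.
split.
- move=> q; apply: sum_cvg_seq => e e0.
  have [x [y [J [JJ ->]]]] := quat_in_slice q.
  have [s0 us0 hs0] := sampling_series_uniform hA hf `|y| e0.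
  by exists s0 => s us ss0; exact: hs0.
- move=> M M0; apply: (bounded_im M) => q [x [y [J JJ [yM ->]]]].
  by exists x, y, J; split => //; exact: ltW.
- move=> K /compact_bounded[M [_ hM]]; apply: (bounded_im (M + 1)) => q Kq.
  have [x [y [J [JJ qE]]]] := quat_in_slice q.
  exists x, y, J; split=> //; apply: le_trans (im_le_slice JJ x y) _.
  by rewrite -qE; apply: hM => //; rewrite ltrDl.
Qed.
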